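(* In the setting described in the context (no ramified irregular singular points), let $\hat\omega$ be the $2$-form on $\widehat{\mathcal M}\times T_{\boldsymbol\theta}$ defined in the context by residues. For $i\in I_{\mathrm{un}}$ and $0\le l\le n_i-2$ one has $\hat\omega(\delta^{\mathrm{IMD}}_{\theta^\pm_{l,t_i}},\hat\delta)=0$ for any vector field $\hat\delta$ on $\widehat{\mathcal M}\times T_{\boldsymbol\theta}$. Moreover, for $i\in\{3,\dots,\nu\}$, one has $\hat\omega(\delta^{\mathrm{IMD}}_{t_i},\hat\delta)=0$ for any vector field $\hat\delta$ on $\widehat{\mathcal M}\times T_{\boldsymbol\theta}$.
   Context: **Setting (no ramified points).** Let $\nu\ge 2$, $I=\{1,\dots,\nu,\infty\}$, $t_1=0$, $t_2=1$, $t_\infty=\infty\in\mathbb P^1$. Let $n_i\ge1$ ($i\in I$) be integers, $n=\sum_{i\in I}n_i$, and $I=I_{\mathrm{reg}}\sqcup I_{\mathrm{un}}$ with $n_i=1$ for $i\in I_{\mathrm{reg}}$, $n_i>1$ for $i\in I_{\mathrm{un}}$. Let $x$ be the affine coordinate on $U_0=\mathbb P^1\setminus\{\infty\}$, $w=1/x$ the coordinate on $U_\infty=\mathbb P^1\setminus\{0\}$; $x_{t_i}=x-t_i$ for $i\ne\infty$, $x_{t_\infty}=w$. Let $T_{\boldsymbol t}$ be the set of $\boldsymbol t=(t_3,\dots,t_\nu)\in\mathbb C^{\nu-2}$ with $t_i\ne t_j$ for $i\neq j$ and $t_i\notin\{0,1\}$. Let $T_{\boldsymbol\theta}$ be the set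 of tuples $\boldsymbol\theta=(\theta^{\pm}_{l,t_i})_{i\in I_{\mathrm{un}},\,0\le l\le n_i-2}$ of complex numbers with $\theta^+_{0,t_i}\ne\theta^-_{0,t_i}$. Fix constants $\boldsymbol\theta_0=(\theta^\pm_{n_i-1,t_i})_{i\in I}$ with $\sum_{i\in I}(\theta^+_{n_i-1,t_i}+\theta^-_{n_i-1,t_i})=-1$ and $\theta^+_{0,t_i}-\theta^-_{0,t_i}\notin\mathbb Z$ for $i\in I_{\mathrm{reg}}$. Let $\widehat{\mathcal M}$ be the set of $(\{(q_1,p_1),\dots,(q_{n-3},p_{n-3})\},\boldsymbol t)\in\mathrm{Sym}^{(n-3)}(\mathbb C^2)\times T_{\boldsymbol t}$ with the $q_j$ pairwise distinct and $q_j\notin\{0,1,t_3,\dots,t_\nu,\infty\}$. Put $P(x)=\prod_{i=1}^\nu(x-t_i)^{n_i}$. **Bundles, local data.** $E_k=\mathcal O_{\mathbb P^1}\oplus\mathcal O_{\mathbb P^1}(k)$ is given by trivializations on $U_0,U_\infty$ with transition matrix $G_k=\mathrm{diag}(1,x^k)$ from $U_\infty$ to $U_0$; a connection $d+\Omega$ on $U_0$ reads $d+G_k^{-1}dG_k+G_k^{-1}\Omega G_k$ on $U_\infty$. A connection matrix $\Omega$ at $t_i$ (the one on $U_\infty$ if $i=\infty$) has local formal data $(\theta^\pm_{l,t_i})_{0\le l\le n_i-1}$ if there is $M\in GL_2(\mathbb C[[x_{t_i}]])$ with $M^{-1}dM+M^{-1}\Omega M=\sum_{l=0}^{n_i-1}\mathrm{diag}(\theta^+_{l,t_i},\theta^-_{l,t_i})\,x_{t_i}^{-n_i+l}dx_{t_i}$.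 **Normal form (Diarra–Loray).** For each point of $\widehat{\mathcal M}\times T_{\boldsymbol\theta}$ there is a unique connection $d+\widehat\Omega^{(n-2)}$ on $E_{n-2}$, with $\widehat\Omega^{(n-2)}=\begin{pmatrix}0&1/P(x)\\ c_0(x)&d_0(x)\end{pmatrix}dx$ on $U_0$, $$c_0=\sum_{i=1}^\nu\frac{C_i(x)}{(x-t_i)^{n_i}}+\sum_{j=1}^{n-3}\frac{p_j}{x-q_j}+\tilde C(x)+x^{n-3}C_\infty(x),\qquad d_0=\sum_{i=1}^\nu\frac{D_i(x)}{(x-t_i)^{n_i}}-\sum_{j=1}^{n-3}\frac1{x-q_j}+D_\infty(x),$$ $C_i,D_i,C_\infty,D_\infty,\tilde C$ polynomials in $x$ with $\deg C_i,\deg D_i\le n_i-1$ ($i\le\nu$), $\deg C_\infty\le n_\infty-1$, $\deg D_\infty\le n_\infty-2$, $\deg\tilde C\le n-4$, such that (a) each $q_j$ is an apparent singularity, i.e. with $\tilde\Phi_{q_j}=\begin{pmatrix}1&0\\ p_j&x-q_j\end{pmatrix}$ the matrix $\tilde\Phi_{q_j}^{-1}d\tilde\Phi_{q_j}+\tilde\Phi_{q_j}^{-1}\widehat\Omega^{(n-2)}\tilde\Phi_{q_j}$ has no pole at $q_j$, and (b) its local formal data at every $t_i$, $i\in I$, is given by $(\boldsymbol\theta,\boldsymbol\theta_0)$. Write $\widehat\Omega^{(n-2)}_\infty=G_{n-2}^{-1}dG_{n-2}+G_{n-2}^{-1}\widehat\Omega^{(n-2)}G_{n-2}$. Let $Q_1(x)=\prod_{j}(x-q_j)$,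 $Q_2$ the polynomial of degree $\le n-4$ with $Q_2(q_j)=p_j$, $\tilde G=\begin{pmatrix}1&0\\ Q_2&Q_1\end{pmatrix}$, $\tilde G_\infty=G_{n-2}^{-1}\tilde G G_1$. Then $\widehat\Omega^{(1)}=\tilde G^{-1}d\tilde G+\tilde G^{-1}\widehat\Omega^{(n-2)}\tilde G$ defines a connection $\widehat\nabla^{(1)}$ on $E_1$ with polar divisor $\sum_{i\in I}n_it_i$. **Formal solutions.** For $i\in I$ let $\Phi_i\in GL_2$ (compatible framing), depending only on $(\boldsymbol t,\boldsymbol\theta)$, be such that $\Phi_i^{-1}\widehat\Omega^{(n-2)}\Phi_i$ has leading coefficient $\mathrm{diag}(\theta^+_{0,t_i},\theta^-_{0,t_i})$ of $x_{t_i}^{-n_i}dx_{t_i}$ (use $\widehat\Omega^{(n-2)}_\infty$ if $i=\infty$). There are unique functions $\theta^\pm_{l,t_i}$ ($l\ge n_i$) on $\widehat{\mathcal M}\times T_{\boldsymbol\theta}$ and a unique formal series $\Xi_i=\mathrm{id}+\sum_{s\ge1}\begin{pmatrix}0&*\\ *&0\end{pmatrix}x_{t_i}^s$ such that $\psi_i=\Phi_i\,\Xi_i(x_{t_i})\exp(-\Lambda_i(x_{t_i}))$, $\Lambda_i=\mathrm{diag}(\hat\lambda_i^+,\hat\lambda_i^-)$, $\hat\lambda_i^\pm=\sum_{l\ge0}\theta^\pm_{l,t_i}\int x_{t_i}^{-n_i+l}dx_{t_i}$, is a formal fundamental solution of $(d+\widehat\Omega^{(n-2)})\psi_i=0$ at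 $t_i$. At $q_j$ let $\psi_{q_j}=\begin{pmatrix}1&0\\ p_j&1\end{pmatrix}\Xi_{q_j}(x)\,\mathrm{diag}(1,x-q_j)$, with $\Xi_{q_j}$ a convergent power series in $x-q_j$, $\Xi_{q_j}(q_j)=\mathrm{id}$, be a fundamental solution of $(d+\widehat\Omega^{(n-2)})\psi_{q_j}=0$. **The 2-form $\hat\omega$.** A vector field $\hat\delta$ on $\widehat{\mathcal M}\times T_{\boldsymbol\theta}$ acts on matrices depending on $x$ and on the parameters with $x$ fixed (so $\hat\delta(x_{t_i})=-\hat\delta(t_i)$ for $i\ne\infty$). Put $\hat\delta(A)\wedge\hat\delta(\psi)\psi^{-1}=\hat\delta_1(A)\hat\delta_2(\psi)\psi^{-1}-\hat\delta_1(\psi)\psi^{-1}\hat\delta_2(A)$ and $$\hat\omega(\hat\delta_1,\hat\delta_2)=\tfrac12\sum_{i\in I}\mathrm{res}_{x=t_i}\mathrm{Tr}\big(\hat\delta(\widehat\Omega^{(n-2)})\wedge\hat\delta(\psi_i)\psi_i^{-1}\big)+\tfrac12\sum_{j=1}^{n-3}\mathrm{res}_{x=q_j}\mathrm{Tr}\big(\hat\delta(\widehat\Omega^{(n-2)})\wedge\hat\delta(\psi_{q_j})\psi_{q_j}^{-1}\big)$$ (with $\widehat\Omega^{(n-2)}_\infty$ for $i=\infty$); this is independent of the choices of $\psi_i,\psi_{q_j}$. **Vector fields $\delta^{\mathrm{IMD}}_s$.** Let $s$ be one of the coordinates $\theta^\pm_{l,t_i}$ ($i\in I_{\mathrm{un}}$,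 $0\le l\le n_i-2$) or $t_i$ ($3\le i\le\nu$), and let $i$ be the corresponding index. Put $B_{\theta^+_{l,t_i}}=\frac{x_{t_i}^{-(n_i-l-1)}}{-n_i+l+1}\mathrm{diag}(1,0)$, $B_{\theta^-_{l,t_i}}=\frac{x_{t_i}^{-(n_i-l-1)}}{-n_i+l+1}\mathrm{diag}(0,1)$, $B_{t_i}=-\sum_{l=0}^{n_i-1}\mathrm{diag}(\theta^+_{l,t_i},\theta^-_{l,t_i})(x-t_i)^{-(n_i-l)}$. Let $P_i$ be the truncation, up to and including the $x_{t_i}^{2n_i-1}$-term, of the expansion of $\tilde G^{-1}\Phi_i\Xi_i$ (of $\tilde G_\infty^{-1}\Phi_\infty\Xi_\infty$ if $i=\infty$). Let $\hat U$ be an open neighbourhood of the section $t_i$ in $\mathbb P^1\times(\widehat{\mathcal M}\times T_{\boldsymbol\theta})$, not meeting $t_k$, $k\ne i$, on which $P_i$ is invertible, and $V$ the complement of the section $t_i$; $\mathfrak B_s=P_iB_sP_i^{-1}$ is an endomorphism of $E_1$ over $\hat U\cap V$ (in the $U_0$-frame, resp. the $U_\infty$-frame if $i=\infty$). Glue the trivial extensions over $\mathbb C[\epsilon]$ ($\epsilon^2=0$) of $E_1|_{\hat U}$ and $E_1|_V$ by $\mathrm{id}+\epsilon\mathfrak B_s$ (from $\hat U$ to $V$), and equip the result with the relative connection equal to $\widehat\nabla^{(1)}$ on $V$ and to $\widehat\nabla^{(1)}+\epsilon[\widehat\nabla^{(1)},\mathfrak B_s]$ on $\hat U$. This is a family of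 connections over $(\widehat{\mathcal M}\times T_{\boldsymbol\theta})\times\mathrm{Spec}\,\mathbb C[\epsilon]$ whose singular points and local formal data are those of $\widehat\nabla^{(1)}$ with $s$ replaced by $s+\epsilon$ (all other $t,\theta$ unchanged). As $H^1(\mathbb P^1,\mathcal End(E_1))=0$, the bundle is isomorphic to $E_1\otimes\mathbb C[\epsilon]$ by an isomorphism reducing to the identity mod $\epsilon$, so the connection can be written over $U_0$ as $d+\begin{pmatrix}A&B\\ C&D\end{pmatrix}\frac{dx}{P^\epsilon}$ with $P^\epsilon$ the deformed $P$. Its apparent singularities $q_j^\epsilon$ are the zeros of $B$, and its dual parameters are $p_j^\epsilon=A(q_j^\epsilon)$. Then $\delta^{\mathrm{IMD}}_s$ is the vector field on $\widehat{\mathcal M}\times T_{\boldsymbol\theta}$ with $\delta^{\mathrm{IMD}}_s(s)=1$, zero on the other coordinates among $\boldsymbol t,\boldsymbol\theta$, and $q_j^\epsilon=q_j+\epsilon\,\delta_s^{\mathrm{IMD}}(q_j)$, $p_j^\epsilon=p_j+\epsilon\,\delta_s^{\mathrm{IMD}}(p_j)$. *)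

(* Defs.v *)
From HB Require Import structures.
From mathcomp Require Import all_boot all_order all_algebra all_fingroup.
From mathcomp Require Import fraction.
From mathcomp Require Import all_classical all_reals all_analysis.
Import numFieldNormedType.Exports.
From mathcomp Require Import generic_quotient.
From mathcomp Require Import zify.

Set Implicit Arguments.
Unset Strict Implicit.
Unset Printing Implicit Defensive.

Import Order.TTheory GRing.Theory Num.Theory.
Local Open Scope ring_scope.

(* Formal Laurent series sum_k f_k z^k with finitely many negative terms.  They
   carry all expansions at a point of P^1; z is the local parameter there. *)
Record laurent (K : nmodType) := Laurent {
  lcoef :> int -> K;
  laurent_bound : exists N : int, forall k : int, (k < N)%R -> lcoef k = 0 }.

Section LaurentRing.
Variable K : comNzRingType.
Implicit Types f g h : laurent K.

Lemma laurentP f g : (forall k, f k = g k) -> f = g.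
Proof.
case: f g => [f pf] [g pg] /= /funext fg; subst g.
by congr Laurent; exact: Prop_irrelevance.
Qed.

HB.instance Definition _ := gen_eqMixin (laurent K).
HB.instance Definition _ := gen_choiceMixin (laurent K).

Lemma laurent0_bound : exists N : int, forall k : int, (k < N)%R -> (0 : K) = 0.
Proof. by exists 0. Qed.
Definition laurent0 := @Laurent K (fun=> 0) laurent0_bound.

Lemma laurentN_bound f : exists N : int, forall k : int, (k < N)%R -> - f k = 0.
Proof. by have [N fN] := laurent_bound f; exists N => k /fN ->; rewrite oppr0. Qed.
Definition laurentN f := Laurent (laurentN_bound f).

Lemma laurentD_bound f g :
  exists N : int, forall k : int, (k < N)%R -> f k + g k = 0.
Proof.
have [M fM] := laurent_bound f; have [N gN] := laurent_bound g.
by exists (Num.min M N) => k; rewrite lt_min => /andP[/fM -> /gN ->]; rewrite addr0.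
Qed.
Definition laurentD f g := Laurent (laurentD_bound f g).

Lemma laurent_addA : associative laurentD.
Proof. by move=> f g h; apply: laurentP => k; rewrite /= addrA. Qed.
Lemma laurent_addC : commutative laurentD.
Proof. by move=> f g; apply: laurentP => k; rewrite /= addrC. Qed.
Lemma laurent_add0 : left_id laurent0 laurentD.
Proof. by move=> f; apply: laurentP => k; rewrite /= add0r. Qed.
Lemma laurent_addN : left_inverse laurent0 laurentN laurentD.
Proof. by move=> f; apply: laurentP => k; rewrite /= addNr. Qed.

HB.instance Definition _ := GRing.isZmodule.Build (laurent K)
  laurent_addA laurent_addC laurent_add0 laurent_addN.

(* For each k only finitely many i contribute. *)
Definition laurent_conv f g (k : int) : K :=
  \sum_(i \in [set: int]) f i * g (k - i).

Lemma laurent_convE f g (M N : int) (a : nat) :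
    (forall k : int, (k < M)%R -> f k = 0) -> (forall k : int, (k < N)%R -> g k = 0) ->
  laurent_conv f g (M + N + a%:Z) =
  \sum_(j < a.+1) f (M + j%:Z) * g (N + (a - j)%N%:Z).
Proof.
move=> fM gN.
rewrite (fsbig_ord _ a.+1 (fun j : nat => f (M + j%:Z) * g (N + (a - j)%N%:Z))).
rewrite /laurent_conv.
rewrite -(@fsbig_widen _ _ _ _ ((fun j : nat => M + j%:Z) @` `I_a.+1)) //.
  rewrite fsbig_image; last first.
    by move=> i j _ _ /addrI[].
  apply: eq_fsbigr => j; rewrite inE /= => ja.
  by congr (_ * g _); lia.
move=> i [_ /= Hi].
have [iM|Mi] := ltP i M; first by rewrite fM // mul0r.
have [iN|Ni] := ltP (M + N + a%:Z - i) N; first by rewrite [X in _ * X]gN // mulr0.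
case: Hi; exists (absz (i - M)%R); lia.
Qed.

Lemma laurent_conv_lt f g (M N : int) k :
    (forall k : int, (k < M)%R -> f k = 0) -> (forall k : int, (k < N)%R -> g k = 0) ->
  (k < M + N)%R -> laurent_conv f g k = 0.
Proof.
move=> fM gN kMN; apply: fsbig1 => i _.
have [iM|Mi] := ltP i M; first by rewrite fM // mul0r.
by rewrite [X in _ * X]gN ?mulr0 //; lia.
Qed.

Lemma laurentM_bound f g :
  exists N : int, forall k : int, (k < N)%R -> laurent_conv f g k = 0.
Proof.
have [M fM] := laurent_bound f; have [N gN] := laurent_bound g.
by exists (M + N) => k; apply: laurent_conv_lt.
Qed.
Definition laurentM f g := Laurent (laurentM_bound f g).

(* Truncation of z^(-M) f, for comparison with polynomial products. *)
Let tr (n : nat) (M : int) f : {poly K} := \poly_(i < n) f (M + i%:Z).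

Let trM n f g (M N : int) (a : nat) : (a < n)%N ->
    (forall k : int, (k < M)%R -> f k = 0) -> (forall k : int, (k < N)%R -> g k = 0) ->
  laurentM f g (M + N + a%:Z) = (tr n M f * tr n N g)`_a.
Proof.
move=> an fM gN; rewrite /= laurent_convE // coefM; apply: eq_bigr => j _.
by rewrite !coef_poly !ifT //; have := ltn_ord j; lia.
Qed.

Let coefM_low (n : nat) (p p' q : {poly K}) (a : nat) : (a < n)%N ->
  (forall i, (i < n)%N -> p`_i = p'`_i) -> (p * q)`_a = (p' * q)`_a.
Proof.
move=> an pp; rewrite !coefM; apply: eq_bigr => j _; rewrite pp //.
by have := ltn_ord j; lia.
Qed.

Lemma laurent_mulC : commutative laurentM.
Proof.
move=> f g; apply: laurentP => k.
have [M fM] := laurent_bound f; have [N gN] := laurent_bound g.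
have [kl|kg] := ltP k (M + N).
  by rewrite /= (laurent_conv_lt fM gN kl) (laurent_conv_lt gN fM) // addrC.
have -> : k = M + N + (absz (k - (M + N))%R)%:Z by lia.
rewrite (trM (ltnSn _) fM gN) mulrC (addrC M N).
by rewrite (trM (ltnSn _) gN fM).
Qed.

Lemma laurent_mulA : associative laurentM.
Proof.
move=> f g h; apply: laurentP => k.
have [M fM] := laurent_bound f; have [N gN] := laurent_bound g.
have [P hP] := laurent_bound h.
have fgMN (l : int) : (l < M + N)%R -> laurentM f g l = 0 by apply: laurent_conv_lt.
have ghNP (l : int) : (l < N + P)%R -> laurentM g h l = 0 by apply: laurent_conv_lt.
have [kl|kg] := ltP k (M + N + P).
  by rewrite /= (laurent_conv_lt fgMN hP kl) (laurent_conv_lt fM ghNP) // addrA.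
set a := (absz (k - (M + N + P))%R).
have -> : k = M + N + P + a%:Z by rewrite /a; lia.
rewrite (trM (ltnSn a) fgMN hP) -(addrA M N P) (trM (ltnSn a) fM ghNP).
rewrite [tr _ M f * _]mulrC (@coefM_low a.+1 (tr a.+1 (N + P) _) (tr a.+1 N g * tr a.+1 P h)) //; last first.
  by move=> i ia; rewrite -(trM ia gN hP) coef_poly ia.
rewrite (@coefM_low a.+1 (tr a.+1 (M + N) _) (tr a.+1 M f * tr a.+1 N g)) //; last first.
  by move=> i ia; rewrite -(trM ia fM gN) coef_poly ia.
by rewrite mulrC mulrA.
Qed.

Lemma laurent_mulDl : left_distributive laurentM laurentD.
Proof.
move=> f g h; apply: laurentP => k.
have [M fM] := laurent_bound f; have [N gN] := laurent_bound g.
have [P hP] := laurent_bound h.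
pose Q := Num.min M N.
have fQ (l : int) : (l < Q)%R -> f l = 0 by move=> lQ; apply: fM; rewrite /Q in lQ; lia.
have gQ (l : int) : (l < Q)%R -> g l = 0 by move=> lQ; apply: gN; rewrite /Q in lQ; lia.
have fgQ (l : int) : (l < Q)%R -> laurentD f g l = 0 by move=> lQ /=; rewrite fQ ?gQ ?addr0.
have [kl|kg] := ltP k (Q + P).
  rewrite /= (laurent_conv_lt fgQ hP kl) (laurent_conv_lt fQ hP kl).
  by rewrite (laurent_conv_lt gQ hP kl) addr0.
set a := (absz (k - (Q + P))%R).
have -> : k = Q + P + a%:Z by rewrite /a; lia.
rewrite [LHS](laurent_convE a fgQ hP) /= (laurent_convE a fQ hP).
rewrite (laurent_convE a gQ hP) -big_split /=; apply: eq_bigr => j _.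
by rewrite mulrDl.
Qed.

Lemma laurentX_bound (c : K) (n : int) :
  exists N : int, forall k : int, (k < N)%R -> (if k == n then c else 0) = 0.
Proof. by exists n => k kn; rewrite ifF //; lia. Qed.

(* c z^n *)
Definition lmonom (c : K) (n : int) := Laurent (laurentX_bound c n).

Lemma laurent_mul1 : left_id (lmonom 1 0) laurentM.
Proof.
move=> f; apply: laurentP => k.
have [M fM] := laurent_bound f.
have o0 l : (l < 0)%R -> lmonom 1 0 l = 0 by move=> l0 /=; rewrite ifF //; lia.
have [kl|kg] := ltP k M.
  by rewrite /= (laurent_conv_lt o0 fM) ?fM // add0r.
have -> : k = 0 + M + (absz (k - M)%R)%:Z by lia.
rewrite [LHS](laurent_convE _ o0 fM) big_ord_recl /= mul1r big1 ?addr0.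
  by rewrite subn0 add0r.
by move=> i _; rewrite mul0r.
Qed.

Lemma laurent_1neq0 : lmonom 1 0 != laurent0.
Proof.
by apply/eqP => /(congr1 (fun f : laurent K => f 0)) /= /eqP; rewrite oner_eq0.
Qed.

HB.instance Definition _ := GRing.Zmodule_isComNzRing.Build (laurent K)
  laurent_mulA laurent_mulC laurent_mul1 laurent_mulDl laurent_1neq0.

Lemma lcoefM f g k : (f * g) k = laurent_conv f g k.
Proof. by []. Qed.

End LaurentRing.

Section LaurentField.
Variable K : fieldType.
Implicit Types f g : laurent K.

Let lunit f := `[< exists g, g * f = 1 >].
Let linv f := if pselect (exists g, g * f = 1) is left ex
  then projT1 (cid ex) else f.

Let linv_mul : {in lunit, left_inverse 1 linv *%R}.
Proof.
move=> f /asboolP ex; rewrite /linv; case: pselect => // ex'.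
exact: (projT2 (cid ex')).
Qed.

Let lunitP f g : g * f = 1 -> lunit f.
Proof. by move=> gf; apply/asboolP; exists g. Qed.

Let linv_out : {in [predC lunit], linv =1 id}.
Proof.
move=> f; rewrite inE /= => /asboolP nex; rewrite /linv.
by case: pselect => // /nex.
Qed.

HB.instance Definition _ := GRing.ComNzRing_hasMulInverse.Build (laurent K)
  linv_mul lunitP linv_out.

(* coefficients of the inverse of sum_k u_k z^k, when u_0 <> 0 *)
Fixpoint inv_coefs (u : nat -> K) (n : nat) : seq K :=
  if n is m.+1 then
    let s := inv_coefs u m in
    rcons s ((u 0%N)^-1 *
      ((m == 0%N)%:R - \sum_(j < m) u j.+1 * s`_(m - j.+1)))
  else [::].

Lemma size_inv_coefs u n : size (inv_coefs u n) = n.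
Proof. by elim: n => //= n IHn; rewrite size_rcons IHn. Qed.

Lemma inv_coefs_nth u n j : (j < n)%N ->
  (inv_coefs u n)`_j = (inv_coefs u j.+1)`_j.
Proof.
elim: n => // n IHn; rewrite ltnS leq_eqVlt => /orP[/eqP -> //|jn].
by rewrite -(IHn jn) nth_rcons size_inv_coefs jn.
Qed.

Lemma inv_coefsE u (a : nat) : u 0%N != 0 ->
  \sum_(j < a.+1) u j * (inv_coefs u (a - j).+1)`_(a - j) = (a == 0%N)%:R.
Proof.
move=> u0; have lastE : (inv_coefs u a.+1)`_a = (u 0%N)^-1 *
    ((a == 0%N)%:R - \sum_(j < a) u j.+1 * (inv_coefs u a)`_(a - j.+1)).
  by rewrite /= nth_rcons size_inv_coefs ltnn eqxx.
rewrite big_ord_recl subn0 lastE mulrA divff // mul1r -[RHS](subrK (\sum_(j < a) u j.+1 * (inv_coefs u a)`_(a - j.+1))).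
congr (_ + _); apply: eq_bigr => j _; rewrite /= /bump /= add1n.
congr (_ * _); apply/esym/inv_coefs_nth; have := ltn_ord j; lia.
Qed.

Lemma laurent_field_axiom f : f != 0 -> f \is a GRing.unit.
Proof.
move=> f0.
have [N fN] := laurent_bound f.
have ex : exists j : nat, f (N + j%:Z) != 0.
  apply: contrapT => nex; case/eqP: f0; apply: laurentP => k.
  have [/fN //|Nk] := ltP k N.
  apply: contrapT => /eqP fk; apply: nex; exists (absz (k - N)%R).
  by rewrite (_ : N + _ = k) //; lia.
pose m := ex_minn ex; pose M := N + m%:Z.
have fM0 : f M != 0 by rewrite /M /m; case: ex_minnP.
have fM k : (k < M)%R -> f k = 0.
  move=> kM; have [/fN //|Nk] := ltP k N.
  apply: contrapT => /eqP fk; move: kM; rewrite /M /m; case: ex_minnP => j _.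
  move=> /(_ (absz (k - N)%R)); rewrite (_ : N + _ = k); last by lia.
  by move=> /(_ fk); lia.
pose u (j : nat) := f (M + j%:Z).
pose c (k : int) : K := if k + M is Posz j then (inv_coefs u j.+1)`_j else 0.
have cM k : (k < - M)%R -> c k = 0 by rewrite /c; case E: (k + M) => [j|//]; lia.
pose g := Laurent (ex_intro _ (- M) cM).
apply: (@lunitP f g); rewrite mulrC; apply: laurentP => k.
rewrite lcoefM /=.
have [k0|k0] := ltP k 0.
  by rewrite (@laurent_conv_lt _ f g M (- M)) // ?subrr // ifF //; lia.
have kE : k = M - M + (absz (k)%R)%:Z by lia.
rewrite {1}kE (@laurent_convE _ f g) //.
have -> : (if k == 0 then 1 else 0) = ((absz (k)%R) == 0%N)%:R :> K.
  by rewrite -(absz_eq0 k); case: eqP.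
rewrite -(@inv_coefsE u); last by rewrite /u addr0.
apply: eq_bigr => j _; congr (_ * _).
by rewrite /= /c (_ : - M + _ + M = (`|k| - j)%N%:Z) //; lia.
Qed.

HB.instance Definition _ := GRing.ComUnitRing_isField.Build (laurent K)
  laurent_field_axiom.

End LaurentField.

(* Dual numbers A[eps], eps^2 = 0. *)
Record dual (A : Type) := Dual { dre : A; deps : A }.

Section DualRing.
Variable A : comNzRingType.
Implicit Types x y : dual A.

HB.instance Definition _ := gen_eqMixin (dual A).
HB.instance Definition _ := gen_choiceMixin (dual A).

Definition dual0 : dual A := Dual 0 0.
Definition dual1 : dual A := Dual 1 0.
Definition dualN x := Dual (- dre x) (- deps x).
Definition dualD x y := Dual (dre x + dre y) (deps x + deps y).
Definition dualM x y :=
  Dual (dre x * dre y) (dre x * deps y + deps x * dre y).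

Lemma dual_addA : associative dualD.
Proof. by move=> x y z; rewrite /dualD /= !addrA. Qed.
Lemma dual_addC : commutative dualD.
Proof. by move=> x y; rewrite /dualD addrC [deps x + _]addrC. Qed.
Lemma dual_add0 : left_id dual0 dualD.
Proof. by case=> a b; rewrite /dualD /= !add0r. Qed.
Lemma dual_addN : left_inverse dual0 dualN dualD.
Proof. by move=> x; rewrite /dualD /= !addNr. Qed.

HB.instance Definition _ := GRing.isZmodule.Build (dual A)
  dual_addA dual_addC dual_add0 dual_addN.

Lemma dual_mulA : associative dualM.
Proof.
by move=> x y z; rewrite /dualM /= mulrDr mulrDl !mulrA addrA.
Qed.
Lemma dual_mulC : commutative dualM.
Proof.
move=> x y; rewrite /dualM mulrC [dre x * deps y]mulrC [deps x * _]mulrC.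
by rewrite addrC.
Qed.
Lemma dual_mul1 : left_id dual1 dualM.
Proof. by case=> a b; rewrite /dualM /= !mul1r mul0r addr0. Qed.
Lemma dual_mulDl : left_distributive dualM dualD.
Proof. by move=> x y z; rewrite /dualM /dualD /= !mulrDl addrACA. Qed.
Lemma dual_1neq0 : dual1 != 0.
Proof. by apply/eqP => -[] /eqP; rewrite oner_eq0. Qed.

HB.instance Definition _ := GRing.Zmodule_isComNzRing.Build (dual A)
  dual_mulA dual_mulC dual_mul1 dual_mulDl dual_1neq0.
End DualRing.

Section DualUnit.
Variable A : comUnitRingType.
Implicit Types x y : dual A.

Definition dual_unit x := dre x \is a GRing.unit.
Definition dual_inv x :=
  if dual_unit x then Dual (dre x)^-1 (- (deps x / dre x ^+ 2)) else x.

Lemma dual_mulV : {in dual_unit, left_inverse 1 dual_inv *%R}.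
Proof.
move=> x ux; rewrite /dual_inv [dual_unit x]ux.
apply: (congr2 (@Dual A)) => /=; first by rewrite mulVr.
rewrite mulNr expr2 invrM // mulrA divrK // [_^-1 * _]mulrC subrr //.
Qed.
Lemma dual_unitP x y : y * x = 1 -> dual_unit x.
Proof. by case=> yx _; apply/unitrPr; exists (dre y); rewrite mulrC. Qed.
Lemma dual_inv_out : {in [predC dual_unit], dual_inv =1 id}.
Proof.
move=> x; rewrite inE /= => nx; rewrite /dual_inv.
by case: ifP => // ux; case/negP: nx.
Qed.

HB.instance Definition _ := GRing.ComNzRing_hasMulInverse.Build (dual A)
  dual_mulV dual_unitP dual_inv_out.
End DualUnit.

Definition dmap (A B : Type) (f : A -> B) (x : dual A) : dual B :=
  Dual (f (dre x)) (f (deps x)).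

Definition dmx (A : Type) (M0 M1 : 'M[A]_2) : 'M[dual A]_2 :=
  \matrix_(a, b) Dual (M0 a b) (M1 a b).

Section Matrices.
Variable A : comUnitRingType.

Definition mx2 (a b c d : A) : 'M[A]_2 := \matrix_(i, j)
  if i == 0 then (if j == 0 then a else b) else (if j == 0 then c else d).

Definition dg (f : 'I_2 -> A) : 'M[A]_2 := diag_mx (\row_a f a).

(* Transition matrix of O + O(k) from U_oo to U_0, at the coordinate x. *)
Definition Gk (k : nat) (x : A) : 'M[A]_2 := mx2 1 0 0 (x ^+ k).

(* Connection matrix of d + Om in the frame G; D is the derivation d/dx. *)
Definition gauge_transform (D : A -> A) (G Om : 'M[A]_2) : 'M[A]_2 :=
  invmx G *m map_mx D G + invmx G *m Om *m G.
End Matrices.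

Section Local.
Variable C : numFieldType.
Local Notation L := (laurent C).
Local Notation K := {fraction {poly C}}.

Definition lC (c : C) : L := lmonom c 0.
Definition lX (k : int) : L := lmonom 1 k.

(* Used only for f bounded below; 0 is a junk value. *)
Definition to_laurent (f : int -> C) : L :=
  if pselect (exists N : int, forall k : int, (k < N)%R -> f k = 0) is left p
  then Laurent p else 0.

Definition dz (f : L) : L := to_laurent (fun k => (k + 1)%:~R * f (k + 1)).

Definition residue (f : L) : C := f (-1).

Definition pseries (f : L) : Prop := forall k : int, (k < 0)%R -> f k = 0.

Definition pseries_mx (M : 'M[L]_2) : Prop := forall a b, pseries (M a b).

Definition trunc_le (N : int) (f : L) : L :=
  to_laurent (fun k => if (k <= N)%R then f k else 0).

Definition coef_mx (M : 'M[L]_2) (k : int) : 'M[C]_2 := \matrix_(a, b) M a b k.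

Definition fnum (f : K) : {poly C} := (frac (repr f)).1.
Definition fden (f : K) : {poly C} := (frac (repr f)).2.

Definition dx (f : K) : K :=
  tofrac ((fnum f)^`() * fden f - fnum f * (fden f)^`()) / tofrac (fden f ^+ 2).

(* The point [None] of P^1 is oo.  [coord_at a] is x as a function of the local
   parameter z, which is x - c at [Some c] and w = 1/x at oo. *)
Definition coord_at (a : option C) : L :=
  if a is Some c then lC c + lX 1 else lX (- 1).

Definition expand (a : option C) (f : K) : L :=
  (map_poly lC (fnum f)).[coord_at a] / (map_poly lC (fden f)).[coord_at a].

(* Coefficient of dz in the expansion of f dx; at oo, dx = - z^-2 dz. *)
Definition expand_form (a : option C) (f : K) : L :=
  if a is Some _ then expand a f else - (lX (- 2)) * expand a f.

Definition xK : K := tofrac 'X.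
Definition cK (c : C) : K := tofrac c%:P.

(* Local expressions in the frame of O + O(k) over U_0, or over U_oo at oo: of
   an endomorphism, of a connection matrix, and of the latter over C[eps]. *)
Definition end_at (k : nat) (a : option C) (g : 'M[K]_2) : 'M[L]_2 :=
  map_mx (expand a)
    (if a is Some _ then g else invmx (Gk k xK) *m g *m Gk k xK).

Definition conn_at (k : nat) (a : option C) (Om : 'M[K]_2) : 'M[L]_2 :=
  map_mx (expand_form a)
    (if a is Some _ then Om else gauge_transform dx (Gk k xK) Om).

Definition conn_at_eps (k : nat) (a : option C) (Om : 'M[dual K]_2) :
    'M[dual L]_2 :=
  map_mx (dmap (expand_form a))
    (if a is Some _ then Om
     else gauge_transform (dmap dx) (Gk k (Dual xK 0)) Om).

(* [th a l] is theta^+_l for a = 0 and theta^-_l for a = 1. *)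
Definition polar_diag (r : nat) (th : 'I_2 -> nat -> C) : 'M[L]_2 :=
  dg (fun a => \sum_(l < r) lC (th a l) * lX (l%:Z - r%:Z)).

Definition has_formal_data (r : nat) (th : 'I_2 -> nat -> C) (Om : 'M[L]_2) :=
  exists M : 'M[L]_2,
    [/\ pseries_mx M, (\det M) 0 != 0 &
        gauge_transform dz M Om = polar_diag r th].

(* exp(-Lam) is a formal symbol.  F exp(-Lam), with dLam = Lam' dz diagonal,
   solves (d + Om) psi = 0, where
   (d + Om) (F exp(-Lam)) = (F' + Om F - F Lam') exp(-Lam) dz. *)
Definition formal_solution (Om F Lam' : 'M[L]_2) : Prop :=
  map_mx dz F + Om *m F - F *m Lam' = 0.

Definition convergent_series (f : L) : Prop :=
  exists B r : C, forall k : nat, `|f k%:Z| <= B * r ^+ k.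

End Local.

Section Setting.
Variable C : numFieldType.
Variable nu : nat.
(* The index i in {1,...,nu} is [Some] of an ordinal (so t_1, t_2 are those of
   value 0, 1), and the index oo is [None].  Signs +, - are 0, 1 : 'I_2. *)
Variable n : option 'I_nu -> nat.
Variable theta0 : 'I_2 -> option 'I_nu -> C.
Local Notation L := (laurent C).
Local Notation K := {fraction {poly C}}.

Definition ntot : nat := \sum_(i : option 'I_nu) n i.

(* The coordinates t_3, ..., t_nu, and theta^(+-)_{l,t_i} for l <= n_i - 2. *)
Definition tcoord : finType :=
  ({i : 'I_nu | (1 < i)%N} +
   'I_2 * {i : option 'I_nu & 'I_(n i).-1})%type.

(* The coordinates q_j, p_j, t, theta. *)
Definition pcoord : finType :=
  ('I_(ntot - 3) + 'I_(ntot - 3) + tcoord)%type.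

(* Mhat x T_theta is the quotient of the open subset [dom] of this space by the
   simultaneous permutations [perm_pt] of the (q_j, p_j), which act freely. *)
Definition param := 'rV[C]_#|pcoord|.
Definition co (m : param) (c : pcoord) : C := m ord0 (enum_rank c).

Definition qq (m : param) (j : 'I_(ntot - 3)) : C := co m (inl (inl j)).
Definition pp (m : param) (j : 'I_(ntot - 3)) : C := co m (inl (inr j)).
Definition ct (i : {i : 'I_nu | (1 < i)%N}) : tcoord := inl i.
Definition cth (a : 'I_2) (i : option 'I_nu) (l : 'I_(n i).-1) : tcoord :=
  inr (a, Tagged (fun i => 'I_(n i).-1) l).

Definition tpt (m : param) (i : 'I_nu) : C :=
  if insub i is Some i' then co m (inr (ct i'))
  else if val i == 0%N then 0 else 1.

Definition pole (m : param) (i : option 'I_nu) : option C := omap (tpt m) i.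

(* theta^(+-)_{l,t_i} for l <= n_i - 1 *)
Definition th (m : param) (i : option 'I_nu) (a : 'I_2) (l : nat) : C :=
  if insub l is Some l' then co m (inr (@cth a i l')) else theta0 a i.

Definition dom (m : param) : Prop :=
  [/\ injective (tpt m), injective (qq m), forall j i, qq m j != tpt m i &
      forall i, (1 < n i)%N -> th m i 0 0 != th m i 1 0].

Definition perm_pt (s : 'S_(ntot - 3)) (m : param) : param :=
  \row_k co m (match enum_val k with
               | inl (inl j) => inl (inl (s j))
               | inl (inr j) => inl (inr (s j))
               | inr c => inr c
               end).

Definition holomorphic (f : param -> C) : Prop :=
  forall m, dom m -> differentiable f m.

Definition vector_field (d : param -> param) : Prop :=
  (forall c, holomorphic (fun m => co (d m) c)) /\
  (forall s m, dom m -> d (perm_pt s m) = perm_pt s (d m)).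

(* The derivatives of t_i and of the centre of x_{t_i} along a tangent vector. *)
Definition dtpt (v : param) (i : 'I_nu) : C :=
  if insub i is Some i' then co v (inr (ct i')) else 0.
Definition dpole (v : param) (i : option 'I_nu) : C :=
  if i is Some i' then dtpt v i' else 0.

Definition PP (m : param) : {poly C} :=
  \prod_i ('X - (tpt m i)%:P) ^+ n (Some i).

Definition ratio_at (f : {poly C}) (c : C) (r : nat) : K :=
  tofrac f / tofrac (('X - c%:P) ^+ r).

Definition normal_form (m : param) (Om : 'M[K]_2) : Prop :=
  exists (Cf Df : 'I_nu -> {poly C}) (Coo Doo Ct : {poly C}),
    let c0 := \sum_i ratio_at (Cf i) (tpt m i) (n (Some i)) +
      \sum_j ratio_at (pp m j)%:P (qq m j) 1 +
      tofrac (Ct + 'X^(ntot - 3) * Coo) in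
    let d0 := \sum_i ratio_at (Df i) (tpt m i) (n (Some i)) -
      \sum_j ratio_at 1 (qq m j) 1 + tofrac Doo in
    [/\ (forall i, (size (Cf i) <= n (Some i))%N /\
                   (size (Df i) <= n (Some i))%N) /\
        [/\ (size Coo <= n None)%N, (size Doo <= (n None).-1)%N &
            (size Ct <= ntot - 3)%N],
        Om = mx2 0 (tofrac (PP m))^-1 c0 d0,
        (forall j, let Phi := mx2 1 0 (cK (pp m j)) (xK C - cK (qq m j)) in
           pseries_mx (map_mx (expand_form (Some (qq m j)))
                         (gauge_transform (@dx C) Phi Om))) &
        forall i, has_formal_data (n i) (th m i)
                    (conn_at (ntot - 2) (pole m i) Om)].

(* The families of connections and solutions over [dom]. *)
Variable Om : param -> 'M[K]_2.
(* theta^(+-)_{l,t_i} for l >= n_i *)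
Variable thh : param -> option 'I_nu -> 'I_2 -> nat -> C.
Variable Phi : option 'I_nu -> param -> 'M[C]_2.
Variable Xi : option 'I_nu -> param -> 'M[L]_2.
Variable Xiq : 'I_(ntot - 3) -> param -> 'M[L]_2.

Definition Om_at (i : option 'I_nu) (m : param) : 'M[L]_2 :=
  conn_at (ntot - 2) (pole m i) (Om m).
Definition Om_atq (j : 'I_(ntot - 3)) (m : param) : 'M[L]_2 :=
  conn_at (ntot - 2) (Some (qq m j)) (Om m).

Definition compatible_framing (i : option 'I_nu) : Prop :=
  [/\ forall a b, holomorphic (fun m => Phi i m a b),
      forall m m', dom m -> dom m' ->
        (forall c : tcoord, co m (inr c) = co m' (inr c)) ->
        Phi i m = Phi i m' &
      forall m, dom m -> Phi i m \in unitmx /\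
        invmx (Phi i m) *m coef_mx (Om_at i m) (- (n i)%:Z) *m Phi i m =
        dg (fun a => th m i a 0)].

Definition theta (m : param) (i : option 'I_nu) (a : 'I_2) (l : nat) : C :=
  if (l < n i)%N then th m i a l else thh m i a l.

(* The derivative of lambda^(+-) in x_{t_i}. *)
Definition lam' (i : option 'I_nu) (m : param) (a : 'I_2) : L :=
  to_laurent (fun k => if k + (n i)%:Z is Posz l then theta m i a l else 0).

(* lambda^(+-) without its logarithmic term theta^(+-)_{n_i - 1} log x_{t_i}. *)
Definition lam (i : option 'I_nu) (m : param) (a : 'I_2) : L :=
  to_laurent (fun k => if k == 0 then 0 else lam' i m a (k - 1) / k%:~R).

(* psi_i = psi_amp i exp(-Lambda_i), with psi_amp i = Phi_i Xi_i *)
Definition psi_amp (i : option 'I_nu) (m : param) : 'M[L]_2 :=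
  map_mx (@lC C) (Phi i m) *m Xi i m.

Definition formal_framing (i : option 'I_nu) : Prop :=
  forall m, dom m ->
    [/\ forall a b (k : int), (k < 0)%R -> Xi i m a b k = 0,
        forall a b, Xi i m a b 0 = (a == b)%:R,
        forall a (k : int), (0 < k)%R -> Xi i m a a k = 0 &
        formal_solution (Om_at i m) (psi_amp i m) (dg (lam' i m))].

Definition psiq (j : 'I_(ntot - 3)) (m : param) : 'M[L]_2 :=
  mx2 1 0 (lC (pp m j)) 1 *m Xiq j m *m mx2 1 0 0 (lX C 1).

Definition apparent_framing (j : 'I_(ntot - 3)) : Prop :=
  (forall a b k, holomorphic (fun m => Xiq j m a b k)) /\
  forall m, dom m ->
    [/\ pseries_mx (Xiq j m), forall a b, Xiq j m a b 0 = (a == b)%:R,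
        forall a b, convergent_series (Xiq j m a b) &
        map_mx (@dz C) (psiq j m) + Om_atq j m *m psiq j m = 0].

(* The derivative along v, with x fixed, of a family sum_k F_k z^k, where z is
   the local parameter and e the derivative along v of its centre. *)
Definition Lder (v : param) (e : C) (m : param) (F : param -> L) : L :=
  to_laurent (fun k => 'D_v (fun m' => F m' k) m) - lC e * dz (F m).

Definition Lder_mx (v : param) (e : C) (m : param) (F : param -> 'M[L]_2) :
    'M[L]_2 :=
  \matrix_(a, b) Lder v e m (fun m' => F m' a b).

Definition dlt_Om (v : param) (i : option 'I_nu) (m : param) :=
  Lder_mx v (dpole v i) m (Om_at i).
Definition dlt_Omq (v : param) (j : 'I_(ntot - 3)) (m : param) :=
  Lder_mx v (qq v j) m (Om_atq j).

(* The coefficient of log x_{t_i} in lambda is constant on [dom]. *)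
Definition dlt_lam (v : param) (i : option 'I_nu) (m : param) (a : 'I_2) : L :=
  to_laurent (fun k => 'D_v (fun m' => lam i m' a k) m)
  - lC (dpole v i) * lam' i m a.

(* delta(psi) psi^-1 for psi = F exp(-Lam), i.e.
   delta(F) F^-1 - F delta(Lam) F^-1 *)
Definition dlog_psi (v : param) (i : option 'I_nu) (m : param) : 'M[L]_2 :=
  Lder_mx v (dpole v i) m (psi_amp i) *m invmx (psi_amp i m)
  - psi_amp i m *m dg (dlt_lam v i m) *m invmx (psi_amp i m).
Definition dlog_psiq (v : param) (j : 'I_(ntot - 3)) (m : param) : 'M[L]_2 :=
  Lder_mx v (qq v j) m (psiq j) *m invmx (psiq j m).

Definition omega_hat (m v1 v2 : param) : C :=
  2^-1 * \sum_i residue (\tr (dlt_Om v1 i m *m dlog_psi v2 i m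
                              - dlog_psi v1 i m *m dlt_Om v2 i m)) +
  2^-1 * \sum_j residue (\tr (dlt_Omq v1 j m *m dlog_psiq v2 j m
                              - dlog_psiq v1 j m *m dlt_Omq v2 j m)).

Definition Q1 (m : param) : {poly C} := \prod_j ('X - (qq m j)%:P).

(* Lagrange interpolation *)
Definition Q2 (m : param) : {poly C} :=
  \sum_j (pp m j)%:P *
    \prod_(k | k != j) ((qq m j - qq m k)^-1 *: ('X - (qq m k)%:P)).

Lemma Q2_interpolates (m : param) : injective (qq m) ->
  (size (Q2 m) <= ntot - 3)%N /\ forall j, (Q2 m).[qq m j] = pp m j.
Proof.
move=> qI; split=> [|j].
  apply: (leq_trans (size_sum _ _ _)); apply/bigmax_leqP => j _.
  rewrite mul_polyC; apply: (leq_trans (size_scale_leq _ _)).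
  rewrite scaler_prod; apply: (leq_trans (size_scale_leq _ _)).
  rewrite -(big_enum _ _ (predC1 j)) size_prod_XsubC -cardE.
  by rewrite cardC1 card_ord; case: (ntot - 3)%N j => [[]|].
rewrite horner_sum (bigD1 j) //= [X in _ + X]big1 ?addr0 => [|k kj].
  rewrite hornerM hornerC horner_prod big1 ?mulr1 // => k kj.
  by rewrite hornerZ hornerXsubC mulVf // subr_eq0 (inj_eq qI) eq_sym.
rewrite hornerM horner_prod (bigD1 j) 1?eq_sym //=.
by rewrite hornerZ hornerXsubC subrr mulr0 mul0r mulr0.
Qed.

Definition Gt (m : param) : 'M[K]_2 :=
  mx2 1 0 (tofrac (Q2 m)) (tofrac (Q1 m)).

Definition Om1 (m : param) : 'M[K]_2 := gauge_transform (@dx C) (Gt m) (Om m).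

Definition Gt_at (i : option 'I_nu) (m : param) : 'M[L]_2 :=
  map_mx (expand (pole m i))
    (if i is Some _ then Gt m
     else invmx (Gk (ntot - 2) (xK C)) *m Gt m *m Gk 1 (xK C)).

Definition idx (s : tcoord) : option 'I_nu :=
  match s with inl i => Some (val i) | inr al => tag al.2 end.

Definition BB (s : tcoord) (m : param) : 'M[L]_2 :=
  match s with
  | inl i => dg (fun a => - \sum_(l < n (Some (val i)))
      lC (th m (Some (val i)) a l) *
      lX C (l%:Z - (n (Some (val i)))%:Z))
  | inr al =>
      let r : int := (n (tag al.2))%:Z - (tagged al.2)%:Z - 1 in
      dg (fun b => if b == al.1 then lmonom (- r%:~R^-1) (- r) else 0)
  end.

Definition Ptr (i : option 'I_nu) (m : param) : 'M[L]_2 :=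
  map_mx (trunc_le (2 * n i).-1%:Z) (invmx (Gt_at i m) *m psi_amp i m).

Definition frakB (s : tcoord) (m : param) : 'M[L]_2 :=
  Ptr (idx s) m *m BB s m *m invmx (Ptr (idx s) m).

(* [nabla, B] for nabla = d + A dz *)
Definition conn_bracket (A B : 'M[L]_2) : 'M[L]_2 :=
  map_mx (@dz C) B + (A *m B - B *m A).

(* Over C[eps]: the deformed P, and polynomials as rational functions. *)
Definition PP_eps (m v : param) : {poly dual C} :=
  \prod_i ('X - (Dual (tpt m i) (dtpt v i))%:P) ^+ n (Some i).
Definition tofrac_eps (f : {poly dual C}) : dual K :=
  Dual (tofrac (map_poly (@dre C) f)) (tofrac (map_poly (@deps C) f)).

(* v is the value at m of delta^IMD_s.  With U the germ of a neighbourhood of the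
   pole i of s and V the complement of that pole, the bundle glued by
   1 + eps frakB from U to V carries d + Om1 on V and
   d + Om1 + eps [d + Om1, frakB] on U.  1 + eps hU and 1 + eps hV are an
   isomorphism from it to E_1 over C[eps], whence
   (1 + eps hV) (1 + eps frakB) = 1 + eps hU; it carries the connection to
   d + Ome = d + N dx / P^eps.  A section of End(E_1) over V has at most a pole at
   i, since hU - frakB does, so that hV is rational. *)
Definition IMD_vector (s : tcoord) (m v : param) : Prop :=
  exists (hU : 'M[L]_2) (hV : 'M[K]_2) (Ome : 'M[dual K]_2)
         (N : 'M[{poly dual C}]_2),
    let i := idx s in
    let a := pole m i in
    let A := conn_at 1 a (Om1 m) in
    [/\ [/\ pseries_mx hU, forall c d, convergent_series (hU c d) &
        forall b : option C, b <> a -> pseries_mx (end_at 1 b hV)],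
        dmx 1%:M (end_at 1 a hV) *m dmx 1%:M (frakB s m) = dmx 1%:M hU,
        map_mx (dmap (@dx C)) (dmx 1%:M hV) + Ome *m dmx 1%:M hV =
          dmx 1%:M hV *m dmx (Om1 m) 0 /\
        map_mx (dmap (@dz C)) (dmx 1%:M hU)
          + conn_at_eps 1 a Ome *m dmx 1%:M hU =
          dmx 1%:M hU *m dmx A (conn_bracket A (frakB s m)),
        tofrac_eps (PP_eps m v) *: Ome = map_mx tofrac_eps N &
        [/\ forall c : tcoord, co v (inr c) = (c == s)%:R,
            forall j, (N 0 1).[Dual (qq m j) (qq v j)] = 0 &
            forall j, (N 0 0).[Dual (qq m j) (qq v j)] =
                      Dual (pp m j) (pp v j)]].

Definition IMD_field (s : tcoord) (d : param -> param) : Prop :=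
  forall m, dom m -> IMD_vector s m (d m).

End Setting.

(* Main.v *)
Require Import Defs.
From HB Require Import structures.
From Stdlib Require Ncring Ncring_tac.
From mathcomp Require Import all_boot all_order all_algebra.
From mathcomp Require Import fraction complex.
From mathcomp Require Import all_classical all_reals all_analysis.
From mathcomp Require Import zify ring.

Set Implicit Arguments.
Unset Strict Implicit.
Unset Printing Implicit Defensive.
Import Order.TTheory GRing.Theory Num.Theory numFieldNormedType.Exports.
Local Open Scope ring_scope.

Import Defs.

(* Along the isomonodromic vector field the connection d + Om on E_(n-2) varies
   by a rational gauge transformation: its derivative is the covariant derivative
   of a rational endomorphism g, regular away from the t_i and q_j.  Indeed, in
   the E_1 frame, the gluing datum hV corrected by a lower triangular matrix
   (which reflects the normalization of the first row by the q_j and p_j)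
   realizes a derivative that differs from the actual one by a deformation with
   trivial formal data and zero first row, and such a deformation vanishes.
   On the other hand delta(psi_i) psi_i^-1 is a formal solution X of
   nabla X = - delta(Om), so that for an exact delta_1(Om) = nabla g an
   integration by parts turns each local term of the 2-form into the residue of
   Tr(g delta_2(Om)), and the sum vanishes by the residue theorem. *)

(** * Formal Laurent series *)

(** The 2-form is built from ['D_v], which is meaningful only for differentiable families, while
    [Om], [Xi] and the exponents [thh] are constrained one parameter at a time. Differentiability is
    therefore derived: formal data and apparent singularities determine the entries of [Om] by
    explicit formulas in the parameters, and [Xi], [thh] obey a recursion whose divisors are nonzero
    by nonresonance. Only the complex line [m + h v] near h = 0 is involved, so this is calculus in
    one variable. A second obstacle is that expansions are centred at moving points: differentiating
    coefficients requires that poles near the centre follow it, and the result differs from the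
    derivative with x fixed by e times [dz], where e is the velocity of the centre. The exponential
    of -Lambda is never formed; its derivative enters through the diagonal series [dlt_lam], in
    which no logarithm occurs because the coefficient of the logarithm is constant. Rigidity is
    sought on E_1 because there the degree of the bundle leaves the lower left entry a zero at oo,
    as Liouville's theorem demands. *)

Section Derivation.
Variables (F : fieldType) (d : F -> F).
Hypothesis dM : forall x y, d (x * y) = d x * y + x * d y.

Lemma deriv_one : d 1 = 0.
Proof. by apply: (addrI (d 1)); have := dM 1 1; rewrite !mulr1 mul1r addr0. Qed.

Lemma deriv_inv x : x != 0 -> d x^-1 = - (d x / x ^+ 2).
Proof.
move=> x0; have := dM x x^-1; rewrite mulfV // deriv_one => /esym/eqP.
by rewrite addrC addr_eq0 => /eqP E; apply: (mulfI x0); rewrite E; field.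
Qed.

Lemma deriv_div x y : y != 0 -> d (x / y) = (d x * y - x * d y) / y ^+ 2.
Proof. by move=> y0; rewrite dM deriv_inv //; field. Qed.

Lemma deriv_expr x k : d (x ^+ k.+1) = k.+1%:R * x ^+ k * d x.
Proof.
elim: k => [|k IH]; first by rewrite !expr1 expr0 !mul1r.
rewrite exprS dM IH [k.+2%:R]mulrS exprS.
by move: k.+1%:R (x ^+ k) => u v; ring.
Qed.
End Derivation.

#[global] Arguments lcoef : simpl never.

Section LaurentOrder.
Variable C : numFieldType.
Local Notation L := (laurent C).
Implicit Types (f g : L) (c : C) (M N k : int).

(** The order is bounded from below rather than computed, so that 0 needs no exceptional value. *)
Definition lge N f := forall k, (k < N)%R -> f k = 0.

Lemma lcoefD f g k : (f + g) k = f k + g k. Proof. by []. Qed.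
Lemma lcoefN f k : (- f) k = - f k. Proof. by []. Qed.
Lemma lcoefB f g k : (f - g) k = f k - g k. Proof. by []. Qed.
Lemma lcoef0 k : (0 : L) k = 0. Proof. by []. Qed.
Lemma lcoef1 k : (1 : L) k = (k == 0)%:R.
Proof.
have -> : (1 : L) k = if k == 0 then 1 else 0 by [].
by case: (k == 0).
Qed.
Lemma lcoef_lmonom c N k : lmonom c N k = if k == N then c else 0.
Proof. by []. Qed.
Lemma lcoef_sum (I : Type) (r : seq I) (P : pred I) (F : I -> L) k :
  (\sum_(i <- r | P i) F i) k = \sum_(i <- r | P i) F i k.
Proof. by elim/big_rec2: _ => // i x y _ <-. Qed.

Lemma lge_le M N f : (M <= N)%R -> lge N f -> lge M f.
Proof. by move=> MN fN k kM; apply: fN; apply: lt_le_trans MN. Qed.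
Lemma lge0 N : lge N 0. Proof. by []. Qed.
Lemma lgeD N f g : lge N f -> lge N g -> lge N (f + g).
Proof. by move=> fN gN k kN; rewrite lcoefD fN // gN // addr0. Qed.
Lemma lgeN N f : lge N f -> lge N (- f).
Proof. by move=> fN k kN; rewrite lcoefN fN // oppr0. Qed.
Lemma lgeB N f g : lge N f -> lge N g -> lge N (f - g).
Proof. by move=> fN gN; apply: lgeD => //; apply: lgeN. Qed.
Lemma lgeM M N f g : lge M f -> lge N g -> lge (M + N) (f * g).
Proof. by move=> fM gN k; apply: laurent_conv_lt. Qed.
Lemma lge_sum (I : Type) (r : seq I) (P : pred I) N (F : I -> L) :
  (forall i, P i -> lge N (F i)) -> lge N (\sum_(i <- r | P i) F i).
Proof. by move=> FN; elim/big_rec: _ => // i x /FN ?; apply: lgeD. Qed.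
Lemma lge_lmonom c N : lge N (lmonom c N).
Proof. by move=> k kN; rewrite lcoef_lmonom ifF //; lia. Qed.
Lemma lge1 : lge 0 (1 : L). Proof. exact: lge_lmonom. Qed.
Lemma lge_lC c : lge 0 (lC c). Proof. exact: lge_lmonom. Qed.
Lemma lge_ex f : exists N, lge N f. Proof. exact: laurent_bound. Qed.

Lemma lead_lcoefM M N f g : lge M f -> lge N g -> (f * g) (M + N) = f M * g N.
Proof.
move=> fM gN; have := laurent_convE 0 fM gN.
by rewrite big_ord1 subnn !addr0.
Qed.

Lemma lorder_ex f : f != 0 -> exists2 N, lge N f & f N != 0.
Proof.
move=> f0; have [N fN] := lge_ex f.
have ex : exists j : nat, f (N + j%:Z) != 0.
  apply: contrapT => nex; case/eqP: f0; apply: laurentP => k.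
  have [/fN //|Nk] := ltP k N.
  apply: contrapT => /eqP fk; apply: nex; exists (absz (k - N)%R).
  by rewrite (_ : N + _ = k) //; lia.
exists (N + (ex_minn ex)%:Z); case: ex_minnP => // m fm mmin k kN.
have [/fN //|Nk] := ltP k N.
apply/eqP; apply: contraT => fk.
have := mmin (absz (k - N)%R); rewrite (_ : N + _ = k); last by lia.
by move=> /(_ fk); lia.
Qed.

(** The order of the inverse is read off from the lowest coefficient of [f * f^-1 = 1], which can be
    nonzero in degree 0 only. *)
Lemma lgeV N f : lge N f -> f N != 0 -> lge (- N) f^-1 /\ f^-1 (- N) = (f N)^-1.
Proof.
move=> fN fN0; have f0 : f != 0 by apply: contraNneq fN0 => ->.
have [M gM gM0] := @lorder_ex f^-1 (invr_neq0 f0).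
have /(congr1 (fun h : L => h (N + M))) := mulfV f0.
rewrite lead_lcoefM // lcoef1.
have [NM|_ /eqP] := eqVneq (N + M) 0; last first.
  by rewrite mulf_eq0 (negPf fN0) (negPf gM0).
move: NM => /eqP; rewrite addr_eq0 => /eqP NM E.
have -> : - N = M by rewrite NM opprK.
by split => //; apply: (mulfI fN0); rewrite E mulfV.
Qed.

Lemma lge_unit f : lge 0 f -> f 0 != 0 -> lge 0 f^-1.
Proof. by move=> f0 f00; have [] := lgeV f0 f00. Qed.

Lemma lge_unit_coef f : lge 0 f -> f 0 != 0 -> f^-1 0 = (f 0)^-1.
Proof. by move=> f0 f00; have [_] := lgeV f0 f00; rewrite oppr0. Qed.

Lemma lge_div M N f g : lge M f -> lge N g -> g N != 0 -> lge (M - N) (f / g).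
Proof. by move=> fM gN gN0; apply: lgeM => //; have [] := lgeV gN gN0. Qed.

Lemma lge_divK M N f g : lge N g -> g N != 0 -> lge (M + N) (f * g) -> lge M f.
Proof.
move=> gN gN0 fg; have g0 : g != 0 by apply: contraNneq gN0 => ->.
rewrite -(mulfK g0 f); apply: lge_le (lge_div fg gN gN0).
by rewrite addrK.
Qed.

Lemma lcoef_lCM c f k : (lC c * f) k = c * f k.
Proof.
have [N fN] := lge_ex f.
have [kN|Nk] := ltP k N.
  rewrite (fN k) // mulr0; apply: (lgeM (lge_lC c) fN).
  by rewrite add0r.
have -> : k = 0 + N + (absz (k - N)%R)%:Z by lia.
rewrite [LHS](laurent_convE _ (lge_lC c) fN) big_ord_recl /= big1 ?addr0 => [|i _].
  by rewrite lcoef_lmonom subn0 add0r.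
by rewrite lcoef_lmonom mul0r.
Qed.

Lemma lmonomM c c' M N : lmonom c M * lmonom c' N = lmonom (c * c') (M + N).
Proof.
apply: laurentP => k.
have [kN|Nk] := ltP k (M + N).
  rewrite (lgeM (@lge_lmonom c M) (@lge_lmonom c' N)) //.
  by rewrite lcoef_lmonom ifF //; lia.
have -> : k = M + N + (absz (k - (M + N))%R)%:Z by lia.
rewrite [LHS](laurent_convE _ (@lge_lmonom c M) (@lge_lmonom c' N)).
rewrite big_ord_recl /= !lcoef_lmonom !addr0 eqxx subn0 big1 ?addr0 => [|i _]; last first.
  by rewrite lcoef_lmonom ifF ?mul0r // /bump /=; lia.
set a := absz _; rewrite -[X in N + X == N]/(a%:Z).
have -> : (N + a%:Z == N) = (M + N + a%:Z == M + N) by lia.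
by case: ifP; rewrite ?mulr0.
Qed.

Lemma lCM c c' : lC (c * c') = lC c * lC c'. Proof. by rewrite lmonomM. Qed.
Lemma lCD c c' : lC (c + c') = lC c + lC c'.
Proof.
apply: laurentP => k; rewrite lcoefD !lcoef_lmonom.
by case: ifP; rewrite ?addr0.
Qed.
Lemma lCN c : lC (- c) = - lC c.
Proof.
apply: laurentP => k; rewrite lcoefN !lcoef_lmonom.
by case: ifP; rewrite ?oppr0.
Qed.
Lemma lC0 : lC 0 = 0 :> L.
Proof. by apply: laurentP => k; rewrite lcoef_lmonom; case: ifP. Qed.
Lemma lC1 : lC 1 = 1 :> L. Proof. by []. Qed.
Lemma lCB c c' : lC (c - c') = lC c - lC c'. Proof. by rewrite lCD lCN. Qed.

Fact lC_is_zmod : zmod_morphism (@lC C). Proof. exact: lCB. Qed.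
Fact lC_is_monoid : monoid_morphism (@lC C). Proof. by split => //; exact: lCM. Qed.
HB.instance Definition _ := GRing.isZmodMorphism.Build C L (@lC C) lC_is_zmod.
HB.instance Definition _ := GRing.isMonoidMorphism.Build C L (@lC C) lC_is_monoid.

Lemma lXM M N : lX C M * lX C N = lX C (M + N).
Proof. by rewrite lmonomM mulr1. Qed.
Lemma lX0 : lX C 0 = 1. Proof. by []. Qed.
Lemma lX_neq0 M : lX C M != 0.
Proof.
apply/eqP => /(congr1 (fun h : L => h M)); rewrite lcoef_lmonom eqxx lcoef0.
by move/eqP; rewrite oner_eq0.
Qed.
Lemma lXV M : (lX C M)^-1 = lX C (- M).
Proof. by apply: (mulfI (lX_neq0 M)); rewrite mulfV ?lX_neq0 // lXM subrr. Qed.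
Lemma lX_exp M (a : nat) : lX C M ^+ a = lX C (M * a%:Z).
Proof. by elim: a => [|a IH]; rewrite ?mulr0 // exprS IH lXM; congr lX; lia. Qed.
Lemma lmonomE c N : lmonom c N = lC c * lX C N.
Proof. by rewrite lmonomM mulr1 add0r. Qed.
Lemma lge_lX M : lge M (lX C M). Proof. exact: lge_lmonom. Qed.

Lemma lcoef_lXM M f k : (lX C M * f) k = f (k - M).
Proof.
have [N fN] := lge_ex f.
have [kN|Nk] := ltP k (M + N).
  by rewrite (lgeM (@lge_lX M) fN) // fN //; lia.
have -> : k = M + N + (absz (k - (M + N))%R)%:Z by lia.
rewrite [LHS](laurent_convE _ (@lge_lX M) fN) big_ord_recl /= big1 ?addr0 => [|i _].
  by rewrite lcoef_lmonom ?addr0 eqxx mul1r subn0; congr (f _); lia.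
by rewrite lcoef_lmonom ifF ?mul0r // /bump /=; lia.
Qed.

Lemma to_laurentE (u : int -> C) N k : (forall j : int, (j < N)%R -> u j = 0) ->
  to_laurent u k = u k.
Proof. by move=> uN; rewrite /to_laurent; case: pselect => // -[]; exists N. Qed.

Lemma lcoef_dz f k : dz f k = (k + 1)%:~R * f (k + 1).
Proof.
have [N fN] := lge_ex f.
by rewrite /dz (@to_laurentE _ (N - 1)) // => j jN; rewrite fN ?mulr0 //; lia.
Qed.

Lemma lge_dz N f : lge N f -> lge (N - 1) (dz f).
Proof. by move=> fN k kN; rewrite lcoef_dz fN ?mulr0 //; lia. Qed.

(** A general bound drops by one under [dz]; at order 0 it does not, since the constant term is
    killed. *)
Lemma lge0_dz f : lge 0 f -> lge 0 (dz f).
Proof.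
move=> f0 k k0; rewrite lcoef_dz; have [->|kn] := eqVneq (k + 1) 0.
  by rewrite mul0r.
by rewrite f0 ?mulr0 //; lia.
Qed.

Lemma residue_dz f : residue (dz f) = 0.
Proof. by rewrite /residue lcoef_dz mul0r. Qed.

Lemma dzD f g : dz (f + g) = dz f + dz g.
Proof. by apply: laurentP => k; rewrite lcoefD !lcoef_dz lcoefD mulrDr. Qed.
Lemma dzN f : dz (- f) = - dz f.
Proof. by apply: laurentP => k; rewrite lcoefN !lcoef_dz lcoefN mulrN. Qed.
Lemma dzB f g : dz (f - g) = dz f - dz g.
Proof. by rewrite dzD dzN. Qed.
Lemma dz_lC c : dz (lC c) = 0.
Proof.
apply: laurentP => k; rewrite lcoef_dz lcoef_lmonom.
by case: eqP => [->|_]; rewrite ?mul0r ?mulr0 lcoef0.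
Qed.
Lemma dz0 : dz (0 : L) = 0. Proof. by rewrite -{1}lC0 dz_lC. Qed.
Lemma dz1 : dz (1 : L) = 0. Proof. by rewrite -{1}lC1 dz_lC. Qed.
HB.instance Definition _ := GRing.isZmodMorphism.Build L L (@dz C) dzB.

(** In each term of the convolution the two exponents add up to the total exponent [k + 1]. *)
Lemma dzM f g : dz (f * g) = dz f * g + f * dz g.
Proof.
have [M fM] := lge_ex f; have [N gN] := lge_ex g.
have dfM := lge_dz fM; have dgN := lge_dz gN.
apply: laurentP => k; rewrite lcoefD lcoef_dz.
have [kN|Nk] := ltP k (M + N - 1).
  rewrite (lgeM fM gN) ?mulr0; last by lia.
  rewrite (lgeM dfM gN); last by lia.
  by rewrite (lgeM fM dgN) ?addr0 //; lia.
set a := absz (k + 1 - (M + N))%R.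
have -> : k + 1 = M + N + a%:Z by rewrite /a; lia.
rewrite [(f * g) _](laurent_convE _ fM gN).
have -> : (dz f * g : L) k = \sum_(j < a.+1) (M + j%:Z)%:~R * f (M + j%:Z) * g (N + (a - j)%N%:Z).
  have -> : k = M - 1 + N + a%:Z by rewrite /a; lia.
  rewrite [LHS](laurent_convE _ dfM gN); apply: eq_bigr => j _.
  by rewrite lcoef_dz (_ : M - 1 + j%:Z + 1 = M + j%:Z) //; lia.
have -> : (f * dz g : L) k = \sum_(j < a.+1) (N + (a - j)%N%:Z)%:~R * f (M + j%:Z) * g (N + (a - j)%N%:Z).
  have -> : k = M + (N - 1) + a%:Z by rewrite /a; lia.
  rewrite [LHS](laurent_convE _ fM dgN); apply: eq_bigr => j _.
  rewrite lcoef_dz (_ : N - 1 + _ + 1 = N + (a - j)%N%:Z); last by lia.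
  by rewrite mulrCA mulrA.
rewrite -big_split mulr_sumr; apply: eq_bigr => j _ /=.
rewrite -!mulrA -mulrDl; congr (_ * _); rewrite -intrD; congr (_ %:~R).
by have := ltn_ord j; lia.
Qed.

Lemma dz_lX k : dz (lX C k) = lC k%:~R * lX C (k - 1).
Proof.
apply: laurentP => j; rewrite lcoef_dz lcoef_lCM !lcoef_lmonom.
have -> : (j == k - 1) = (j + 1 == k) by lia.
by case: eqP => [->//|]; rewrite !mulr0.
Qed.

Lemma dz_div f g : g != 0 -> dz (f / g) = (dz f * g - f * dz g) / g ^+ 2.
Proof. exact: (deriv_div dzM). Qed.

Lemma trunc_leE N f k : trunc_le N f k = if (k <= N)%R then f k else 0.
Proof.
have [M fM] := lge_ex f; rewrite /trunc_le (@to_laurentE _ M) // => j jM.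
by rewrite fM //; case: ifP.
Qed.

Lemma lge_trunc_le N M f : lge M f -> lge M (trunc_le N f).
Proof. by move=> fM k kM; rewrite trunc_leE fM //; case: ifP. Qed.

Lemma lge_trunc_tail N f : lge (N + 1) (f - trunc_le N f).
Proof. by move=> k kN; rewrite lcoefB trunc_leE ifT ?subrr //; lia. Qed.

End LaurentOrder.

(** * Expansions of rational functions *)

Section Expansion.
Variable C : numFieldType.
Local Notation L := (laurent C).
Local Notation K := {fraction {poly C}}.
Implicit Types (a b : option C) (c : C) (p q : {poly C}) (f g : K).

Definition pexpand a p : L := (map_poly (@lC C) p).[coord_at a].

(** The factor in dx = [jac a] dz, for z the local parameter at [a]. *)
Definition jac a : L := if a is Some _ then 1 else - lX C (- 2).

Fact pexpand_is_zmod a : zmod_morphism (pexpand a).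
Proof. by move=> p q; rewrite /pexpand rmorphB hornerD hornerN. Qed.
Fact pexpand_is_monoid a : monoid_morphism (pexpand a).
Proof.
by split=> [|p q]; rewrite /pexpand ?rmorph1 ?hornerC // rmorphM hornerM.
Qed.
HB.instance Definition _ a :=
  GRing.isZmodMorphism.Build {poly C} L (pexpand a) (pexpand_is_zmod a).
HB.instance Definition _ a :=
  GRing.isMonoidMorphism.Build {poly C} L (pexpand a) (pexpand_is_monoid a).

Lemma pexpandC a c : pexpand a c%:P = lC c.
Proof. by rewrite /pexpand map_polyC hornerC. Qed.
Lemma pexpandX a : pexpand a 'X = coord_at a.
Proof. by rewrite /pexpand map_polyX hornerX. Qed.

Lemma pexpand_zero_coef p k :
  pexpand (Some 0) p k = if k is Posz i then p`_i else 0.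
Proof.
have E : coord_at (Some 0) = lX C 1 by rewrite /coord_at lC0 add0r.
elim/poly_ind: p k => [|p c IH] k; first by rewrite rmorph0 lcoef0; case: k => // i; rewrite coef0.
rewrite rmorphD rmorphM /= pexpandX pexpandC E lcoefD mulrC lcoef_lXM IH.
rewrite lcoef_lmonom; case: k => [[|i]|i].
- by rewrite coefD coefMX coefC.
- have -> : i.+1%:Z - 1 = i%:Z by lia.
  by rewrite coefD coefMX coefC.
have -> : Negz i - 1 = Negz i.+1 by lia.
by rewrite addr0.
Qed.

Lemma pexpand_shift c p : pexpand (Some c) p = pexpand (Some 0) (p \Po ('X + c%:P)).
Proof.
rewrite /pexpand map_comp_poly horner_comp rmorphD /= map_polyX map_polyC.
by rewrite hornerD hornerX hornerC /coord_at lC0 add0r addrC.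
Qed.

Lemma lge_pexpand c p : lge 0 (pexpand (Some c) p).
Proof. by move=> k k0; rewrite pexpand_shift pexpand_zero_coef; case: k k0. Qed.

Lemma pexpand_coef0 c p : pexpand (Some c) p 0 = p.[c].
Proof.
rewrite pexpand_shift pexpand_zero_coef -[LHS]/((p \Po ('X + c%:P))`_0).
rewrite -horner_coef0 horner_comp.
by rewrite !hornerE.
Qed.

Lemma pexpand_oo_coef p k : pexpand None p k =
  if k is Posz 0 then p`_0 else if k is Negz i then p`_i.+1 else 0.
Proof.
elim/poly_ind: p k => [|p c IH] k.
  by rewrite rmorph0 lcoef0; case: k => [[|i]|i]; rewrite ?coef0.
rewrite rmorphD rmorphM /= pexpandX pexpandC lcoefD mulrC lcoef_lXM IH opprK.
rewrite lcoef_lmonom; case: k => [[|i]|[|i]].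
- by rewrite !(coefD, coefMX, coefC).
- have -> : i.+1%:Z + 1 = i.+2%:Z by lia.
  by rewrite addr0.
- have -> : Negz 0 + 1 = 0 by lia.
  by rewrite !(coefD, coefMX, coefC).
have -> : Negz i.+1 + 1 = Negz i by lia.
by rewrite !(coefD, coefMX, coefC).
Qed.

Lemma pexpand_oo_coefN p (r : nat) : pexpand None p (- r%:Z) = p`_r.
Proof. by rewrite pexpand_oo_coef; case: r => [|r] //; rewrite -NegzE. Qed.

Lemma lge_pexpand_oo p (r : nat) : (size p <= r.+1)%N -> lge (- r%:Z) (pexpand None p).
Proof.
move=> pr k kr; rewrite pexpand_oo_coef; case: k kr => [[|i]|i] //; first by lia.
by rewrite NegzE => ir; rewrite nth_default //; apply: leq_trans pr _; lia.
Qed.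

Lemma lead_pexpand_oo p : lge (- (size p).-1%:Z) (pexpand None p) /\
  pexpand None p (- (size p).-1%:Z) = lead_coef p.
Proof.
by split; [apply: lge_pexpand_oo; apply: leqSpred | rewrite pexpand_oo_coefN].
Qed.

Lemma pexpand_eq0 a p : (pexpand a p == 0) = (p == 0).
Proof.
apply/eqP/eqP => [|->]; last by rewrite rmorph0.
case: a => [c|] p0; last first.
  have [_] := lead_pexpand_oo p; rewrite p0 lcoef0 => /esym/eqP.
  by rewrite lead_coef_eq0 => /eqP.
have q0 : p \Po ('X + c%:P) = 0.
  apply/polyP => i; rewrite coef0 -(pexpand_zero_coef _ i) -pexpand_shift p0.
  exact: lcoef0.
by have := comp_poly_eq0 p (q := 'X + c%:P); rewrite q0 size_XaddC eqxx => /(_ isT)/esym/eqP.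
Qed.

Lemma dz_pexpand a p : dz (pexpand a p) = jac a * pexpand a p^`().
Proof.
elim/poly_ind: p => [|p c IH]; first by rewrite linear0 !rmorph0 dz0 mulr0.
rewrite derivD derivM derivX derivC addr0 mulr1 !rmorphD !rmorphM /=.
rewrite pexpandX pexpandC dzD dz_lC dzM IH addr0 mulrDr mulrA; congr (_ + _).
rewrite mulrC; congr (_ * _); rewrite /jac /coord_at; case: a {IH} => [c'|].
  by rewrite dzD dz_lC dz_lX lC1 mul1r add0r.
by rewrite dz_lX lCN lC1 mulN1r.
Qed.

Lemma fracE f : f = tofrac (fnum f) / tofrac (fden f).
Proof.
rewrite -[f in LHS]reprK; unlock FracField.tofrac.
rewrite -[X in _ * X]FracField.pi_inv -[RHS]FracField.pi_mul.
congr (\pi_({fraction {poly C}}) _)%qT; rewrite /FracField.mulf /FracField.invf.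
rewrite !numden_Ratio ?oner_eq0 ?denom_ratioP // mulr1 mul1r.
by rewrite /fnum /fden Ratio_numden.
Qed.

Lemma fden_neq0 f : fden f != 0. Proof. exact: denom_ratioP. Qed.

(** [expand] is defined through the representative picked by [fnum] and [fden]; cross-multiplication
    in the field of Laurent series, where nonzero denominators stay nonzero, makes it independent of
    that choice. *)
Lemma expand_frac a p q : q != 0 ->
  expand a (tofrac p / tofrac q) = pexpand a p / pexpand a q.
Proof.
move=> q0; set f := _ / _; rewrite /expand -!/(pexpand _ _).
have := fracE f; rewrite {1}/f => /eqP.
rewrite eqr_div ?tofrac_eq0 ?fden_neq0 // -!rmorphM /= tofrac_eq => /eqP.
move=> /(congr1 (pexpand a)); rewrite !rmorphM /= => E; apply/eqP.
by rewrite eqr_div ?pexpand_eq0 ?fden_neq0 // -E.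
Qed.

Lemma expand_poly a p : expand a (tofrac p) = pexpand a p.
Proof.
have := @expand_frac a p 1 (oner_neq0 _).
by rewrite !rmorph1 !divr1.
Qed.

Fact expand_is_zmod a : zmod_morphism (expand a).
Proof.
move=> f g; rewrite {1}(fracE f) {1}(fracE g) -mulNr addf_div ?tofrac_eq0 ?fden_neq0 //.
rewrite -rmorphN -!rmorphM -rmorphD /= expand_frac ?mulf_neq0 ?fden_neq0 //.
rewrite rmorphD !rmorphM /= rmorphN -addf_div ?pexpand_eq0 ?fden_neq0 //.
by rewrite mulNr.
Qed.

Fact expand_is_monoid a : monoid_morphism (expand a).
Proof.
split=> [|f g]; first by rewrite -tofrac1 expand_poly rmorph1.
rewrite {1}(fracE f) {1}(fracE g) mulf_div -!rmorphM /=.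
by rewrite expand_frac ?mulf_neq0 ?fden_neq0 // !rmorphM /= -mulf_div.
Qed.
HB.instance Definition _ a :=
  GRing.isZmodMorphism.Build K L (expand a) (expand_is_zmod a).
HB.instance Definition _ a :=
  GRing.isMonoidMorphism.Build K L (expand a) (expand_is_monoid a).

Lemma expand_inj a : injective (expand a).
Proof. exact: fmorph_inj. Qed.

Lemma expandX a : expand a (xK C) = coord_at a.
Proof. by rewrite expand_poly pexpandX. Qed.
Lemma expandC a c : expand a (cK c) = lC c.
Proof. by rewrite expand_poly pexpandC. Qed.

Fact cK_is_zmod : zmod_morphism (@cK C).
Proof. by move=> c c'; rewrite /cK !rmorphB. Qed.
Fact cK_is_monoid : monoid_morphism (@cK C).
Proof. by split=> [|c c']; rewrite /cK ?rmorph1 // !rmorphM. Qed.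
HB.instance Definition _ := GRing.isZmodMorphism.Build C K (@cK C) cK_is_zmod.
HB.instance Definition _ := GRing.isMonoidMorphism.Build C K (@cK C) cK_is_monoid.

Lemma dz_expand a f : dz (expand a f) = jac a * expand a (dx f).
Proof.
rewrite /dx expand_frac ?expf_neq0 ?fden_neq0 // rmorphXn /=.
have E : expand a f = pexpand a (fnum f) / pexpand a (fden f) by [].
rewrite {}E dz_div ?pexpand_eq0 ?fden_neq0 // !dz_pexpand.
by rewrite rmorphB !rmorphM /= [RHS]mulrA; congr (_ / _); ring.
Qed.

Lemma jac_neq0 a : jac a != 0.
Proof. by case: a => [c|] /=; rewrite ?oner_eq0 // oppr_eq0 lX_neq0. Qed.

Lemma expand_formE a f : expand_form a f = jac a * expand a f.
Proof. by case: a => [c|] /=; rewrite ?mul1r. Qed.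

Lemma expand_form_dx a f : expand_form a (dx f) = dz (expand a f).
Proof. by rewrite expand_formE dz_expand. Qed.

(** Expansion at 0 is injective and [jac] is 1 there, so the rules for [dz] carry over to [dx],
    whose definition by a chosen fraction does not display them. *)
Let dx_expand f g : (dz (expand (Some 0) f) = expand (Some 0) g) -> dx f = g.
Proof. by rewrite dz_expand mul1r => /expand_inj. Qed.

Lemma dxB f g : dx (f - g) = dx f - dx g.
Proof. by apply: dx_expand; rewrite rmorphB dzB !dz_expand !mul1r rmorphB. Qed.
HB.instance Definition _ := GRing.isZmodMorphism.Build K K (@dx C) dxB.
Lemma dxM f g : dx (f * g) = dx f * g + f * dx g.
Proof.
by apply: dx_expand; rewrite rmorphM dzM !dz_expand !mul1r rmorphD !rmorphM.
Qed.
Lemma dx_cK c : dx (cK c) = 0.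
Proof. by apply: dx_expand; rewrite expandC dz_lC rmorph0. Qed.
Lemma dx_tofrac p : dx (tofrac p) = tofrac p^`().
Proof. by apply: dx_expand; rewrite expand_poly dz_pexpand mul1r expand_poly. Qed.

Lemma xK_sub_neq0 c : xK C - cK c != 0.
Proof. by rewrite -rmorphB tofrac_eq0 polyXsubC_eq0. Qed.
Lemma dx_xK : dx (xK C) = 1.
Proof. by rewrite dx_tofrac derivX rmorph1. Qed.
Lemma dx_div f g : g != 0 -> dx (f / g) = (dx f * g - f * dx g) / g ^+ 2.
Proof. exact: (deriv_div dxM). Qed.

End Expansion.

(** * The residue theorem *)

Lemma partial_fraction_step (F : fieldType) (x u v w : F) (j : nat) :
    x - u != 0 -> x - v != 0 -> u - v != 0 ->
  w / (x - u) ^+ j.+1 / (x - v) =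
  w / (u - v) / (x - u) ^+ j.+1 + - (u - v)^-1 * (w / (x - u) ^+ j / (x - v)).
Proof.
move=> h1 h2 h3; rewrite exprS; have := expf_neq0 j h1.
by move: ((x - u) ^+ j) => A h4; field; rewrite h1 h2 h3 h4.
Qed.

Lemma pole_primitive (F : fieldType) (u v w : F) (j : nat) : v != 0 -> w != 0 ->
  u / w ^+ j.+2 = (0 * w ^+ j.+1 - (- u / v) * (v * w ^+ j * 1)) / (w ^+ j.+1) ^+ 2.
Proof.
move=> v0 w0; rewrite !exprS; have := expf_neq0 j w0.
by move: (w ^+ j) => A A0; field; rewrite v0 w0 A0.
Qed.

Section Residues.
Variable C : numClosedFieldType.
Local Notation L := (laurent C).
Local Notation K := {fraction {poly C}}.
Implicit Types (a b : option C) (c d : C) (p q : {poly C}) (f g : K).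

(** A nonconstant denominator has a root; regularity there makes it a root of the numerator too, so
    a linear factor cancels and the denominator shrinks. *)
Lemma regular_poly f : (forall c, lge 0 (expand (Some c) f)) ->
  exists p, f = tofrac p.
Proof.
move=> freg; have : f * tofrac (fden f) = tofrac (fnum f).
  by rewrite {1}(fracE f) divfK // tofrac_eq0 fden_neq0.
move: (fden_neq0 f); move: (fnum f) (fden f) => p q.
have [N] := ubnP (size q); elim: N p q => // N IH p q; rewrite ltnS => qN q0 fq.
have [/eqP/size_poly1P[c c0 qE]|/closed_rootP[c qc]] := eqVneq (size q) 1%N.
  exists (c^-1 *: p); rewrite -mul_polyC rmorphM /= -fq qE mulrCA -rmorphM /=.
  by rewrite -polyCM mulVf // rmorph1 mulr1.
have [q1 qE] := factor_theorem _ _ qc.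
have pc : root p c.
  rewrite rootE -pexpand_coef0 -expand_poly -fq rmorphM /= expand_poly.
  have := lead_lcoefM (freg c) (@lge_pexpand _ c q); rewrite addr0 => ->.
  by rewrite pexpand_coef0 (eqP qc) mulr0.
have [p1 pE] := factor_theorem _ _ pc.
have Xc0 : 'X - c%:P != 0 by rewrite polyXsubC_eq0.
have q10 : q1 != 0 by apply: contraNneq q0 => q10; rewrite qE q10 mul0r.
apply: (IH p1 q1) => //.
  by apply: leq_trans qN; rewrite qE size_Mmonic ?monicXsubC // size_XsubC addn2.
have /mulIf : tofrac ('X - c%:P) != 0 :> K by rewrite tofrac_eq0.
by apply; rewrite -mulrA -!rmorphM /= -qE -pE.
Qed.

Lemma regular_eq0 f : (forall c, lge 0 (expand (Some c) f)) ->
  lge 1 (expand None f) -> f = 0.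
Proof.
move=> /regular_poly[p ->]; rewrite expand_poly => p_ge.
have [_ pl] := lead_pexpand_oo p.
by apply/eqP; rewrite tofrac_eq0 -lead_coef_eq0 -pl p_ge.
Qed.

(** As an inductive predicate, partial fractions become an induction principle, with no bookkeeping
    of the set of poles. *)
Inductive pfrac : K -> Prop :=
| pfrac_poly p : pfrac (tofrac p)
| pfrac_pole d c k : pfrac (cK d / (xK C - cK c) ^+ k.+1)
| pfracD f g : pfrac f -> pfrac g -> pfrac (f + g).

Lemma pfrac_scale d f : pfrac f -> pfrac (cK d * f).
Proof.
elim=> [p|d' c k|g h _ IHg _ IHh].
- by rewrite /cK -rmorphM; apply: pfrac_poly.
- by rewrite mulrA -rmorphM; apply: pfrac_pole.
by rewrite mulrDr; apply: pfracD.
Qed.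

Lemma pfrac_div f c : pfrac f -> pfrac (f / (xK C - cK c)).
Proof.
elim=> [p|d c' k|g h _ IHg _ IHh]; last by rewrite mulrDl; apply: pfracD.
  have pc : root (p - p.[c]%:P) c by rewrite rootE !hornerE subrr.
  have [q pE] := factor_theorem _ _ pc.
  have {1}-> : p = q * ('X - c%:P) + p.[c]%:P by rewrite -pE subrK.
  rewrite rmorphD mulrDl rmorphM rmorphB /= -/(xK C) -/(cK c) mulfK ?xK_sub_neq0 //.
  by apply: pfracD; [apply: pfrac_poly | apply: (pfrac_pole _ _ 0%N)].
have [->|cc] := eqVneq c' c.
  by rewrite -mulrA -invfM -exprSr; apply: pfrac_pole.
have E (j : nat) : cK d / (xK C - cK c') ^+ j.+1 / (xK C - cK c) =
    cK (d / (c' - c)) / (xK C - cK c') ^+ j.+1 +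
    cK (- (c' - c)^-1) * (cK d / (xK C - cK c') ^+ j / (xK C - cK c)).
  have cc0 : cK c' - cK c != 0 by rewrite -rmorphB fmorph_eq0 subr_eq0.
  rewrite rmorphN fmorph_div fmorphV rmorphB /=.
  by apply: partial_fraction_step; rewrite ?xK_sub_neq0.
elim: k => [|k IH]; rewrite E.
  apply: pfracD; first exact: pfrac_pole.
  by apply: pfrac_scale; rewrite expr0 divr1; apply: (pfrac_pole _ _ 0%N).
by apply: pfracD; [apply: pfrac_pole | apply: pfrac_scale].
Qed.

Lemma pfrac_all f : pfrac f.
Proof.
rewrite (fracE f); have [r ->] := closed_field_poly_normal (fden f).
rewrite -mul_polyC rmorphM invfM mulrA rmorph_prod /=.
have -> : tofrac (fnum f) / tofrac (lead_coef (fden f))%:P =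
    cK (lead_coef (fden f))^-1 * tofrac (fnum f).
  by rewrite mulrC fmorphV.
have := pfrac_scale (lead_coef (fden f))^-1 (pfrac_poly (fnum f)).
elim: r (cK _ * _) => [|c r IH] g gp; first by rewrite big_nil divr1.
by rewrite big_cons invfM mulrA; apply: IH; rewrite rmorphB; apply: pfrac_div.
Qed.

Definition res a f : C := residue (expand_form a f).

Lemma resD a f g : res a (f + g) = res a f + res a g.
Proof. by rewrite /res !expand_formE rmorphD mulrDr. Qed.

Lemma res_dx a f : res a (dx f) = 0.
Proof. by rewrite /res expand_form_dx residue_dz. Qed.

Lemma res_simple_pole d c : let f := cK d / (xK C - cK c) in
  (forall c', res (Some c') f = if c' == c then d else 0) /\ res None f = - d.
Proof.
rewrite /=; split=> [c'|]; rewrite /res expand_formE fmorph_div rmorphB /= expandX !expandC /=.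
  rewrite mul1r /residue lcoef_lCM addrAC -lCB; case: eqVneq => [->|cc].
    by rewrite subrr lC0 add0r lXV lcoef_lmonom eqxx mulr1.
  rewrite lge_unit ?mulr0 //; first by apply: lgeD; [apply: lge_lC | apply: lge_le (@lge_lX _ 1)].
  by rewrite lcoefD !lcoef_lmonom /= addr0 subr_eq0.
rewrite /residue mulNr lcoefN lcoef_lXM lcoef_lCM.
have ul : lge (-1) (lX C (-1) - lC c).
  by apply: lgeB; [apply: lge_lX | apply: lge_le (@lge_lC _ c)].
have u1 : (lX C (-1) - lC c) (-1) = 1 by rewrite lcoefB !lcoef_lmonom subr0.
have := proj2 (lgeV ul _); rewrite u1 oner_eq0 => /(_ isT).
by rewrite opprK (_ : -1 - -2 = 1 :> int) // => ->; rewrite invr1 mulr1.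
Qed.

(** Quantifying over all sufficiently large lists makes the property additive in [f], as the
    induction on [pfrac] requires: the lists for two summands are concatenated. *)
Lemma residues_eventually f : exists s : seq C, forall s', uniq s' ->
  {subset s <= s'} -> \sum_(c <- s') res (Some c) f + res None f = 0.
Proof.
elim: (pfrac_all f) => [p|d c k|g h _ [s1 IH1] _ [s2 IH2]].
- exists [::] => s' _ _.
  (* A polynomial has a polynomial primitive in characteristic 0, hence no residue anywhere. *)
  pose q := \poly_(i < (size p).+1) (p`_i.-1 / i%:R).
  have -> : tofrac p = dx (tofrac q).
    rewrite dx_tofrac; congr tofrac; apply/polyP => i.
    rewrite coef_deriv coef_poly ltnS; case: ltnP => [_|pi].
      by rewrite -[_ *+ _]mulr_natr divfK ?pnatr_eq0.
    by rewrite mul0rn nth_default.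
  by rewrite res_dx addr0 big1 // => c _; rewrite res_dx.
- case: k => [|k].
    exists [:: c] => s' us' /(_ c (mem_head _ _)) cs'.
    have [E1 ->] := res_simple_pole d c.
    rewrite (bigD1_seq c) //= E1 eqxx big1 ?addr0 ?subrr // => c' /negPf cc.
    by rewrite E1 cc.
  exists [::] => s' _ _.
  (* Poles of order at least 2 have a primitive as well, so only simple poles contribute. *)
  have -> : cK d / (xK C - cK c) ^+ k.+2 =
            dx (cK (- d / k.+1%:R) / (xK C - cK c) ^+ k.+1).
    rewrite dx_div ?expf_neq0 ?xK_sub_neq0 // dx_cK (deriv_expr (@dxM C)).
    rewrite dxB dx_xK dx_cK subr0 rmorphM rmorphN fmorphV rmorph_nat /=.
    have := xK_sub_neq0 c; have : k.+1%:R != 0 :> K.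
      by rewrite -(rmorph_nat (@cK C)) fmorph_eq0 pnatr_eq0.
    by move: (cK d) k.+1%:R (xK C - cK c) => u v w; apply: pole_primitive.
  by rewrite res_dx addr0 big1 // => c' _; rewrite res_dx.
exists (s1 ++ s2) => s' us' sub.
rewrite resD (eq_bigr _ (fun c _ => resD _ _ _)) big_split /= addrACA.
by rewrite IH1 ?IH2 ?addr0 // => c cs; apply: sub; rewrite mem_cat cs ?orbT.
Qed.

Lemma sum_residues (s : seq C) f : uniq s ->
  (forall c, c \notin s -> res (Some c) f = 0) ->
  \sum_(c <- s) res (Some c) f + res None f = 0.
Proof.
move=> us fs; have [s1 H] := residues_eventually f.
rewrite -[RHS](H (undup (s ++ s1))) ?undup_uniq //; last first.
  by move=> c cs; rewrite mem_undup mem_cat cs orbT.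
congr (_ + _).
rewrite [in RHS](bigID (mem s)) /= [X in _ = _ + X]big1 ?addr0; last first.
  by move=> c; apply: fs.
rewrite -[in RHS]big_filter; apply: perm_big; apply: uniq_perm => //.
  by rewrite filter_uniq // undup_uniq.
by move=> c; rewrite mem_filter mem_undup mem_cat; case: (c \in s).
Qed.
End Residues.

(** * Differentiation of families *)

Section Jets.
Variable C : numFieldType.
Local Notation L := (laurent C).

Section Scalar.
Implicit Types P Q : C -> Prop.

Definition near0 P := \forall h \near (0 : C), P h.
Definition sder (f : C -> C) (f' : C) := is_derive (0 : C) (1 : C) f f'.

Lemma near0T P : (forall h, P h) -> near0 P.
Proof. exact: (@filterE _ (nbhs (0 : C)) _ P). Qed.
Lemma near0_and P Q : near0 P -> near0 Q -> near0 (fun h => P h /\ Q h).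
Proof. exact: (@filterI _ (nbhs (0 : C)) _ P Q). Qed.
Lemma near0_imp P Q : (forall h, P h -> Q h) -> near0 P -> near0 Q.
Proof. exact: (@filterS _ (nbhs (0 : C)) _ P Q). Qed.
Lemma near0_imp2 P Q (S : C -> Prop) : (forall h, P h -> Q h -> S h) ->
  near0 P -> near0 Q -> near0 S.
Proof. exact: (@filterS2 _ (nbhs (0 : C)) _ P Q S). Qed.
Lemma near0_forall (I : finType) (P : I -> C -> Prop) :
  (forall i, near0 (P i)) -> near0 (fun h => forall i, P i h).
Proof. exact: (@filter_forall _ _ P (nbhs (0 : C))). Qed.
Lemma near0_at0 P : near0 P -> P 0. Proof. exact: (@nbhs_singleton C 0 P). Qed.

Lemma sder_uniq (f : C -> C) (f' g' : C) : sder f f' -> sder f g' -> f' = g'.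
Proof. by move=> [_ <-] [_ <-]. Qed.
Lemma sder_ex (f : C -> C) : derivable f 0 1 -> exists f', sder f f'.
Proof. by move=> df; exists ('D_1 f 0); apply: derivableP. Qed.
Lemma sder_near (f g : C -> C) (f' : C) : near0 (fun h => f h = g h) -> sder f f' -> sder g f'.
Proof. by move=> fg; apply: near_eq_is_derive. Qed.
Lemma sder_ext (f g : C -> C) (f' : C) : f =1 g -> sder f f' -> sder g f'.
Proof. by move=> /funext ->. Qed.
Lemma sder_cst c : sder (fun=> c) 0. Proof. exact: is_derive_cst. Qed.
Lemma sderD (f g : C -> C) (f' g' : C) : sder f f' -> sder g g' -> sder (fun h => f h + g h) (f' + g').
Proof. exact: is_deriveD. Qed.
Lemma sderN (f : C -> C) (f' : C) : sder f f' -> sder (fun h => - f h) (- f').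
Proof. exact: is_deriveN. Qed.
Lemma sderB (f g : C -> C) (f' g' : C) : sder f f' -> sder g g' -> sder (fun h => f h - g h) (f' - g').
Proof. by move=> df dg; apply: sderD => //; apply: sderN. Qed.
Lemma sderM (f g : C -> C) (f' g' : C) : sder f f' -> sder g g' ->
  sder (fun h => f h * g h) (f' * g 0 + f 0 * g').
Proof.
move=> df dg; have := @is_deriveM _ _ _ _ _ _ _ _ df dg.
by rewrite /sder addrC [f' * _]mulrC.
Qed.
Lemma sder_id : sder id 1. Proof. exact: is_derive_id. Qed.
Lemma sder_sum (I : Type) (r : seq I) (f : I -> C -> C) (f' : I -> C) :
  (forall i, sder (f i) (f' i)) ->
  sder (fun h => \sum_(i <- r) f i h) (\sum_(i <- r) f' i).
Proof.
move=> df; elim: r => [|i r IH].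
  rewrite big_nil; apply: sder_ext (sder_cst 0) => h; by rewrite big_nil.
rewrite big_cons; apply: sder_ext (sderD (df i) IH) => h; by rewrite big_cons.
Qed.
Lemma sder_neq0 (f : C -> C) (f' : C) : sder f f' -> f 0 != 0 -> near0 (fun h => f h != 0).
Proof.
move=> [/derivable1_diffP/differentiable_continuous cf _] f0.
exact: (cvgr_neq0 (f := f) (F := nbhs (0 : C)) _ cf f0).
Qed.
Lemma sderV (f : C -> C) (f' : C) : sder f f' -> f 0 != 0 ->
  sder (fun h => (f h)^-1) (- (f' / f 0 ^+ 2)).
Proof.
move=> [df dfE] f0; split; first exact: derivableV.
by rewrite deriveV // dfE scaleNr /= mulrC.
Qed.
End Scalar.

(** The lower bound on exponents is common to all small h, which keeps every coefficient of a
    product one fixed finite sum. *)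
Definition lder (F : C -> L) (F' : L) :=
  (exists N, near0 (fun h => lge N (F h))) /\
  (forall k, sder (fun h => F h k) (F' k)).

Lemma lder_uniq (F : C -> L) (F' G' : L) : lder F F' -> lder F G' -> F' = G'.
Proof. by move=> [_ dF] [_ dG]; apply: laurentP => k; apply: sder_uniq (dF k) (dG k). Qed.

Lemma lder_lge N (F : C -> L) (F' : L) : near0 (fun h => lge N (F h)) -> lder F F' -> lge N F'.
Proof.
move=> FN [_ dF] k kN; apply: sder_uniq (dF k) _.
apply: sder_near (sder_cst 0); apply: near0_imp FN => h hN.
by rewrite hN.
Qed.

Lemma lder_ex N (F : C -> L) : near0 (fun h => lge N (F h)) ->
  (forall k, exists f', sder (fun h => F h k) f') -> exists F', lder F F'.
Proof.
move=> FN dF; exists (to_laurent (fun k => xget 0 (sder (fun h => F h k)))).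
split=> [|k]; first by exists N.
have E j : sder (fun h => F h j) (xget 0 (sder (fun h => F h j))).
  by have [x xP] := dF j; apply: xgetPex; exists x.
rewrite (@to_laurentE _ _ N) // => j jN.
apply: sder_uniq (E j) _; apply: sder_near (sder_cst 0).
by apply: near0_imp FN => h hN; rewrite hN.
Qed.

Lemma lder_near (F G : C -> L) (F' : L) : near0 (fun h => F h = G h) -> lder F F' -> lder G F'.
Proof.
move=> FG [[N FN] dF]; split=> [|k].
  by exists N; apply: near0_imp2 FG FN => h ->.
by apply: sder_near (dF k); apply: near0_imp FG => h ->.
Qed.
Lemma lder_ext (F G : C -> L) (F' : L) : F =1 G -> lder F F' -> lder G F'.
Proof. by move=> /funext ->. Qed.

Lemma lder_cst f : lder (fun=> f) 0.
Proof.
split=> [|k]; last exact: sder_cst.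
by have [N fN] := lge_ex f; exists N; apply: near0T.
Qed.

Lemma lder_lC (a : C -> C) (a' : C) : sder a a' -> lder (fun h => lC (a h)) (lC a').
Proof.
move=> da; split=> [|k].
  by exists 0; apply: near0T => h; apply: lge_lC.
rewrite lcoef_lmonom; apply: (@sder_ext (fun h => if k == 0 then a h else 0)) => //.
by case: ifP => _ //; apply: sder_cst.
Qed.

Lemma lderD (F G : C -> L) (F' G' : L) : lder F F' -> lder G G' ->
  lder (fun h => F h + G h) (F' + G').
Proof.
move=> [[M FM] dF] [[N GN] dG]; split=> [|k]; last exact: sderD.
exists (Num.min M N); apply: near0_imp2 FM GN => h hM hN.
by apply: lgeD; [apply: lge_le hM|apply: lge_le hN]; lia.
Qed.
Lemma lderN (F : C -> L) (F' : L) : lder F F' -> lder (fun h => - F h) (- F').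
Proof.
move=> [[M FM] dF]; split=> [|k]; last exact: sderN.
by exists M; apply: near0_imp FM => h; apply: lgeN.
Qed.

Lemma lderM (F G : C -> L) (F' G' : L) : lder F F' -> lder G G' ->
  lder (fun h => F h * G h) (F' * G 0 + F 0 * G').
Proof.
move=> dF dG; have [[M FM] dFk] := dF; have [[N GN] dGk] := dG.
have F'M := lder_lge FM dF; have G'N := lder_lge GN dG.
have F0M := near0_at0 FM; have G0N := near0_at0 GN.
split=> [|k].
  by exists (M + N); apply: near0_imp2 FM GN => h hM hN; apply: lgeM.
have [kMN|MNk] := ltP k (M + N).
  rewrite lcoefD (lgeM F'M G0N) // (lgeM F0M G'N) // addr0.
  apply: sder_near (sder_cst 0); apply: near0_imp2 FM GN => h hM hN.
  by rewrite (lgeM hM hN).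
have -> : k = M + N + (absz (k - (M + N))%R)%:Z by lia.
set a := absz _.
apply: (@sder_near (fun h => \sum_(j < a.+1) F h (M + j%:Z) * G h (N + (a - j)%N%:Z))).
  by apply: near0_imp2 FM GN => h hM hN; rewrite -(laurent_convE _ hM hN).
rewrite lcoefD [(F' * _) _](laurent_convE _ F'M G0N) [(F 0 * _) _](laurent_convE _ F0M G'N).
rewrite -big_split /=; apply: sder_sum => j; exact: sderM.
Qed.

Lemma lder_sum (I : Type) (r : seq I) (F : I -> C -> L) (F' : I -> L) :
  (forall i, lder (F i) (F' i)) ->
  lder (fun h => \sum_(i <- r) F i h) (\sum_(i <- r) F' i).
Proof.
move=> dF; elim: r => [|i r IH].
  by rewrite big_nil; apply: lder_ext (lder_cst 0) => h; rewrite big_nil.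
by rewrite big_cons; apply: lder_ext (lderD (dF i) IH) => h; rewrite big_cons.
Qed.

(** The condition [F 0 N != 0] says that the order does not jump at h = 0, so that the inverses have
    a common bound. Their coefficients are differentiable by the recursion for the inverse series;
    the formula then follows by differentiating [F h * (F h)^-1 = 1]. *)
Lemma lderV N (F : C -> L) (F' : L) : lder F F' -> near0 (fun h => lge N (F h)) -> F 0 N != 0 ->
  lder (fun h => (F h)^-1) (- (F' / F 0 ^+ 2)).
Proof.
move=> dF FN F0N; have [_ dFk] := dF.
have nzN := sder_neq0 (dFk N) F0N.
have VN : near0 (fun h => lge (- N) (F h)^-1).
  by apply: near0_imp2 FN nzN => h hN hN0; have [] := lgeV hN hN0.
have nz : near0 (fun h => F h != 0).
  by apply: near0_imp nzN => h; apply: contraNneq => ->.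
have rec (a : nat) : near0 (fun h => (F h)^-1 (- N + a%:Z) =
    (F h N)^-1 * ((a == 0)%N%:R - \sum_(j < a) F h (N + j.+1%:Z) * (F h)^-1 (- N + (a - j.+1)%N%:Z))).
  apply: near0_imp2 (near0_and FN VN) (near0_and nz nzN) => h [hN hV] [h0 hN0].
  have := laurent_convE a hN hV; rewrite -lcoefM mulfV // subrr add0r.
  rewrite big_ord_recl /= addr0 subn0 lcoef1 eqz_nat => ->.
  by rewrite addrK mulKf.
have [G' dG] : exists G', lder (fun h => (F h)^-1) G'.
  apply: (lder_ex VN) => k; have [kN|Nk] := ltP k (- N).
    exists 0; apply: sder_near (sder_cst 0).
    by apply: near0_imp VN => h hV; rewrite hV.
  have -> : k = - N + (absz (k + N)%R)%:Z by lia.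
  elim/ltn_ind: (absz _) => a IH.
  have /choice[u uP] : forall j : 'I_a, exists x : C,
      sder (fun h => (F h)^-1 (- N + (a - j.+1)%N%:Z)) x.
    by move=> j; apply: IH; have := ltn_ord j; lia.
  eexists; apply: sder_near.
    by apply: near0_imp (rec a) => h /esym; apply.
  apply: sderM; first exact: (sderV (dFk N) F0N).
  apply: sderB; first exact: sder_cst.
  by apply: sder_sum => j; apply: sderM.
suff -> : - (F' / F 0 ^+ 2) = G' by [].
have F00 := near0_at0 nz.
have dFG : lder (fun=> 1) (F' * (F 0)^-1 + F 0 * G').
  by apply: lder_near (lderM dF dG); apply: near0_imp nz => h; apply: mulfV.
have /eqP := lder_uniq dFG (lder_cst 1); rewrite addrC addr_eq0 => /eqP E.
by apply: (mulfI F00); rewrite E; field.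
Qed.

Lemma lder_dz (F : C -> L) (F' : L) : lder F F' -> lder (fun h => dz (F h)) (dz F').
Proof.
move=> [[N FN] dF]; split=> [|k].
  by exists (N - 1); apply: near0_imp FN => h; apply: lge_dz.
rewrite lcoef_dz; apply: (@sder_ext (fun h => (k + 1)%:~R * F h (k + 1))).
  by move=> h; rewrite lcoef_dz.
by have := sderM (sder_cst (k + 1)%:~R) (dF (k + 1)); rewrite mul0r add0r.
Qed.
End Jets.

Section RationalFamilies.
Variable C : numFieldType.
Local Notation L := (laurent C).
Local Notation K := {fraction {poly C}}.
Variable sing : (C -> C) -> Prop.

(** Each singularity in [sing] must either follow a finite centre identically or stay away from it
    at h = 0. A singularity meeting the centre only at h = 0 would make the pole order jump, and
    coefficientwise derivatives need not exist then. *)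
Definition adm (p : C -> option C) (e : C) :=
  (p = (fun=> None) /\ e = 0) \/
  exists2 c, p = (fun h => Some (c h)) & sder c e /\
    forall u, sing u -> near0 (fun h => c h = u h) \/ c 0 != u 0.

(* [lder] differentiates the coefficients at the moving centre [p]; the last
   term restores the derivative with x fixed. *)
Definition gder (f : C -> K) (f' : K) := forall p e, adm p e ->
  lder (fun h => expand (p h) (f h))
       (expand (p 0) f' + lC e * dz (expand (p 0) (f 0))).

Lemma adm_oo : adm (fun=> None) 0. Proof. by left. Qed.

(** The point oo is always an admissible centre, it does not move, and expansion there is
    injective. *)
Lemma gder_uniq (f : C -> K) (f' g' : K) : gder f f' -> gder f g' -> f' = g'.
Proof.
move=> /(_ _ _ adm_oo) df /(_ _ _ adm_oo) dg.
have E := addIr _ (lder_uniq df dg); exact: (fmorph_inj (expand None) E).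
Qed.

Lemma gder_near (f g : C -> K) (f' : K) :
  near0 (fun h => f h = g h) -> gder f f' -> gder g f'.
Proof.
move=> fg df p e pe; rewrite -(near0_at0 fg); apply: lder_near (df p e pe).
by apply: near0_imp fg => h ->.
Qed.

Lemma gder_ext (f g : C -> K) (f' : K) : f =1 g -> gder f f' -> gder g f'.
Proof. by move=> /funext ->. Qed.

Lemma gder_cK (a : C -> C) (a' : C) : sder a a' ->
  gder (fun h => cK (a h)) (cK a').
Proof.
move=> da p e pe; rewrite !expandC dz_lC mulr0 addr0.
by apply: lder_ext (lder_lC da) => h; rewrite expandC.
Qed.

Lemma gder_cst (c : C) : gder (fun=> cK c) 0.
Proof. by have := gder_cK (sder_cst c); rewrite rmorph0. Qed.

Lemma gder0 : gder (fun=> 0) 0.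
Proof. by have := gder_cst 0; rewrite rmorph0. Qed.

Lemma gder1 : gder (fun=> 1) 0.
Proof. by have := gder_cst 1; rewrite rmorph1. Qed.

Lemma gder_xK : gder (fun=> xK C) 0.
Proof.
move=> p e [[-> ->]|[c -> [dc _]]] /=.
  by rewrite rmorph0 lC0 mul0r addr0; apply: lder_cst.
rewrite rmorph0 add0r expandX /coord_at dzD dz_lC dz_lX lC1 mul1r add0r mulr1.
rewrite -[lC e]addr0; apply: lder_ext (lderD (lder_lC dc) (lder_cst _)) => h.
by rewrite expandX.
Qed.

Lemma gderD (f g : C -> K) (f' g' : K) : gder f f' -> gder g g' ->
  gder (fun h => f h + g h) (f' + g').
Proof.
move=> df dg p e pe; have := lderD (df p e pe) (dg p e pe).
rewrite !rmorphD /= dzD mulrDr addrACA; apply: lder_ext => h.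
by rewrite rmorphD.
Qed.

Lemma gderN (f : C -> K) (f' : K) : gder f f' -> gder (fun h => - f h) (- f').
Proof.
move=> df p e pe; have := lderN (df p e pe).
rewrite opprD !rmorphN /= dzN mulrN; apply: lder_ext => h.
by rewrite rmorphN.
Qed.

Lemma gderB (f g : C -> K) (f' g' : K) : gder f f' -> gder g g' ->
  gder (fun h => f h - g h) (f' - g').
Proof. by move=> df dg; apply: gderD => //; apply: gderN. Qed.

Lemma gderM (f g : C -> K) (f' g' : K) : gder f f' -> gder g g' ->
  gder (fun h => f h * g h) (f' * g 0 + f 0 * g').
Proof.
move=> df dg p e pe; have := lderM (df p e pe) (dg p e pe).
rewrite rmorphD !rmorphM /= dzM.
move: (expand _ f') (expand _ g') (expand _ (f 0)) (expand _ (g 0)) (dz _) (dz _) (lC e).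
move=> f1 g1 f0 g0 df0 dg0 e0; set X := _ + _; set Y := _ + _.
have -> : X = Y by rewrite /X /Y; ring.
by apply: lder_ext => h; rewrite rmorphM.
Qed.

Lemma gder_sum (I : Type) (r : seq I) (f : I -> C -> K) (f' : I -> K) :
  (forall i, gder (f i) (f' i)) ->
  gder (fun h => \sum_(i <- r) f i h) (\sum_(i <- r) f' i).
Proof.
move=> df; elim: r => [|i r IH].
  by rewrite big_nil; apply: gder_ext gder0 => h; rewrite big_nil.
by rewrite big_cons; apply: gder_ext (gderD (df i) IH) => h; rewrite big_cons.
Qed.

Lemma gder_prod_ex (I : Type) (r : seq I) (P : pred I) (f : I -> C -> K) :
  (forall i, P i -> exists f', gder (f i) f') ->
  exists f', gder (fun h => \prod_(i <- r | P i) f i h) f'.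
Proof.
move=> df; elim: r => [|i r [f' IH]].
  by exists 0; apply: gder_ext gder1 => h; rewrite big_nil.
case Pi: (P i); last first.
  by exists f'; apply: gder_ext IH => h; rewrite big_cons Pi.
have [g' dg] := df i Pi; eexists; apply: gder_ext (gderM dg IH) => h.
by rewrite big_cons Pi.
Qed.

Lemma gder_sum_ex (I : Type) (r : seq I) (f : I -> C -> K) :
  (forall i, exists f', gder (f i) f') ->
  exists f', gder (fun h => \sum_(i <- r) f i h) f'.
Proof. by move=> /choice[f' df]; eexists; apply: gder_sum df. Qed.

Lemma gder_exp_ex (f : C -> K) (k : nat) : (exists f', gder f f') ->
  exists f', gder (fun h => f h ^+ k) f'.
Proof.
move=> [f' df]; elim: k => [|k [g' IH]]; first by exists 0; apply: gder1.
by eexists; apply: gder_ext (gderM df IH) => h; rewrite exprS.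
Qed.

Lemma lder_sub (c u : C -> C) (e u' : C) : sder c e -> sder u u' ->
    near0 (fun h => c h = u h) \/ c 0 != u 0 ->
  exists2 N, near0 (fun h => lge N (lC (c h) + lX C 1 - lC (u h))) &
    (lC (c 0) + lX C 1 - lC (u 0)) N != 0.
Proof.
move=> dc du [cu|cu].
  exists 1; last by rewrite (near0_at0 cu) addrAC subrr add0r lcoef_lmonom oner_eq0.
  by apply: near0_imp cu => h ->; rewrite addrAC subrr add0r; apply: lge_lX.
exists 0; last by rewrite lcoefB lcoefD !lcoef_lmonom /= addr0 subr_eq0.
apply: near0T => h; apply: lgeB; last exact: lge_lC.
by apply: lgeD; [apply: lge_lC | apply: lge_le (@lge_lX _ 1)].
Qed.

(** Admissibility makes the order of [x - u] at the centre constant near h = 0, as [lderV] requires: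
    -1 at oo, 1 when the centre follows [u], 0 when it is away from [u]. *)
Lemma gder_pole (u : C -> C) (u' : C) : sing u -> sder u u' ->
  gder (fun h => (xK C - cK (u h))^-1) (cK u' / (xK C - cK (u 0)) ^+ 2).
Proof.
move=> su du p e pe.
have dF := gderB gder_xK (gder_cK du) pe.
have [N FN F0N] : exists2 N,
    near0 (fun h => lge N (expand (p h) (xK C - cK (u h)))) &
    expand (p 0) (xK C - cK (u 0)) N != 0.
  case: pe => [[-> _]|[c -> [dc /(_ u su) cu]]].
    exists (-1); [apply: near0T => h|];
      rewrite rmorphB /= expandX expandC /coord_at.
      by apply: lgeB; [apply: lge_lX | apply: lge_le (@lge_lC C (u h)); lia].
    by rewrite lcoefB !lcoef_lmonom subr0 oner_eq0.
  have [N cN c0N] := lder_sub dc du cu; exists N.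
    by apply: near0_imp cN => h; rewrite rmorphB /= expandX expandC.
  by rewrite rmorphB /= expandX expandC.
have := lderV dF FN F0N.
have F0 : expand (p 0) (xK C - cK (u 0)) != 0.
  by apply: contraNneq F0N => ->.
rewrite fmorph_div rmorphXn fmorphV sub0r rmorphN /= (deriv_inv (@dzM C)) //.
rewrite mulrDl opprD mulNr opprK mulrN mulrA.
by apply: lder_ext => h; rewrite fmorphV.
Qed.

Lemma gder_pole_ex (u : C -> C) k : sing u -> (exists u', sder u u') ->
  exists f', gder (fun h => ((xK C - cK (u h)) ^+ k)^-1) f'.
Proof.
move=> su [u' du]; have [f' df] := gder_exp_ex k (ex_intro _ _ (gder_pole su du)).
by exists f'; apply: gder_ext df => h; rewrite exprVn.
Qed.

End RationalFamilies.

(** * Connection matrices and gauge transformations *)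

Section NoncommutativeRing.
Variable S : nzRingType.

(** Interface for the noncommutative ring tactic: the gauge identities are proved in an abstract
    ring with a derivation and specialised to matrices afterwards. *)
#[local] Instance nz_ring_ops : @Ncring.Ring_ops S 0 1 (@GRing.add S) (@GRing.mul S)
  (fun x y => x - y) (@GRing.opp S) (@eq S) := {}.
#[local] Instance nz_ring_axioms : Ncring.Ring (Ro := nz_ring_ops).
Proof.
constructor; try (typeclasses eauto).
all: move=> *; hnf.
all: rewrite /Algebra_syntax.addition /Algebra_syntax.multiplication /Algebra_syntax.subtraction /Algebra_syntax.opposite.
all: rewrite /Ncring.add_notation /Ncring.mul_notation /Ncring.sub_notation /Ncring.opp_notation /=.
all: try solve [by rewrite ?(addrA,mulrA,mul1r,mulr1,mulrDl,mulrDr,add0r,subrr) | by rewrite addrC].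
all: congruence.
Qed.

Variable d : S -> S.
Hypothesis dB : zmod_morphism d.
Hypothesis dM : forall x y, d (x * y) = d x * y + x * d y.
Implicit Types G Gi X Y Om F L : S.

Let d0 : d 0 = 0. Proof. by rewrite -[X in d X](subrr 0) dB subrr. Qed.
Let dN x : d (- x) = - d x. Proof. by rewrite -sub0r dB d0 sub0r. Qed.
Let dD x y : d (x + y) = d x + d y.
Proof. by rewrite -[y in LHS]opprK dB dN opprK. Qed.

Definition nabla Om X := d X + (Om * X - X * Om).

Lemma nablaB Om X Y : nabla Om (X - Y) = nabla Om X - nabla Om Y.
Proof. by rewrite /nabla dB; Ncring_tac.non_commutative_ring. Qed.

Definition gauge G Gi Om := Gi * d G + Gi * Om * G.

Lemma mul_gauge G Gi Om : G * Gi = 1 -> G * gauge G Gi Om = d G + Om * G.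
Proof. by move=> GG; rewrite /gauge mulrDr !mulrA GG !mul1r. Qed.

Lemma gauge_uniq G Gi Om Om' : Gi * G = 1 -> G * Om' = d G + Om * G ->
  Om' = gauge G Gi Om.
Proof.
by move=> GG E; rewrite -[Om']mul1r -GG -mulrA E /gauge mulrDr mulrA.
Qed.

Lemma gauge_comp G Gi H Hi Om : G * Gi = 1 -> H * Hi = 1 -> Gi * G = 1 -> Hi * H = 1 ->
  gauge (G * H) (Hi * Gi) Om = gauge H Hi (gauge G Gi Om).
Proof.
move=> GG HH GG' HH'; apply/esym/gauge_uniq.
  by rewrite -mulrA [Gi * _]mulrA GG' mul1r.
rewrite -mulrA mul_gauge // mulrDr [G * (_ * H)]mulrA mul_gauge // dM.
by Ncring_tac.non_commutative_ring.
Qed.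

Lemma nabla_gauge G Gi Om X : G * Gi = 1 -> Gi * G = 1 ->
  G * nabla (gauge G Gi Om) X = nabla Om (G * X * Gi) * G.
Proof.
move=> GG GG'; rewrite {1}/nabla mulrDr mulrBr mulrA mul_gauge //.
(* The derivative of the inverse, from d(Gi G) = d 1 = 0. *)
have E : d Gi * G = - (Gi * d G).
  apply/eqP; rewrite -addr_eq0 -dM GG'.
  by apply/eqP; apply: (addrI (d 1)); have := dM 1 1; rewrite !mulr1 mul1r addr0.
rewrite /nabla !dM !mulrDl mulNr -[G * X * d Gi * G]mulrA E.
rewrite -[Om * _ * G]mulrA -[G * X * Gi * G]mulrA GG' mulr1 /gauge.
rewrite -[d G * X * Gi * G]mulrA GG' -[G * d X * Gi * G]mulrA GG'.
by Ncring_tac.non_commutative_ring.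
Qed.

(** The hypothesis is the parameter derivative of [G * O = d G + Om * G], with [G1], [Om1], [O'] the
    derivatives of [G], [Om] and the transformed matrix. The motion of the frame contributes exactly
    the covariant derivative of [Gi * G1]. *)
Lemma derivative_gauge G Gi Om G1 Om1 O' : G * Gi = 1 ->
  G1 * gauge G Gi Om + G * O' = d G1 + (Om1 * G + Om * G1) ->
  G * O' = Om1 * G + G * nabla (gauge G Gi Om) (Gi * G1).
Proof.
move=> GG; set O := gauge G Gi Om; set T := Gi * G1 => E.
have GT : G * T = G1 by rewrite /T mulrA GG mul1r.
have GO : G * O = d G + Om * G by apply: mul_gauge.
have -> : G * nabla O T = G * d T + ((G * O) * T - (G * T) * O).
  by rewrite /nabla; Ncring_tac.non_commutative_ring.
have -> : G * O' = d G1 + (Om1 * G + Om * G1) - G1 * O by rewrite -E addrC addKr.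
rewrite GO GT mulrDl -[Om * G * T]mulrA GT -GT dM.
by Ncring_tac.non_commutative_ring.
Qed.

Lemma gauge_solution G Gi Om F Lam : G * Gi = 1 ->
  d (G * F) + Om * (G * F) = G * F * Lam ->
  G * (d F + gauge G Gi Om * F) = G * (F * Lam).
Proof.
move=> GG E; rewrite mulrDr [G * (_ * F)]mulrA mul_gauge // [RHS]mulrA -E dM.
by Ncring_tac.non_commutative_ring.
Qed.

(** Algebraic shadow of differentiating (d + Om) psi = 0 for psi = F exp(-Lambda): [Delta] stands
    for the derivative of Lambda, and its commuting with [Lam] replaces any manipulation of the
    exponential. *)
Lemma nabla_dlog Om F Fi Lam F1 Om1 Lam1 Delta : F * Fi = 1 -> Fi * F = 1 ->
    d F + Om * F = F * Lam ->
    d F1 + (Om1 * F + Om * F1) = F1 * Lam + F * Lam1 ->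
    d Delta = Lam1 -> Delta * Lam = Lam * Delta ->
  nabla Om (F1 * Fi - F * Delta * Fi) = - Om1.
Proof.
move=> FF FF' E E1 dDelta comm; set X := _ - _.
have XF : X * F = F1 - F * Delta by rewrite mulrBl -!mulrA FF' !mulr1.
rewrite -[LHS]mulr1 -FF mulrA -[RHS]mulr1 -FF [RHS]mulrA; congr (_ * _).
have dF : d F = F * Lam - Om * F by rewrite -E addrK.
have -> : nabla Om X * F = d (X * F) - X * d F + (Om * (X * F) - X * (Om * F)).
  by rewrite /nabla dM; Ncring_tac.non_commutative_ring.
rewrite dF mulrBr [X * (F * Lam)]mulrA XF dB dM dDelta dF.
have -> : d F1 = F1 * Lam + F * Lam1 - (Om1 * F + Om * F1) by rewrite -E1 addrK.
rewrite [(F1 - _) * Lam]mulrBl -[F * Delta * Lam]mulrA comm.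
by Ncring_tac.non_commutative_ring.
Qed.
End NoncommutativeRing.

Section MatrixNabla.
Variables (F : fieldType) (d : F -> F).
Hypothesis dB : zmod_morphism d.
Hypothesis dM : forall x y, d (x * y) = d x * y + x * d y.
Implicit Types A B X Y : 'M[F]_2.

Let d0 : d 0 = 0. Proof. by rewrite -[X in d X](subrr 0) dB subrr. Qed.
Let dN x : d (- x) = - d x. Proof. by rewrite -sub0r dB d0 sub0r. Qed.
Let dD x y : d (x + y) = d x + d y.
Proof. by rewrite -[y in LHS]opprK dB dN opprK. Qed.

Lemma map_derivM A B : map_mx d (A *m B) = map_mx d A *m B + A *m map_mx d B.
Proof.
apply/matrixP => i j; rewrite !mxE !big_ord_recl !big_ord0 !mxE !dD d0 !dM.
by rewrite !addr0 addrACA.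
Qed.

Lemma map_derivB : zmod_morphism (map_mx d : 'M[F]_2 -> 'M[F]_2).
Proof. by move=> A B; apply/matrixP => i j; rewrite !mxE dB. Qed.

Lemma map_derivD A B : map_mx d (A + B) = map_mx d A + map_mx d B.
Proof. by apply/matrixP => i j; rewrite !mxE dD. Qed.

Lemma map_deriv1 : map_mx d 1%:M = 0 :> 'M[F]_2.
Proof.
apply/matrixP => i j; rewrite !mxE.
by case: eqP => _; rewrite ?mulr1n ?mulr0n ?(deriv_one dM) ?d0.
Qed.

Lemma deriv_mxtrace A : d (\tr A) = \tr (map_mx d A).
Proof. by rewrite /mxtrace !big_ord_recl !big_ord0 !dD d0 !mxE. Qed.

Definition nabmx A X : 'M[F]_2 := nabla (map_mx d) A X.

Lemma nabmxE A X : nabmx A X = map_mx d X + (A *m X - X *m A). Proof. by []. Qed.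

Lemma nabmxB A X Y : nabmx A (X - Y) = nabmx A X - nabmx A Y.
Proof. exact: (nablaB map_derivB). Qed.
Lemma nabmx0 A : nabmx A 0 = 0.
Proof. by rewrite -[X in nabmx _ X](subrr 0) nabmxB subrr. Qed.
Lemma nabmxN A X : nabmx A (- X) = - nabmx A X.
Proof. by rewrite -[- X]sub0r nabmxB nabmx0 sub0r. Qed.
Lemma nabmxD A X Y : nabmx A (X + Y) = nabmx A X + nabmx A Y.
Proof. by rewrite -[Y in LHS]opprK nabmxB nabmxN opprK. Qed.

Let trB A B : \tr (A - B) = \tr A - \tr B. Proof. exact: raddfB. Qed.

Let trN A : \tr (- A) = - \tr A. Proof. exact: raddfN. Qed.

Lemma mxtrace_nab A X : \tr (nabmx A X) = d (\tr X).
Proof.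
by rewrite nabmxE mxtraceD trB [\tr (X *m A)]mxtrace_mulC subrr addr0 deriv_mxtrace.
Qed.

Lemma mxtrace_nab_mul A X Y :
  \tr (nabmx A X *m Y) + \tr (X *m nabmx A Y) = d (\tr (X *m Y)).
Proof.
rewrite deriv_mxtrace map_derivM !nabmxE mulmxDl mulmxDr mulmxBl mulmxBr.
rewrite !mxtraceD !trN !mulmxA addrACA.
rewrite [\tr (X *m Y *m A)]mxtrace_mulC mulmxA.
by rewrite [X in _ + X]addrA subrK subrr addr0.
Qed.

(** The commutator disappears under the trace against [A] itself, so for a regular [X] the trace has
    a pole no worse than that of [A], instead of twice that order. This controls the lower left
    entry in [rigidity]. *)
Lemma mxtrace_nab_self A X : \tr (nabmx A X *m A) = \tr (map_mx d X *m A).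
Proof.
rewrite nabmxE mulmxDl mxtraceD mulmxBl trB.
by rewrite -mulmxA [\tr (A *m _)]mxtrace_mulC subrr addr0.
Qed.

Lemma gauge_transform1 A : gauge_transform d 1%:M A = A.
Proof. by rewrite /gauge_transform invmx1 map_deriv1 mulmx0 add0r mulmx1 mul1mx. Qed.

Lemma gauge_transform_comp G H A : G \in unitmx -> H \in unitmx ->
  gauge_transform d (G *m H) A = gauge_transform d H (gauge_transform d G A).
Proof.
move=> uG uH; have uGH : G *m H \in unitmx by rewrite unitmx_mul uG.
have iGH : invmx (G *m H) = invmx H *m invmx G.
  apply: (can_inj (mulKmx uGH)); rewrite mulmxV // -mulmxA [H *m _]mulmxA mulmxV //.
  by rewrite mul1mx mulmxV.
rewrite {1}/gauge_transform iGH.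
by apply: (gauge_comp map_derivM); [apply: mulmxV|apply: mulmxV|apply: mulVmx|apply: mulVmx].
Qed.

Lemma mulmx_gauge G A : G \in unitmx ->
  G *m gauge_transform d G A = map_mx d G + A *m G.
Proof. by move=> uG; apply: mul_gauge; apply: mulmxV. Qed.

Lemma nabmx_gauge G A X : G \in unitmx ->
  nabmx (gauge_transform d G A) X = invmx G *m nabmx A (G *m X *m invmx G) *m G.
Proof.
move=> uG; rewrite -mulmxA; apply: (canRL (mulKmx uG)).
by apply: (nabla_gauge map_derivM); [apply: mulmxV | apply: mulVmx].
Qed.
End MatrixNabla.

Section Mx2.
Variable F : fieldType.
Implicit Types (a b c d : F) (A B G : 'M[F]_2).

Lemma mx2E a b c d : [/\ mx2 a b c d 0 0 = a, mx2 a b c d 0 1 = b,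
  mx2 a b c d 1 0 = c & mx2 a b c d 1 1 = d].
Proof. by split; rewrite mxE. Qed.

Lemma mx2P A B : A 0 0 = B 0 0 -> A 0 1 = B 0 1 -> A 1 0 = B 1 0 ->
  A 1 1 = B 1 1 -> A = B.
Proof.
move=> h00 h01 h10 h11; apply/matrixP => i j.
have ord2 (k : 'I_2) : k = 0 \/ k = 1.
  by case: k => [[|[|//]] hk]; [left|right]; apply: val_inj.
by case: (ord2 i) => ->; case: (ord2 j) => ->.
Qed.

Lemma mx2_eta A : A = mx2 (A 0 0) (A 0 1) (A 1 0) (A 1 1).
Proof. by apply: mx2P; rewrite mxE. Qed.

Lemma mulmx2E A B i j : (A *m B) i j = A i 0 * B 0 j + A i 1 * B 1 j.
Proof.
rewrite mxE !big_ord_recl big_ord0 addr0; congr (_ + A i _ * B _ j);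
  exact: val_inj.
Qed.

Lemma mulmx2 a b c d a' b' c' d' : mx2 a b c d *m mx2 a' b' c' d' =
  mx2 (a * a' + b * c') (a * b' + b * d') (c * a' + d * c') (c * b' + d * d').
Proof. by apply: mx2P; rewrite mulmx2E !mxE. Qed.

Lemma mxtrace2E A : \tr A = A 0 0 + A 1 1.
Proof.
rewrite /mxtrace !big_ord_recl big_ord0 addr0; congr (_ + A _ _); exact: val_inj.
Qed.

Lemma det2E A : \det A = A 0 0 * A 1 1 - A 0 1 * A 1 0.
Proof.
rewrite (expand_det_row A 0) !big_ord_recl big_ord0 addr0 /cofactor.
rewrite !det_mx11 !mxE /= expr0 mul1r expr1 mulN1r mulrN.
by congr (A _ _ * A _ _ - A _ _ * A _ _); apply: val_inj.
Qed.

Lemma mx2_1 : mx2 1 0 0 1 = 1%:M :> 'M[F]_2.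
Proof. by apply: mx2P; rewrite !mxE. Qed.

Lemma unitmx2 A : (A \in unitmx) = (\det A != 0).
Proof. by rewrite unitmxE unitfE. Qed.

Lemma invmx2E A : A \in unitmx ->
  invmx A = mx2 ((\det A)^-1 * A 1 1) (- ((\det A)^-1 * A 0 1))
                (- ((\det A)^-1 * A 1 0)) ((\det A)^-1 * A 0 0).
Proof.
move=> u; have d0 : \det A != 0 by rewrite -unitmx2.
apply: (can_inj (mulKmx u)); rewrite mulmxV // {1}[A]mx2_eta mulmx2 -mx2_1.
by move: d0; rewrite det2E => d0; congr mx2; field.
Qed.

Lemma invmx_lower c d : d != 0 ->
  mx2 1 0 c d \in unitmx /\ invmx (mx2 1 0 c d) = mx2 1 0 (- c / d) d^-1.
Proof.
move=> d0; have u : mx2 1 0 c d \in unitmx.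
  by rewrite unitmx2 det2E !mxE /= mul1r mul0r subr0.
split=> //; apply: (can_inj (mulKmx u)); rewrite mulmxV // mulmx2 -mx2_1.
by congr mx2; field.
Qed.

Lemma conj_mulmx G A B : G \in unitmx ->
  invmx G *m (A *m B) *m G = (invmx G *m A *m G) *m (invmx G *m B *m G).
Proof. by move=> uG; rewrite -!mulmxA mulKVmx. Qed.

Lemma conj_conjV G A : G \in unitmx -> G *m (invmx G *m A *m G) *m invmx G = A.
Proof. by move=> uG; rewrite !mulmxA mulmxV // mul1mx -mulmxA mulmxV // mulmx1. Qed.

Lemma mxtrace_conj G A : G \in unitmx -> \tr (invmx G *m A *m G) = \tr A.
Proof. by move=> uG; rewrite mxtrace_mulC mulmxA mulmxV // mul1mx. Qed.

Lemma conjZ G c A : invmx G *m (c *: A) *m G = c *: (invmx G *m A *m G).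
Proof. by rewrite -scalemxAr -scalemxAl. Qed.

Lemma conjB G A B : invmx G *m (A - B) *m G =
  invmx G *m A *m G - invmx G *m B *m G.
Proof. by rewrite mulmxBr mulmxBl. Qed.
End Mx2.

Lemma map_mx2 (F G : fieldType) (f : F -> G) a b c d :
  map_mx f (mx2 a b c d) = mx2 (f a) (f b) (f c) (f d).
Proof. by apply: mx2P; rewrite !mxE. Qed.

(** * Connections and endomorphisms in local frames *)

Section LocalExpressions.
Variable C : numFieldType.
Local Notation L := (laurent C).
Local Notation K := {fraction {poly C}}.
Implicit Types (a : option C) (A B : 'M[L]_2) (Om G X Y : 'M[K]_2) (k l : nat) (M N : int).

Definition mlge N A := forall i j, lge N (A i j).

Lemma mlgeD N A B : mlge N A -> mlge N B -> mlge N (A + B).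
Proof. by move=> hA hB i j; rewrite mxE; apply: lgeD. Qed.
Lemma mlgeN N A : mlge N A -> mlge N (- A).
Proof. by move=> hA i j; rewrite mxE; apply: lgeN. Qed.
Lemma mlgeB N A B : mlge N A -> mlge N B -> mlge N (A - B).
Proof. by move=> hA hB; apply: mlgeD => //; apply: mlgeN. Qed.
Lemma mlgeM M N A B : mlge M A -> mlge N B -> mlge (M + N) (A *m B).
Proof. by move=> hA hB i j; rewrite mulmx2E; apply: lgeD; apply: lgeM. Qed.
Lemma mlgeMl N A B : mlge 0 A -> mlge N B -> mlge N (A *m B).
Proof. by move=> hA hB; rewrite -[N]add0r; apply: mlgeM. Qed.
Lemma mlgeMr N A B : mlge N A -> mlge 0 B -> mlge N (A *m B).
Proof. by move=> hA hB; rewrite -[N]addr0; apply: mlgeM. Qed.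
Lemma mlge_le M N A : (M <= N)%R -> mlge N A -> mlge M A.
Proof. by move=> MN hA i j; apply: lge_le MN (hA i j). Qed.
Lemma mlge_tr N A : mlge N A -> lge N (\tr A).
Proof. by move=> hA; rewrite mxtrace2E; apply: lgeD. Qed.
Lemma mlge_mx2 N (p q r s : L) : lge N p -> lge N q -> lge N r -> lge N s ->
  mlge N (mx2 p q r s).
Proof.
move=> hp hq hr hs i j; rewrite mxE.
by case: ifP => _; case: ifP => _.
Qed.
Lemma mlge_dz A : mlge 0 A -> mlge 0 (map_mx (@dz C) A).
Proof. by move=> hA i j; rewrite mxE; apply: lge0_dz. Qed.
Lemma mlge_dg N f : (forall i, lge N (f i)) -> mlge N (dg f).
Proof.
by move=> hf i j; rewrite !mxE; case: eqP => _; rewrite ?mulr1n ?mulr0n.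
Qed.
Lemma mlge_nab N A B : (N <= 0)%R -> mlge N A -> mlge 0 B -> mlge N (nabmx (@dz C) A B).
Proof.
move=> N0 hA hB; rewrite nabmxE; apply: mlgeD.
  exact: mlge_le N0 (mlge_dz hB).
by apply: mlgeB; [apply: mlgeMr | apply: mlgeMl].
Qed.

(** Membership in GL_2 of the ring of formal power series. *)
Definition lunitmx A := mlge 0 A /\ (\det A) 0 != 0.

Lemma lge_det A : mlge 0 A -> lge 0 (\det A).
Proof. by move=> hA; rewrite det2E -[0]add0r; apply: lgeB; apply: lgeM. Qed.

Lemma lunitmxM A B : lunitmx A -> lunitmx B -> lunitmx (A *m B).
Proof.
move=> [hA A0] [hB B0]; split; first exact: mlgeMl.
have := lead_lcoefM (lge_det hA) (lge_det hB).
by rewrite addr0 det_mulmx => ->; rewrite mulf_neq0.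
Qed.

Lemma lunitmx_unit A : lunitmx A -> A \in unitmx.
Proof. by move=> [_ A0]; rewrite unitmx2; apply: contraNneq A0 => ->. Qed.

Lemma lunitmxV A : lunitmx A -> lunitmx (invmx A).
Proof.
move=> uA; have u := lunitmx_unit uA; have [hA A0] := uA.
have hd := lge_unit (lge_det hA) A0.
split; last by rewrite det_inv lge_unit_coef ?invr_eq0 //; apply: lge_det.
rewrite invmx2E //.
by apply: mlge_mx2; try apply: lgeN; rewrite -[0]add0r; apply: lgeM.
Qed.

Lemma lunitmx_inv_ge A : lunitmx A -> mlge 0 (invmx A).
Proof. by case/lunitmxV. Qed.

Lemma det_lunitmx2 (p q r s : L) : lge 0 p -> lge 0 q -> lge 0 r -> lge 0 s ->
  p 0 * s 0 - q 0 * r 0 != 0 -> lunitmx (mx2 p q r s).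
Proof.
move=> hp hq hr hs; split; first exact: mlge_mx2.
rewrite det2E !mxE /= lcoefB -[X in (p * s) X]addr0 lead_lcoefM //.
by rewrite -[X in (q * r) X]addr0 lead_lcoefM.
Qed.

Lemma lcoef_det A : mlge 0 A -> (\det A) 0 = A 0 0 0 * A 1 1 0 - A 0 1 0 * A 1 0 0.
Proof.
move=> hA; rewrite det2E lcoefB -[X in (A 0 0 * _) X]addr0 lead_lcoefM //.
by rewrite -[X in (A 0 1 * _) X]addr0 lead_lcoefM.
Qed.

Local Notation E a := (map_mx (expand a)).

(** The change from the U_0-frame to the frame used at [a], so that finite points and oo are treated
    by the same formulas. *)
Definition Gam k a : 'M[L]_2 := if a is Some _ then 1%:M else E a (Gk k (xK C)).

Lemma Gk_unit k : Gk k (xK C) \in unitmx.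
Proof.
rewrite /Gk unitmx2 det2E !mxE /= mul0r subr0 mul1r expf_neq0 //.
by rewrite tofrac_eq0 polyX_eq0.
Qed.

Lemma Gam_unit k a : Gam k a \in unitmx.
Proof. by case: a => [c|] /=; rewrite ?unitmx1 // map_unitmx Gk_unit. Qed.

Lemma Gam_oo k : Gam k None = mx2 1 0 0 (lX C (- k%:Z)).
Proof.
rewrite /Gam /Gk map_mx2 !rmorph0 rmorph1 rmorphXn /= expandX /coord_at lX_exp.
by congr (mx2 _ _ _ (lX _ _)); rewrite mulN1r.
Qed.

Lemma map_expandM a X Y : E a (X *m Y) = E a X *m E a Y.
Proof. exact: map_mxM. Qed.
Lemma map_expandB a X Y : E a (X - Y) = E a X - E a Y.
Proof. exact: map_mxB. Qed.

Lemma dz_map_expand a X : map_mx (@dz C) (E a X) = jac a *: E a (map_mx (@dx C) X).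
Proof. by apply/matrixP => i j; rewrite !mxE dz_expand. Qed.

Lemma map_expand_nab a Om X : nabmx (@dz C) (jac a *: E a Om) (E a X) =
  jac a *: E a (nabmx (@dx C) Om X).
Proof.
rewrite !nabmxE (map_mxD (expand a)) map_expandB !map_expandM dz_map_expand.
by rewrite -scalemxAl -scalemxAr -scalerBr -scalerDr.
Qed.

Lemma map_expand_form a X : map_mx (expand_form a) X = jac a *: E a X.
Proof. by apply/matrixP => i j; rewrite !mxE expand_formE. Qed.

Lemma map_expand_gauge a G Om : G \in unitmx ->
  jac a *: E a (gauge_transform (@dx C) G Om) =
  gauge_transform (@dz C) (E a G) (jac a *: E a Om).
Proof.
move=> uG; rewrite /gauge_transform map_mxD !map_expandM map_invmx scalerDr.
by rewrite dz_map_expand -!scalemxAr -!scalemxAl.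
Qed.

Lemma conn_atE k a Om : conn_at k a Om =
  gauge_transform (@dz C) (Gam k a) (jac a *: E a Om).
Proof.
rewrite /conn_at map_expand_form; case: a => [c|] /=.
  by rewrite gauge_transform1 //; [apply: dzB | apply: dzM].
by rewrite -[- lX C (-2)]/(jac None) map_expand_gauge ?Gk_unit.
Qed.

Lemma end_atE k a X : end_at k a X = invmx (Gam k a) *m E a X *m Gam k a.
Proof.
rewrite /end_at; case: a => [c|] /=; first by rewrite invmx1 mul1mx mulmx1.
by rewrite !map_expandM map_invmx.
Qed.

Lemma end_atM k a X Y : end_at k a (X *m Y) = end_at k a X *m end_at k a Y.
Proof.
rewrite (end_atE k a (X *m Y)) (end_atE k a X) (end_atE k a Y) map_expandM.
exact: conj_mulmx (Gam_unit k a).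
Qed.
Lemma end_atB k a X Y : end_at k a (X - Y) = end_at k a X - end_at k a Y.
Proof. by rewrite end_atE map_expandB conjB -!end_atE. Qed.

Lemma mxtrace_end_at k a X : \tr (end_at k a X) = expand a (\tr X).
Proof.
rewrite end_atE mxtrace_conj ?Gam_unit //.
by rewrite !mxtrace2E !mxE rmorphD.
Qed.

Lemma nab_conn_at k a Om X : nabmx (@dz C) (conn_at k a Om) (end_at k a X) =
  jac a *: end_at k a (nabmx (@dx C) Om X).
Proof.
rewrite conn_atE nabmx_gauge ?Gam_unit //; [|exact: dzB|exact: dzM].
rewrite (end_atE k a X) (conj_conjV (E a X) (Gam_unit k a)).
rewrite (end_atE k a (nabmx _ _ _)) -(conjZ (Gam k a) (jac a) (E a _)).
by rewrite map_expand_nab.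
Qed.

(** Local matrix of a bundle map from E_l to E_k that is [G] over U_0. *)
Definition local_gauge k l a G : 'M[L]_2 := invmx (Gam k a) *m E a G *m Gam l a.

Lemma local_gauge_unit k l a G : G \in unitmx -> local_gauge k l a G \in unitmx.
Proof.
by move=> uG; rewrite !unitmx_mul unitmx_inv !Gam_unit map_unitmx uG.
Qed.

Lemma local_gauge_inv k l a G : G \in unitmx ->
  invmx (local_gauge k l a G) = local_gauge l k a (invmx G).
Proof.
move=> uG; have u := local_gauge_unit k l a uG.
have [uk ul] := (Gam_unit k a, Gam_unit l a).
have uE : E a G \in unitmx by rewrite map_unitmx.
apply: (can_inj (mulKmx u)); rewrite mulmxV // /local_gauge map_invmx.
by rewrite -!mulmxA (mulKVmx ul) (mulKVmx uE) (mulVmx uk).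
Qed.

Lemma conn_at_gauge k l a G Om : G \in unitmx ->
  conn_at l a (gauge_transform (@dx C) G Om) =
  gauge_transform (@dz C) (local_gauge k l a G) (conn_at k a Om).
Proof.
move=> uG; have [uk ul] := (Gam_unit k a, Gam_unit l a).
have uE : E a G \in unitmx by rewrite map_unitmx.
rewrite (conn_atE l a _) (conn_atE k a Om) (map_expand_gauge a Om uG).
rewrite -(gauge_transform_comp (@dzB C) (@dzM C) _ uE ul).
rewrite -(gauge_transform_comp (@dzB C) (@dzM C) _ uk (local_gauge_unit k l a uG)).
by rewrite /local_gauge -!mulmxA (mulKVmx uk).
Qed.

End LocalExpressions.

(** * Formal data and the normal form *)

Section FormalData.
Variable C : numFieldType.
Local Notation L := (laurent C).
Implicit Types (A M : 'M[L]_2) (r : nat).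

Lemma lge_polar r (th : 'I_2 -> nat -> C) b :
  lge (- r%:Z) (\sum_(l < r) lC (th b l) * lX C (l%:Z - r%:Z)).
Proof.
apply: lge_sum => l _; apply: lge_le (lgeM (@lge_lC C _) (@lge_lX C _)); lia.
Qed.

Lemma polar_diagE r (th : 'I_2 -> nat -> C) : polar_diag r th =
  mx2 (\sum_(l < r) lC (th 0 l) * lX C (l%:Z - r%:Z)) 0
      0 (\sum_(l < r) lC (th 1 l) * lX C (l%:Z - r%:Z)).
Proof. by apply: mx2P; rewrite !mxE /= ?mulr1n ?mulr0n. Qed.

(** Conjugation by [M] turns [A] into [T - N] with [N = M^-1 dM] holomorphic. Hence the trace is
    known modulo holomorphic terms and the determinant modulo poles of order at most r. For the
    normal form this fixes the principal part of d_0, and also that of c_0 at a finite pole, because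
    the determinant is - c_0 / P and P vanishes to order r there. *)
Lemma formal_data_bounds r th A : has_formal_data r th A ->
  [/\ lge 0 (\tr A - \tr (polar_diag r th)),
      lge (- r%:Z) (\det A - \det (polar_diag r th)) & mlge (- r%:Z) A].
Proof.
move=> [M [hM M0 ME]]; have uM : lunitmx M by [].
have u := lunitmx_unit uM.
have hMi := lunitmx_inv_ge uM.
set N := invmx M *m map_mx (@dz C) M.
have hN : mlge 0 N by apply: mlgeMl => //; apply: mlge_dz.
set T := polar_diag r th in ME *.
have AE : invmx M *m A *m M = T - N by rewrite -ME /gauge_transform addrC addKr.
have hT : mlge (- r%:Z) T.
  by apply: mlge_dg => b; apply: lge_polar.
have r0 : (- r%:Z <= 0)%R by lia.
have T01 : T 0 1 = 0 by rewrite /T polar_diagE !mxE.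
have T10 : T 1 0 = 0 by rewrite /T polar_diagE !mxE.
clearbody T N.
split.
- rewrite -(mxtrace_conj A u) AE.
  have -> : \tr (T - N) - \tr T = - \tr N by rewrite raddfB /= addrAC subrr sub0r.
  by apply: lgeN; apply: mlge_tr.
- have -> : \det A = \det (T - N).
    rewrite -AE !det_mulmx det_inv mulrC mulrA mulfV ?mul1r //.
    by rewrite -unitmx2.
  rewrite !det2E !mxE T01 T10 !mul0r subr0 !sub0r.
  have -> : (T 0 0 - N 0 0) * (T 1 1 - N 1 1) - - N 0 1 * - N 1 0 - T 0 0 * T 1 1
    = (N 0 0 * N 1 1 - N 0 1 * N 1 0) - (T 0 0 * N 1 1 + N 0 0 * T 1 1) by ring.
  apply: lgeB.
    by apply: lge_le r0 _; rewrite -[0]add0r; apply: lgeB; apply: lgeM.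
  by apply: lgeD; [rewrite -[- _]addr0|rewrite -[- _]add0r]; apply: lgeM.
have -> : A = M *m (T - N) *m invmx M.
  by rewrite -AE -{1}(conj_conjV A u).
apply: mlgeMr hMi; apply: mlgeMl => //; apply: mlgeB => //.
exact: mlge_le r0 hN.
Qed.
End FormalData.

Lemma expr_div_sub (F : fieldType) (x : F) r k : x != 0 -> (r <= k)%N ->
  x ^+ r * (x ^+ k)^-1 = (x ^+ (k - r))^-1.
Proof.
move=> x0 rk; rewrite -{1}(subnKC rk) exprD invfM mulrA mulfV ?mul1r //.
exact: expf_neq0.
Qed.

(** * Partial fractions with prescribed principal parts *)

Section PartialFractions.
Variables (C : numFieldType) (I J : finType).
Local Notation L := (laurent C).
Local Notation K := {fraction {poly C}}.
Variables (n : I -> nat) (t : I -> C) (q : J -> C).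
Hypotheses (n_gt0 : forall i, (0 < n i)%N) (t_inj : injective t) (q_inj : injective q).
Hypothesis qt : forall j i, q j != t i.

Lemma XsubK_exp (c : C) (k : nat) :
  tofrac (('X - c%:P) ^+ k) = (xK C - cK c) ^+ k.
Proof. by rewrite rmorphXn rmorphB. Qed.

Lemma expand_sub_same (c : C) : expand (Some c) (xK C - cK c) = lX C 1.
Proof. by rewrite rmorphB /= expandX expandC /coord_at addrAC subrr add0r. Qed.

Lemma expand_sub (c c' : C) : expand (Some c') (xK C - cK c) = lC (c' - c) + lX C 1.
Proof. by rewrite rmorphB /= expandX expandC /coord_at lCB addrAC. Qed.

Lemma lge_expand_sub (c c' : C) : lge 0 (expand (Some c') (xK C - cK c)) /\
  expand (Some c') (xK C - cK c) 0 = c' - c.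
Proof.
rewrite expand_sub; split; last by rewrite lcoefD !lcoef_lmonom addr0.
by apply: lgeD; [apply: lge_lC | apply: lge_le (@lge_lX C 1)].
Qed.

Lemma lge_expand_sub_inv (c c' : C) (k : nat) : c' != c ->
  lge 0 (expand (Some c') ((xK C - cK c) ^+ k)^-1).
Proof.
move=> cc; have [h h0] := lge_expand_sub c c'.
have hV : lge 0 (expand (Some c') (xK C - cK c))^-1.
  by apply: lge_unit h _; rewrite h0 subr_eq0.
rewrite -exprVn rmorphXn fmorphV /=; elim: k => [|k IH]; first exact: lge1.
by rewrite exprS -[0]addr0; apply: lgeM.
Qed.

Lemma expand_sub_oo (c : C) : lge (-1) (expand None (xK C - cK c)) /\
  expand None (xK C - cK c) (-1) = 1.
Proof.
rewrite rmorphB /= expandX expandC /coord_at; split.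
  by apply: lgeB; [apply: lge_lX | apply: lge_le (@lge_lC C c)].
by rewrite lcoefB !lcoef_lmonom subr0.
Qed.

Lemma expand_sub_inv_oo (c : C) (k : nat) :
  lge k%:Z (expand None ((xK C - cK c) ^+ k)^-1) /\
  expand None ((xK C - cK c) ^+ k)^-1 k%:Z = 1.
Proof.
have [h h1] := expand_sub_oo c.
have [hV hV1] : lge 1 (expand None (xK C - cK c))^-1 /\
   (expand None (xK C - cK c))^-1 1 = 1.
  by have := lgeV h; rewrite h1 oner_eq0 opprK invr1; apply.
rewrite -exprVn rmorphXn fmorphV /=; elim: k => [|k [IH IH1]].
  by rewrite expr0; split; [apply: lge1 | rewrite lcoef1].
rewrite exprS (_ : k.+1%:Z = 1 + k%:Z); last by lia.
by split; [apply: lgeM | rewrite lead_lcoefM // IH1 hV1 mulr1].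
Qed.

Lemma ratio_atE (f : {poly C}) c k :
  ratio_at f c k = tofrac f * ((xK C - cK c) ^+ k)^-1.
Proof. by rewrite /ratio_at XsubK_exp. Qed.

Lemma lge_ratio_at (f : {poly C}) c c' k : c' != c ->
  lge 0 (expand (Some c') (ratio_at f c k)).
Proof.
move=> cc; rewrite ratio_atE rmorphM /= -[0]addr0; apply: lgeM.
  by rewrite expand_poly; apply: lge_pexpand.
exact: lge_expand_sub_inv.
Qed.

Lemma lge_ratio_at_oo (f : {poly C}) c k : (0 < k)%N -> (size f <= k)%N ->
  lge 1 (expand None (ratio_at f c k)).
Proof.
case: k => // k _ fk; rewrite ratio_atE rmorphM /= expand_poly.
have [h _] := expand_sub_inv_oo c k.+1.
by apply: lge_le (lgeM (lge_pexpand_oo fk) h); lia.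
Qed.

Lemma coef_ratio_at (f : {poly C}) c (k r : nat) : (r < k)%N ->
  expand (Some c) (ratio_at f c k) (r%:Z - k%:Z) = (f \Po ('X + c%:P))`_r.
Proof.
move=> rk; rewrite ratio_atE rmorphM /= expand_poly -exprVn rmorphXn fmorphV /=.
rewrite expand_sub_same lXV lX_exp mulrC lcoef_lXM pexpand_shift pexpand_zero_coef.
by rewrite (_ : r%:Z - k%:Z - -1 * k%:Z = r%:Z); last by lia.
Qed.

Lemma ratio_at_expansion (f : {poly C}) c k : (size f <= k)%N ->
  ratio_at f c k =
  \sum_(r < k) cK ((f \Po ('X + c%:P))`_r) * ((xK C - cK c) ^+ (k - r))^-1.
Proof.
move=> fk; set g := f \Po _; have gk : (size g <= k)%N by rewrite size_comp_poly2 // size_XaddC.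
have fE : f = g \Po ('X - c%:P).
  by rewrite /g -comp_polyA comp_polyD comp_polyX comp_polyC subrK comp_polyXr.
have gE : g = \sum_(r < k) g`_r *: 'X^r.
  rewrite -{1}(coefK g) poly_def (big_ord_widen _ (fun r => g`_r *: 'X^r) gk).
  rewrite [RHS](bigID (fun r : 'I_k => (r < size g)%N)) /= [X in _ + X]big1 ?addr0 //.
  by move=> r; rewrite -leqNgt => /(nth_default 0) ->; rewrite scale0r.
rewrite ratio_atE fE {1}gE linear_sum /= rmorph_sum mulr_suml; apply: eq_bigr => r _.
rewrite linearZ /= -mul_polyC rmorphM comp_Xn_poly /= XsubK_exp -mulrA; congr (_ * _).
have x0 := xK_sub_neq0 c.
exact: expr_div_sub x0 (ltnW (ltn_ord r)).
Qed.

Variables (Cf : I -> {poly C}) (b : J -> C) (P : {poly C}) (f : K).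
Hypothesis Cf_size : forall i, (size (Cf i) <= n i)%N.
Hypothesis fE : f = \sum_i ratio_at (Cf i) (t i) (n i) +
  \sum_j ratio_at (b j)%:P (q j) 1 + tofrac P.

Lemma polar_coef i (r : 'I_(n i)) :
  expand (Some (t i)) f (r%:Z - (n i)%:Z) = (Cf i \Po ('X + (t i)%:P))`_r.
Proof.
rewrite fE !rmorphD !rmorph_sum /= !lcoefD !lcoef_sum expand_poly.
have rn : (r%:Z - (n i)%:Z < 0)%R by have := ltn_ord r; lia.
rewrite [X in _ + X]lge_pexpand // addr0.
rewrite [X in _ + X]big1 ?addr0 => [|j _]; last first.
  by rewrite lge_ratio_at // eq_sym qt.
rewrite (bigD1 i) //= big1 ?addr0 ?coef_ratio_at // => k ki.
by rewrite lge_ratio_at // (inj_eq t_inj) eq_sym.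
Qed.

Lemma partial_fractions : f =
  \sum_i \sum_(r < n i) cK (expand (Some (t i)) f (r%:Z - (n i)%:Z)) *
     ((xK C - cK (t i)) ^+ (n i - r))^-1 +
  \sum_j cK (b j) * ((xK C - cK (q j)) ^+ 1)^-1 + tofrac P.
Proof.
rewrite {1}fE; congr (_ + _ + _).
  apply: eq_bigr => i _; rewrite ratio_at_expansion //.
  by apply: eq_bigr => r _; rewrite polar_coef.
by apply: eq_bigr => j _; rewrite ratio_atE.
Qed.

(** Proper fractions vanish at oo, so the nonpositive powers of the local parameter see the
    polynomial part only. *)
Lemma polar_coef_oo (r : nat) : expand None f (- r%:Z) = P`_r.
Proof.
rewrite fE !rmorphD !rmorph_sum /= !lcoefD !lcoef_sum expand_poly pexpand_oo_coefN.
have r1 : (- r%:Z < 1)%R by lia.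
rewrite big1 ?add0r => [|i _]; last by rewrite lge_ratio_at_oo.
rewrite big1 ?add0r // => j _; rewrite lge_ratio_at_oo //.
by rewrite size_polyC; case: eqP.
Qed.
End PartialFractions.

Lemma sum_option (V : nmodType) (T : finType) (F : option T -> V) :
  \sum_i F i = F None + \sum_i F (Some i).
Proof.
rewrite (bigD1 None) //= (reindex_omap Some id) => [|[i|]] //=.
by congr (_ + _); apply: eq_bigl => i; rewrite eqxx.
Qed.

(** For the determinant at oo: [x4] and [x2] are z^4 and z^-2, undoing the square of dx = - z^-2 dz,
    while [a] and [b] are the factors z^-k and z^k from the transition matrix. *)
Lemma mul_det_oo (F : fieldType) (P x4 x2 a b g D : F) : P != 0 ->
    x4 * x2 * x2 = 1 -> a * b = 1 ->
  P * (x4 * (- (- x2 * P^-1 * a * (- x2 * g * b)) - D)) = - (g + P * (x4 * D)).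
Proof.
move=> P0 h1 h2.
transitivity (- ((P * P^-1) * (x4 * x2 * x2) * (a * b) * g + P * (x4 * D))).
  by ring.
by rewrite mulfV // h1 h2 !mul1r.
Qed.

(** With [y = x - q_j] and [p = p_j], regularity of this entry is the apparent singularity equation:
    c_0 + p_j d_0 - p_j^2 / P vanishes at q_j. *)
Lemma gauge_lower10 (F : fieldType) (d : F -> F) (p y g c e : F) : y != 0 ->
    d 1 = 0 -> d p = 0 ->
  gauge_transform d (mx2 1 0 p y) (mx2 0 g c e) 1 0 = (c + p * e - p ^+ 2 * g) / y.
Proof.
move=> y0 d1 dp; rewrite /gauge_transform; have [_ ->] := invmx_lower p y0.
rewrite map_mx2 d1 dp !mulmx2 !mxE /=; move: (d 0) (d y) => u w.
by field.
Qed.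

Section LeadingTerms.
Variable C : numFieldType.
Local Notation L := (laurent C).
Implicit Types (f g : L) (c : C) (N M : int).

Definition leading f N c := lge N f /\ f N = c.

Lemma leadingM f g N M c c' : leading f N c -> leading g M c' ->
  leading (f * g) (N + M) (c * c').
Proof.
by move=> [hf <-] [hg <-]; split; [apply: lgeM | rewrite lead_lcoefM].
Qed.

Lemma leading1 : leading 1 0 1. Proof. by split; [apply: lge1 | rewrite lcoef1]. Qed.

Lemma leadingX f N c (k : nat) : leading f N c -> leading (f ^+ k) (N * k%:Z) (c ^+ k).
Proof.
move=> hf; elim: k => [|k IH]; first by rewrite mulr0 !expr0; apply: leading1.
rewrite !exprS (_ : N * k.+1%:Z = N + N * k%:Z); last by lia.
exact: leadingM.
Qed.

Lemma leading_prod (I : Type) (r : seq I) (P : pred I) (F : I -> L) (N : I -> int)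
    (c : I -> C) : (forall i, P i -> leading (F i) (N i) (c i)) ->
  leading (\prod_(i <- r | P i) F i) (\sum_(i <- r | P i) N i) (\prod_(i <- r | P i) c i).
Proof.
move=> hF; elim: r => [|i r IH]; first by rewrite !big_nil; apply: leading1.
by rewrite !big_cons; case: ifP => // Pi; apply: leadingM => //; apply: hF.
Qed.

Lemma leadingV f N c : leading f N c -> c != 0 -> leading f^-1 (- N) c^-1.
Proof. by move=> [hf <-] c0; apply: lgeV. Qed.
End LeadingTerms.

(** * Explicit formula for the normal form and its uniqueness *)

Section NormalFormFacts.
Variable C : numFieldType.
Variable nu : nat.
Variable n : option 'I_nu -> nat.
Variable theta0 : 'I_2 -> option 'I_nu -> C.
Hypothesis nu_ge2 : (2 <= nu)%N.
Hypothesis n_gt0 : forall i, (0 < n i)%N.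
Local Notation L := (laurent C).
Local Notation K := {fraction {poly C}}.
Local Notation ntot := (ntot n).
Local Notation nn := (ntot - 2)%N.
Implicit Types (m : param C n).

Lemma ntot_split : ntot = (n None + \sum_i n (Some i))%N.
Proof.
exact: sum_option.
Qed.

Lemma ntot_ge3 : (3 <= ntot)%N.
Proof.
rewrite /Defs.ntot; apply: leq_trans (_ : #|{: option 'I_nu}| <= _)%N.
  by rewrite card_option card_ord.
by rewrite -sum1_card; apply: leq_sum.
Qed.

Lemma tofrac_PP m : tofrac (PP m) = \prod_i (xK C - cK (tpt m i)) ^+ n (Some i).
Proof. by rewrite /PP rmorph_prod /=; apply: eq_bigr => i _; rewrite XsubK_exp. Qed.

Lemma tofrac_Q1 m : tofrac (Q1 m) = \prod_j (xK C - cK (qq m j)).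
Proof. by rewrite /Q1 rmorph_prod /=; apply: eq_bigr => i _; rewrite rmorphB. Qed.

Lemma leading_sub (c c' : C) : leading (expand (Some c') (xK C - cK c))
  (c' == c)%:Z (if c' == c then 1 else c' - c).
Proof.
case: eqVneq => [->|cc]; last exact: lge_expand_sub.
by rewrite expand_sub_same; split; [apply: lge_lX | rewrite lcoef_lmonom eqxx].
Qed.

Lemma leading_sub_oo (c : C) : leading (expand None (xK C - cK c)) (-1) 1.
Proof. exact: expand_sub_oo. Qed.

Lemma leading_PP m (c : C) : exists2 u, u != 0 &
  leading (expand (Some c) (tofrac (PP m)))
          (\sum_i (c == tpt m i)%:Z * (n (Some i))%:Z) u.
Proof.
rewrite tofrac_PP rmorph_prod /=.
exists (\prod_i (if c == tpt m i then 1 else c - tpt m i) ^+ n (Some i)).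
  apply/prodf_neq0 => i _; rewrite expf_neq0 //.
  by case: ifPn => [_|ct]; rewrite ?oner_eq0 // subr_eq0.
by apply: leading_prod => i _; rewrite rmorphXn; apply: leadingX; apply: leading_sub.
Qed.

Lemma leading_PP_oo m :
  leading (expand None (tofrac (PP m))) ((n None)%:Z - ntot%:Z) 1.
Proof.
rewrite tofrac_PP rmorph_prod /=.
have -> : (n None)%:Z - ntot%:Z = \sum_i (-1) * (n (Some i))%:Z.
  rewrite ntot_split PoszD opprD addrA subrr add0r -mulr_sumr mulN1r.
  by congr (- _); rewrite (big_morph Posz PoszD (erefl _)).
have -> : 1 = \prod_(i < nu) (1 ^+ n (Some i)) :> C by rewrite big1 // => i _; rewrite expr1n.
by apply: leading_prod => i _; rewrite rmorphXn; apply: leadingX; apply: leading_sub_oo.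
Qed.

Lemma tofrac_expansion (P : {poly C}) k : (size P <= k)%N ->
  tofrac P = \sum_(r < k) cK P`_r * xK C ^+ r.
Proof.
move=> Pk; have -> : P = \sum_(r < k) P`_r *: 'X^r.
  rewrite -[LHS]coefK poly_def (big_ord_widen _ (fun r => P`_r *: 'X^r) Pk).
  rewrite [RHS](bigID (fun r : 'I_k => (r < size P)%N)) /= [X in _ + X]big1 ?addr0 //.
  by move=> r; rewrite -leqNgt => /(nth_default 0) ->; rewrite scale0r.
rewrite rmorph_sum; apply: eq_bigr => r _ /=.
rewrite coef_sum (bigD1 r) //= big1 ?addr0 => [|i ir].
  by rewrite coefZ coefXn eqxx mulr1 -mul_polyC rmorphM rmorphXn.
by rewrite coefZ coefXn eq_sym (inj_eq val_inj) (negPf ir) mulr0.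
Qed.

Lemma conn_at_fin k (c : C) (f g h : K) : conn_at k (Some c) (mx2 0 f g h) =
  mx2 0 (expand (Some c) f) (expand (Some c) g) (expand (Some c) h).
Proof. by rewrite /conn_at map_mx2 /= rmorph0. Qed.

Lemma conn_at_oo k (f g h : K) : conn_at k None (mx2 0 f g h) =
  mx2 0 (- lX C (- 2) * expand None f * lX C (- k%:Z))
      (- lX C (- 2) * expand None g * lX C k%:Z)
      (- lX C (- 2) * expand None h - lC k%:R * lX C (- 1)).
Proof.
rewrite conn_atE Gam_oo /gauge_transform.
have [_ ->] := invmx_lower 0 (lX_neq0 C (- k%:Z)).
rewrite !map_mx2 rmorph0 dz1 dz0 dz_lX lXV opprK.
have -> : jac None *: mx2 0 (expand None f) (expand None g) (expand None h) =
    mx2 0 (jac None * expand None f) (jac None * expand None g) (jac None * expand None h).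
  by apply: mx2P; rewrite !mxE /= ?mulr0.
rewrite !mulmx2 /=.
have E1 : lX C k%:Z * lX C (- k%:Z) = 1 by rewrite lXM subrr.
have E2 : lX C k%:Z * lX C (- k%:Z - 1) = lX C (-1).
  by rewrite lXM; congr lX; lia.
rewrite rmorphN lCN /= -[lC k%:~R]/(lC (k%:R)).
apply: mx2P; rewrite !mxE /=.
- by rewrite !(mul0r, mul1r, mulr0, addr0).
- by rewrite !(mul0r, mul1r, mulr0, addr0, add0r).
- by rewrite !(mul0r, mul1r, mulr0, mulr1, addr0, add0r, oppr0) mulrC.
rewrite !(mul0r, mul1r, mulr0, addr0, add0r, oppr0).
rewrite [- lC _ * _]mulNr mulrN [lX C k%:Z * (lC _ * _)]mulrCA E2.
by rewrite [lX C k%:Z * _ * _]mulrAC E1 mul1r addrC.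
Qed.

Definition Thtr i m : L := \tr (polar_diag (n i) (th theta0 m i)).
Definition Thdet i m : L := \det (polar_diag (n i) (th theta0 m i)).

Definition fin_part (m : param C n) (u : 'I_nu -> L) : K :=
  \sum_i \sum_(r < n (Some i)) cK (u i (r%:Z - (n (Some i))%:Z)) *
    ((xK C - cK (tpt m i)) ^+ (n (Some i) - r))^-1.

(** The formula forced on d_0: its polar parts at the t_i are those of the trace, and the
    coefficient of x^r at oo sits at order - r - 2 with a sign, because dx = - z^-2 dz. *)
Definition d0f m : K := fin_part m (fun i => Thtr (Some i) m) +
  \sum_j cK (- 1) * ((xK C - cK (qq m j)) ^+ 1)^-1 +
  \sum_(r < (n None).-1) cK (- Thtr None m (- r%:Z - 2)) * xK C ^+ r.

(** The part of c_0 forced by its residues p_j and by the determinants: principal parts at the t_i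
    and coefficients from x^(n-3) on. The factor z^4 undoes the square of dx = - z^-2 dz. A
    polynomial of degree at most n - 4 remains open. *)
Definition c0s m : K :=
  fin_part m (fun i => - (expand (Some (tpt m i)) (tofrac (PP m)) * Thdet (Some i) m)) +
  \sum_j cK (pp m j) * ((xK C - cK (qq m j)) ^+ 1)^-1 +
  \sum_(r < n None) cK (- (expand None (tofrac (PP m)) * (lX C 4 * Thdet None m))
      (- (ntot - 3 + r)%N%:Z)) * xK C ^+ (ntot - 3 + r).

(** The value at q_j that the apparent singularity equation forces on the remaining polynomial;
    these n - 3 values determine it by interpolation. *)
Definition tau m j : C := - (expand (Some (qq m j))
  (c0s m + cK (pp m j) * d0f m - cK (pp m j) ^+ 2 / tofrac (PP m))) 0.

Definition lag m j : K :=
  \prod_(k | k != j) (cK (qq m j - qq m k)^-1 * (xK C - cK (qq m k))).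

Definition c0f m : K := c0s m + \sum_j cK (tau m j) * lag m j.

Section Unique.
Variables (m : param C n) (Om : 'M[K]_2).
Hypotheses (hm : dom theta0 m) (hOm : normal_form theta0 m Om).

Lemma normal_form_shape : Om = mx2 0 (tofrac (PP m))^-1 (Om 1 0) (Om 1 1).
Proof.
have [Cf [Df [Coo [Doo [Ct [_ E _ _]]]]]] := hOm.
by rewrite E; apply: mx2P; rewrite !mxE.
Qed.

Lemma normal_form_data i :
  has_formal_data (n i) (th theta0 m i) (conn_at nn (pole m i) Om).
Proof. by have [Cf [Df [Coo [Doo [Ct [_ _ _]]]]]] := hOm. Qed.

Lemma d0_fin i k : (k < 0)%R ->
  expand (Some (tpt m i)) (Om 1 1) k = Thtr (Some i) m k.
Proof.
move=> k0; have [h _ _] := formal_data_bounds (normal_form_data (Some i)).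
have := h k k0; rewrite normal_form_shape conn_at_fin mxtrace2E !mxE /= add0r.
by rewrite lcoefB => /eqP; rewrite subr_eq0 => /eqP.
Qed.

Lemma d0_oo (r : nat) : expand None (Om 1 1) (- r%:Z) = - Thtr None m (- r%:Z - 2).
Proof.
have [h _ _] := formal_data_bounds (normal_form_data None).
have k0 : (- r%:Z - 2 < 0)%R by lia.
have := h _ k0; rewrite normal_form_shape conn_at_oo mxtrace2E !mxE /= add0r.
(* The frame of E_k contributes only the term in z^-1, and - r - 2 lies below that order. *)
rewrite !lcoefB mulNr lcoefN lcoef_lXM lcoef_lCM lcoef_lmonom ifF; last by lia.
rewrite mulr0 subr0 (_ : - r%:Z - 2 - -2 = - r%:Z); last by lia.
by move/eqP; rewrite subr_eq0 => /eqP <-; rewrite opprK.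
Qed.

Lemma pole_order i : (\sum_k (tpt m i == tpt m k)%:Z * (n (Some k))%:Z) = (n (Some i))%:Z.
Proof.
have [tI _ _ _] := hm.
rewrite (bigD1 i) //= eqxx mul1r big1 ?addr0 // => k /negPf ki.
by rewrite (inj_eq tI) eq_sym ki mul0r.
Qed.

Lemma c0_fin i k : (k < 0)%R -> expand (Some (tpt m i)) (Om 1 0) k =
  - (expand (Some (tpt m i)) (tofrac (PP m)) * Thdet (Some i) m) k.
Proof.
move=> k0; have [_ h _] := formal_data_bounds (normal_form_data (Some i)).
have [u u0] := leading_PP m (tpt m i); rewrite pole_order => -[hP hPu].
have P0 : expand (Some (tpt m i)) (tofrac (PP m)) != 0.
  by apply: contraNneq u0 => P0; rewrite -hPu P0.
have := lgeM hP h; rewrite addrN => /(_ k k0).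
rewrite normal_form_shape conn_at_fin det2E !mxE /= mul0r sub0r fmorphV.
rewrite mulrBr mulrN mulrA mulfV // mul1r -opprD lcoefN lcoefD => /eqP.
by rewrite oppr_eq0 addr_eq0 => /eqP.
Qed.

Lemma c0_oo (r : nat) : expand None (Om 1 0) (- (ntot - 3 + r)%N%:Z) =
  - (expand None (tofrac (PP m)) * (lX C 4 * Thdet None m)) (- (ntot - 3 + r)%N%:Z).
Proof.
have [_ h _] := formal_data_bounds (normal_form_data None).
have [hP hP1] := leading_PP_oo m.
have P0 : expand None (tofrac (PP m)) != 0.
  by apply/eqP => P0; move/eqP: hP1; rewrite P0 lcoef0 eq_sym oner_eq0.
have := lgeM hP (lgeM (@lge_lX C 4) h).
(* The determinants agree up to order 4 - n after multiplication by z^4 P, so exactly the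
   coefficients from x^(n-3) on are determined. *)
have k0 : (- (ntot - 3 + r)%N%:Z < ((n None)%:Z - ntot%:Z) + (4 - (n None)%:Z))%R.
  by have := ntot_ge3; lia.
move=> /(_ _ k0); rewrite normal_form_shape conn_at_oo det2E !mxE /= mul0r sub0r.
rewrite fmorphV mul_det_oo ?lXM ?subrr //; last by rewrite addNr.
by rewrite lcoefN lcoefD => /eqP; rewrite oppr_eq0 addr_eq0 => /eqP.
Qed.

Lemma d0_unique : Om 1 1 = d0f m.
Proof.
have [tI qI qt _] := hm.
have [Cf [Df [Coo [Doo [Ct [[sz [_ sDoo _]] E _ _]]]]]] := hOm.
have sD i : (size (Df i) <= n (Some i))%N by have [] := sz i.
have fE : Om 1 1 = \sum_i ratio_at (Df i) (tpt m i) (n (Some i)) +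
    \sum_j ratio_at (- 1)%:P (qq m j) 1 + tofrac Doo.
  rewrite E mxE /=; congr (_ + _ + _); rewrite -sumrN; apply: eq_bigr => j _.
  by rewrite !ratio_atE polyCN rmorphN mulNr.
rewrite (partial_fractions tI qt sD fE) /d0f.
rewrite (tofrac_expansion sDoo); congr (_ + _ + _).
  apply: eq_bigr => i _; apply: eq_bigr => r _.
  by rewrite d0_fin //; have := ltn_ord r; lia.
apply: eq_bigr => r _; rewrite -d0_oo.
by rewrite (polar_coef_oo (fun i => n_gt0 (Some i)) sD fE).
Qed.

Lemma c0_partial : exists2 P : {poly C}, (size P <= ntot - 3)%N &
  Om 1 0 = c0s m + tofrac P.
Proof.
have [tI qI qt _] := hm.
have [Cf [Df [Coo [Doo [Ct [[sz [sCoo _ sCt]] E _ _]]]]]] := hOm.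
have sC i : (size (Cf i) <= n (Some i))%N by have [] := sz i.
set Q := Ct + 'X^(ntot - 3) * Coo.
have fE : Om 1 0 = \sum_i ratio_at (Cf i) (tpt m i) (n (Some i)) +
    \sum_j ratio_at (pp m j)%:P (qq m j) 1 + tofrac Q.
  by rewrite E mxE.
exists Ct => //; rewrite /c0s.
rewrite (partial_fractions tI qt sC fE) -!addrA; congr (_ + (_ + _)).
  apply: eq_bigr => i _; apply: eq_bigr => r _.
  by rewrite c0_fin //; have := ltn_ord r; lia.
rewrite /Q rmorphD rmorphM /= (tofrac_expansion sCoo) addrC; congr (_ + _).
rewrite mulr_sumr; apply: eq_bigr => r _.
rewrite -c0_oo (polar_coef_oo (fun i => n_gt0 (Some i)) sC fE) /Q coefD coefXnM.
have -> : Ct`_(ntot - 3 + r) = 0.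
  by apply: nth_default; apply: leq_trans sCt (leq_addr _ _).
rewrite ltnNge leq_addr /= addKn add0r.
by rewrite rmorphXn mulrCA exprD.
Qed.

Lemma apparent_zero j : expand (Some (qq m j))
  (Om 1 0 + cK (pp m j) * Om 1 1 - cK (pp m j) ^+ 2 / tofrac (PP m)) 0 = 0.
Proof.
have [Cf [Df [Coo [Doo [Ct [_ _ ap _]]]]]] := hOm.
have x0 := xK_sub_neq0 (qq m j).
have := ap j 1 0; rewrite /= mxE expand_formE mul1r {1}normal_form_shape.
rewrite (gauge_lower10 _ _ _ x0 (deriv_one (@dxM C)) (dx_cK _)).
have [hx _] := leading_sub (qq m j) (qq m j); rewrite eqxx /= in hx.
move=> h; have := lgeM h hx; rewrite -rmorphM add0r divfK //.
by apply.
Qed.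

Lemma lagrange_expansion (P : {poly C}) : (size P <= ntot - 3)%N ->
  tofrac P = \sum_j cK P.[qq m j] * lag m j.
Proof.
have [_ qI _ _] := hm => sP.
pose Q := \sum_j P.[qq m j] *: \prod_(k | k != j) ((qq m j - qq m k)^-1 *: ('X - (qq m k)%:P)).
suff {1}-> : P = Q.
  rewrite /Q rmorph_sum; apply: eq_bigr => j _.
  rewrite -mul_polyC rmorphM rmorph_prod /lag /=; congr (_ * _); apply: eq_bigr => k _ /=.
  by rewrite -mul_polyC rmorphM rmorphB.
(* Interpolation is available for [Q2], whose prescribed values are the p_j; hence the p_j of [m]
   are replaced by the values of [P]. *)
pose m' : param C n := \row_k (match enum_val k with
  | inl (inr j) => P.[qq m j] | c => co m c end).
have coE c : co m' c = match c with inl (inr j) => P.[qq m j] | c => co m c end.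
  by rewrite /co mxE enum_rankK; case: c => [[]|].
have qE : qq m' = qq m by apply/funext => j; rewrite /qq coE.
have QE : Q = Q2 m'.
  apply: eq_bigr => j _; rewrite mul_polyC qE; congr (_ *: _).
  by rewrite /pp coE.
have [sQ vQ] : (size (Q2 m') <= ntot - 3)%N /\ forall j, (Q2 m').[qq m' j] = pp m' j.
  by apply: Q2_interpolates; rewrite qE.
apply/eqP; rewrite -subr_eq0; apply/negP => /negP PQ0.
have sPQ : (size (P - Q)%R <= ntot - 3)%N.
  by apply: leq_trans (size_polyD _ _) _; rewrite geq_max size_polyN sP QE.
have := max_poly_roots (rs := [seq qq m j | j <- enum 'I_(ntot - 3)]) PQ0.
rewrite map_inj_uniq // enum_uniq size_map -cardE card_ord ltnNge sPQ => h.
have /h/(_ isT) // : all (root (P - Q)) [seq qq m j | j <- enum 'I_(ntot - 3)].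
apply/allP => _ /mapP[j _ ->].
by rewrite rootE hornerD hornerN QE -[in X in _ - X]qE vQ /pp coE subrr.
Qed.

Lemma c0_unique : Om 1 0 = c0f m.
Proof.
have [P sP E] := c0_partial; rewrite E /c0f; congr (_ + _).
rewrite lagrange_expansion //; apply: eq_bigr => j _; congr (cK _ * _).
have := apparent_zero j; rewrite E d0_unique [c0s m + _]addrC -2!addrA.
rewrite rmorphD /= lcoefD expand_poly pexpand_coef0 addrA => /eqP.
by rewrite addr_eq0 => /eqP.
Qed.

Lemma normal_form_unique : Om = mx2 0 (tofrac (PP m))^-1 (c0f m) (d0f m).
Proof. by rewrite -c0_unique -d0_unique -normal_form_shape. Qed.
End Unique.
End NormalFormFacts.

(** * Families along a line in the parameter space *)

Section Line.
Variable C : numFieldType.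
Variable nu : nat.
Variable n : option 'I_nu -> nat.
Variable theta0 : 'I_2 -> option 'I_nu -> C.
Local Notation L := (laurent C).
Local Notation K := {fraction {poly C}}.
Local Notation ntot := (ntot n).
Variables (m v : param C n).
Hypothesis hm : dom theta0 m.

Definition line (h : C) : param C n := h *: v + m.

Lemma line0 : line 0 = m. Proof. by rewrite /line scale0r add0r. Qed.

(** The directional derivative at [m] and the ordinary one at 0 are limits of the same difference
    quotients; this reduces ['D_v] to one variable. *)
Lemma line_quotient (f : param C n -> C) :
  (fun h : C => h^-1 *: ((f \o shift m) (h *: v) - f m)) =
  (fun h : C => h^-1 *: (((fun h => f (line h)) \o shift (0 : C)) (h *: (1 : C)) - f (line 0))).
Proof.
apply/funext => h; rewrite line0 /=; congr (_ *: (f _ - _)).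
by rewrite addr0 /line /= [_ *: 1]mulr1.
Qed.

Lemma derive_line (f : param C n -> C) : 'D_v f m = 'D_1 (fun h => f (line h)) 0.
Proof. by rewrite /derive line_quotient. Qed.

Lemma derivable_line (f : param C n -> C) :
  derivable f m v -> derivable (fun h => f (line h)) (0 : C) 1.
Proof. by rewrite /derivable line_quotient. Qed.

Lemma sder_line (f : param C n -> C) : differentiable f m ->
  exists x, sder (fun h => f (line h)) x.
Proof.
by move=> df; apply: sder_ex; apply: derivable_line; apply: diff_derivable.
Qed.

Lemma sder_co c : sder (fun h => co (line h) c) (co v c).
Proof.
have := sderD (sderM (sder_id C) (sder_cst (co v c))) (sder_cst (co m c)).
by rewrite mul1r mulr0 !addr0; apply: sder_ext => h; rewrite /co !mxE.
Qed.

Lemma sder_tpt i : sder (fun h => tpt (line h) i) (dtpt v i).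
Proof.
rewrite /tpt /dtpt; case: insub => [i'|]; first exact: sder_co.
exact: sder_cst.
Qed.

Definition dth i a l : C :=
  if insub l is Some l' then co v (inr (@cth _ n a i l')) else 0.

Lemma sder_th i a l : sder (fun h => th theta0 (line h) i a l) (dth i a l).
Proof.
rewrite /th /dth; case: insub => [l'|]; first exact: sder_co.
exact: sder_cst.
Qed.

Lemma near_neq (f g : C -> C) : (exists x, sder f x) -> (exists y, sder g y) ->
  f 0 != g 0 -> near0 (fun h => f h != g h).
Proof.
move=> [x df] [y dg]; rewrite -subr_eq0 => fg.
have := sder_neq0 (sderB df dg) fg.
by apply: near0_imp => h; rewrite subr_eq0.
Qed.

Lemma near0_if (b : bool) (P : C -> Prop) : (b -> near0 P) -> near0 (fun h => b -> P h).
Proof.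
by case: b => [/(_ isT)|_]; [apply: near0_imp | apply: near0T].
Qed.

Lemma dom_near : near0 (fun h => dom theta0 (line h)).
Proof.
have [tI qI qt hth] := hm.
have dt i : exists x, sder (fun h => tpt (line h) i) x.
  by exists (dtpt v i); apply: sder_tpt.
have dq j : exists x, sder (fun h => qq (line h) j) x.
  by eexists; apply: sder_co.
have dth' i a : exists x, sder (fun h => th theta0 (line h) i a 0) x.
  by eexists; apply: sder_th.
have N1 : near0 (fun h => forall i j, i != j -> tpt (line h) i != tpt (line h) j).
  apply: near0_forall => i; apply: near0_forall => j; apply: near0_if => ij.
  by apply: near_neq => //; rewrite line0 (inj_eq tI).
have N2 : near0 (fun h => forall i j, i != j -> qq (line h) i != qq (line h) j).
  apply: near0_forall => i; apply: near0_forall => j; apply: near0_if => ij.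
  by apply: near_neq => //; rewrite line0 (inj_eq qI).
have N3 : near0 (fun h => forall j i, qq (line h) j != tpt (line h) i).
  apply: near0_forall => j; apply: near0_forall => i.
  by apply: near_neq => //; rewrite line0.
have N4 : near0 (fun h => forall i, (1 < n i)%N ->
    th theta0 (line h) i 0 0 != th theta0 (line h) i 1 0).
  apply: near0_forall => i; apply: near0_if => ni.
  by apply: near_neq => //; rewrite line0 hth.
have inj (I : eqType) (f : I -> C) : (forall i j, i != j -> f i != f j) -> injective f.
  by move=> fI i j /eqP fij; apply/eqP; apply: contraLR fij; apply: fI.
apply: near0_imp2 (near0_and N1 N2) (near0_and N3 N4) => h [h1 h2] [h3 h4].
by split=> //; apply: inj.
Qed.

Definition sing (u : C -> C) : Prop :=
  (exists i, u = fun h => tpt (line h) i) \/ (exists j, u = fun h => qq (line h) j).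

Lemma sing_tpt i : sing (fun h => tpt (line h) i). Proof. by left; exists i. Qed.
Lemma sing_qq j : sing (fun h => qq (line h) j). Proof. by right; exists j. Qed.

Lemma adm_pole i : adm sing (fun h => pole (line h) i) (dpole v i).
Proof.
have [tI _ qt _] := hm; case: i => [i|] /=; last by left.
right; exists (fun h => tpt (line h) i) => //; split; first exact: sder_tpt.
move=> _ [[k ->]|[j ->]]; rewrite line0; last by right; rewrite eq_sym.
have [->|ik] := eqVneq i k; first by left; apply: near0T.
by right; rewrite (inj_eq tI).
Qed.

Lemma adm_qq j : adm sing (fun h => Some (qq (line h) j)) (qq v j).
Proof.
have [_ qI qt _] := hm.
right; exists (fun h => qq (line h) j) => //; split; first exact: sder_co.
move=> _ [[k ->]|[k ->]]; rewrite line0; first by right.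
have [->|jk] := eqVneq j k; first by left; apply: near0T.
by right; rewrite (inj_eq qI).
Qed.

Lemma adm_cst (c : C) : (forall i, c != tpt m i) -> (forall j, c != qq m j) ->
  adm sing (fun=> Some c) 0.
Proof.
move=> ct cq; right; exists (fun=> c) => //; split; first exact: sder_cst.
by move=> _ [[k ->]|[k ->]]; rewrite line0; right.
Qed.

Definition smooth (f : param C n -> K) := exists f', gder sing (fun h => f (line h)) f'.
Definition ssmooth (f : param C n -> C) := exists f', sder (fun h => f (line h)) f'.
Definition lsmooth (f : param C n -> L) := exists f', lder (fun h => f (line h)) f'.

Lemma smoothD f g : smooth f -> smooth g -> smooth (fun m => f m + g m).
Proof. by move=> [f' df] [g' dg]; eexists; apply: gderD df dg. Qed.
Lemma smoothB f g : smooth f -> smooth g -> smooth (fun m => f m - g m).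
Proof. by move=> [f' df] [g' dg]; eexists; apply: gderB df dg. Qed.
Lemma smoothM f g : smooth f -> smooth g -> smooth (fun m => f m * g m).
Proof. by move=> [f' df] [g' dg]; eexists; apply: gderM df dg. Qed.
Lemma smooth_cK (a : param C n -> C) : ssmooth a -> smooth (fun m => cK (a m)).
Proof. by move=> [a' da]; eexists; apply: gder_cK da. Qed.
Lemma smooth_xK : smooth (fun=> xK C).
Proof. by eexists; apply: gder_xK. Qed.
Lemma smoothX f k : smooth f -> smooth (fun m => f m ^+ k).
Proof. exact: gder_exp_ex. Qed.
Lemma smooth_sum (I : Type) (r : seq I) (f : I -> param C n -> K) :
  (forall i, smooth (f i)) -> smooth (fun m => \sum_(i <- r) f i m).
Proof. exact: gder_sum_ex. Qed.
Lemma smooth_prod (I : Type) (r : seq I) (P : pred I) (f : I -> param C n -> K) :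
  (forall i, P i -> smooth (f i)) -> smooth (fun m => \prod_(i <- r | P i) f i m).
Proof. exact: gder_prod_ex. Qed.

Lemma ssmooth_coef f k : lsmooth f -> ssmooth (fun m => f m k).
Proof. by move=> [f' [_ df]]; exists (f' k). Qed.
Lemma ssmooth_co c : ssmooth (fun m => co m c).
Proof. by exists (co v c); apply: sder_co. Qed.
Lemma ssmoothN f : ssmooth f -> ssmooth (fun m => - f m).
Proof. by move=> [f' df]; eexists; apply: sderN df. Qed.
Lemma ssmooth_tpt i : ssmooth (fun m => tpt m i).
Proof. by eexists; apply: sder_tpt. Qed.

Lemma lsmoothD f g : lsmooth f -> lsmooth g -> lsmooth (fun m => f m + g m).
Proof. by move=> [f' df] [g' dg]; eexists; apply: lderD df dg. Qed.
Lemma lsmoothM f g : lsmooth f -> lsmooth g -> lsmooth (fun m => f m * g m).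
Proof. by move=> [f' df] [g' dg]; eexists; apply: lderM df dg. Qed.
Lemma lsmoothN f : lsmooth f -> lsmooth (fun m => - f m).
Proof. by move=> [f' df]; eexists; apply: lderN df. Qed.
Lemma lsmooth_cst (f : L) : lsmooth (fun=> f).
Proof. by eexists; apply: lder_cst. Qed.
Lemma lsmooth_expand f i : smooth f -> lsmooth (fun m => expand (pole m i) (f m)).
Proof. by move=> [f' df]; eexists; apply: df (adm_pole i). Qed.
Lemma lsmooth_expand_qq f j : smooth f ->
  lsmooth (fun m => expand (Some (qq m j)) (f m)).
Proof. by move=> [f' df]; eexists; apply: df (adm_qq j). Qed.

Lemma lsmooth_polar i a :
  lsmooth (fun m => \sum_(l < n i) lC (th theta0 m i a l) * lX C (l%:Z - (n i)%:Z)).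
Proof.
eexists; apply: lder_sum => l.
by apply: lderM; [apply: lder_lC; apply: sder_th | apply: lder_cst].
Qed.

Lemma lsmooth_ext f g : (forall m, f m = g m) -> lsmooth f -> lsmooth g.
Proof. by move=> /funext ->. Qed.
Lemma smooth_ext f g : (forall m, f m = g m) -> smooth f -> smooth g.
Proof. by move=> /funext ->. Qed.

Lemma lsmooth_Thtr i : lsmooth (fun m => Thtr theta0 i m).
Proof.
apply: lsmooth_ext (lsmoothD (lsmooth_polar i 0) (lsmooth_polar i 1)) => m'.
by rewrite /Thtr polar_diagE mxtrace2E !mxE.
Qed.

Lemma lsmooth_Thdet i : lsmooth (fun m => Thdet theta0 i m).
Proof.
apply: lsmooth_ext (lsmoothM (lsmooth_polar i 0) (lsmooth_polar i 1)) => m'.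
by rewrite /Thdet polar_diagE det2E !mxE /= mul0r subr0.
Qed.

Lemma smooth_PP : smooth (fun m => tofrac (PP m)).
Proof.
apply: smooth_ext (smooth_prod (index_enum 'I_nu) (P := xpredT) _) => [m'|i _].
  by rewrite tofrac_PP.
by apply: smoothX; apply: smoothB; [apply: smooth_xK | apply: smooth_cK; apply: ssmooth_tpt].
Qed.

Lemma smooth_pole i k : smooth (fun m => ((xK C - cK (tpt m i)) ^+ k)^-1).
Proof. by apply: gder_pole_ex; [apply: sing_tpt | exists (dtpt v i); apply: sder_tpt]. Qed.

Lemma smooth_pole_qq j k : smooth (fun m => ((xK C - cK (qq m j)) ^+ k)^-1).
Proof. by apply: gder_pole_ex; [apply: sing_qq | eexists; apply: sder_co]. Qed.

Lemma smooth_PPV : smooth (fun m => (tofrac (PP m))^-1).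
Proof.
apply: smooth_ext (smooth_prod (index_enum 'I_nu) (P := xpredT)
  (f := fun i m => ((xK C - cK (tpt m i)) ^+ n (Some i))^-1) _) => [m'|i _].
  by rewrite tofrac_PP -prodfV.
exact: smooth_pole.
Qed.

Lemma smooth_Q1 : smooth (fun m => tofrac (Q1 m)).
Proof.
apply: smooth_ext (smooth_prod (index_enum 'I_(ntot - 3)) (P := xpredT) _) => [m'|i _].
  by rewrite tofrac_Q1.
by apply: smoothB; [apply: smooth_xK | apply: smooth_cK; apply: ssmooth_co].
Qed.

Lemma smooth_Q1V : smooth (fun m => (tofrac (Q1 m))^-1).
Proof.
apply: smooth_ext (smooth_prod (index_enum 'I_(ntot - 3)) (P := xpredT)
  (f := fun j m => ((xK C - cK (qq m j)) ^+ 1)^-1) _) => [m'|i _].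
  by rewrite tofrac_Q1 -prodfV; apply: eq_bigr => j _; rewrite expr1.
exact: smooth_pole_qq.
Qed.

Lemma ssmooth_qqV j k : k != j -> ssmooth (fun m => (qq m j - qq m k)^-1).
Proof.
move=> kj; have [_ qI _ _] := hm.
eexists; apply: sderV; first by apply: sderB; apply: sder_co.
by rewrite line0 subr_eq0 (inj_eq qI) eq_sym.
Qed.

Lemma smooth_lag j : smooth (fun m => lag m j).
Proof.
apply: smooth_prod => k kj; apply: smoothM.
  by apply: smooth_cK; apply: ssmooth_qqV.
by apply: smoothB; [apply: smooth_xK | apply: smooth_cK; apply: ssmooth_co].
Qed.

Lemma smooth_Q2 : smooth (fun m => tofrac (Q2 m)).
Proof.
apply: smooth_ext (smooth_sum (index_enum 'I_(ntot - 3))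
  (f := fun j m => cK (pp m j) * lag m j) _) => [m'|j].
  rewrite /Q2 rmorph_sum; apply: eq_bigr => j _ /=.
  rewrite rmorphM rmorph_prod; congr (_ * _); apply: eq_bigr => k _ /=.
  by rewrite -mul_polyC rmorphM rmorphB.
by apply: smoothM; [apply: smooth_cK; apply: ssmooth_co | apply: smooth_lag].
Qed.

Lemma smooth_fin_part (u : param C n -> 'I_nu -> L) :
  (forall i, lsmooth (fun m => u m i)) -> smooth (fun m => fin_part m (u m)).
Proof.
move=> du; do 2!apply: smooth_sum => ?; apply: smoothM; last exact: smooth_pole.
by apply: smooth_cK; apply: ssmooth_coef.
Qed.

Lemma smooth_d0f : smooth (fun m => d0f theta0 m).
Proof.
apply: smoothD; first apply: smoothD.
- by apply: smooth_fin_part => i; apply: lsmooth_Thtr.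
- apply: smooth_sum => j; apply: smoothM; last exact: smooth_pole_qq.
  by apply: smooth_cK; exists 0; apply: sder_cst.
apply: smooth_sum => r; apply: smoothM; last by apply: smoothX; apply: smooth_xK.
by apply: smooth_cK; apply: ssmoothN; apply: ssmooth_coef; apply: lsmooth_Thtr.
Qed.

Lemma smooth_c0s : smooth (fun m => c0s theta0 m).
Proof.
apply: smoothD; first apply: smoothD.
- apply: smooth_fin_part => i; apply: lsmoothN; apply: lsmoothM.
    exact: (lsmooth_expand (Some i) smooth_PP).
  exact: lsmooth_Thdet.
- apply: smooth_sum => j; apply: smoothM; last exact: smooth_pole_qq.
  by apply: smooth_cK; apply: ssmooth_co.
apply: smooth_sum => r; apply: smoothM; last by apply: smoothX; apply: smooth_xK.
apply: smooth_cK; apply: ssmoothN; apply: ssmooth_coef; apply: lsmoothM.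
  exact: (lsmooth_expand None smooth_PP).
by apply: lsmoothM; [apply: lsmooth_cst | apply: lsmooth_Thdet].
Qed.

(** [tau] is a coefficient of an expansion at the moving point q_j, an admissible centre. All
    coefficients there are differentiable, so the cancellation of poles at q_j need not be
    examined. *)
Lemma smooth_c0f : smooth (fun m => c0f theta0 m).
Proof.
apply: smoothD; first exact: smooth_c0s.
apply: smooth_sum => j; apply: smoothM; last exact: smooth_lag.
apply: smooth_cK; apply: ssmoothN; apply: ssmooth_coef; apply: lsmooth_expand_qq.
apply: smoothB; first apply: smoothD; first exact: smooth_c0s.
  by apply: smoothM; [apply: smooth_cK; apply: ssmooth_co | apply: smooth_d0f].
apply: smoothM; last exact: smooth_PPV.
by apply: smoothX; apply: smooth_cK; apply: ssmooth_co.
Qed.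
End Line.

Lemma mulmx_dgE (F : fieldType) (B : 'M[F]_2) f a b :
  (B *m dg f) a b = B a b * f b.
Proof. by rewrite /dg mul_mx_diag !mxE. Qed.

Lemma mxDB_entry (F : fieldType) (P Q T : 'M[F]_2) a b :
  (P + Q - T) a b = P a b + Q a b - T a b.
Proof. by rewrite !mxE. Qed.

(** * Parameter dependence of formal solutions *)

Section FormalRecursion.
Variable C : numFieldType.
Local Notation L := (laurent C).

Definition sm (f : C -> C) := exists x, sder f x.

Lemma sm_near f g : near0 (fun h => f h = g h) -> sm f -> sm g.
Proof. by move=> fg [x df]; exists x; apply: sder_near df. Qed.
Lemma sm_cst c : sm (fun=> c). Proof. by exists 0; apply: sder_cst. Qed.
Lemma smD f g : sm f -> sm g -> sm (fun h => f h + g h).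
Proof. by move=> [x df] [y dg]; eexists; apply: sderD df dg. Qed.
Lemma smB f g : sm f -> sm g -> sm (fun h => f h - g h).
Proof. by move=> [x df] [y dg]; eexists; apply: sderB df dg. Qed.
Lemma smM f g : sm f -> sm g -> sm (fun h => f h * g h).
Proof. by move=> [x df] [y dg]; eexists; apply: sderM df dg. Qed.
Lemma smV f : sm f -> f 0 != 0 -> sm (fun h => (f h)^-1).
Proof. by move=> [x df] f0; eexists; apply: sderV df f0. Qed.
Lemma sm_sum (k : nat) (f : 'I_k -> C -> C) : (forall i, sm (f i)) ->
  sm (fun h => \sum_(i < k) f i h).
Proof. by move=> /choice[x df]; eexists; apply: sder_sum df. Qed.

Lemma coef_mul_tail (f g : L) N (s : nat) : lge N f -> lge 0 g ->
  (f * g) (N + s%:Z) = f N * g s%:Z + \sum_(j < s) f (N + j.+1%:Z) * g (s - j.+1)%N%:Z.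
Proof.
move=> hf hg; have := laurent_convE s hf hg; rewrite addr0 -lcoefM => ->.
by rewrite big_ord_recl subn0 addr0.
Qed.

Lemma coef_mul_last (f g : L) N (s : nat) : lge 0 f -> lge N g ->
  (f * g) (N + s%:Z) = \sum_(j < s) f j%:Z * g (N + (s - j)%N%:Z) + f s%:Z * g N.
Proof.
move=> hf hg; have := laurent_convE s hf hg; rewrite add0r -lcoefM => ->.
by rewrite big_ord_recr /= subnn addr0.
Qed.

Variables (n : nat) (A X : C -> 'M[L]_2) (lam : C -> 'I_2 -> L).
Hypothesis n_gt0 : (0 < n)%N.
Hypothesis near_sol : near0 (fun h =>
  [/\ mlge (- n%:Z) (A h), mlge 0 (X h), forall a, lge (- n%:Z) (lam h a),
      (forall a b, X h a b 0 = (a == b)%:R) /\ (forall a k, (0 < k)%R -> X h a a k = 0) &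
      (forall a b, a != b -> A h a b (- n%:Z) = 0) /\
      formal_solution (A h) (X h) (dg (lam h))]).
Hypothesis A_sm : forall a b k, sm (fun h => A h a b k).
Hypothesis nonres : forall a b, a != b -> forall s : nat, (0 < s)%N ->
  A 0 a a (- n%:Z) - lam 0 b (- n%:Z) + (if n == 1%N then s%:R else 0) != 0.

Let ord2 (k : 'I_2) : k = 0 \/ k = 1.
Proof. by case: k => [[|[|//]] hk]; [left|right]; apply: val_inj. Qed.

Let solE h a b : formal_solution (A h) (X h) (dg (lam h)) ->
  dz (X h a b) + (A h a 0 * X h 0 b + A h a 1 * X h 1 b) = X h a b * lam h b.
Proof.
move=> H; have {H} := congr1 (fun M : 'M[L]_2 => M a b) H.
rewrite mxDB_entry (mulmx_dgE (X h) (lam h) a b) (mulmx2E (A h) (X h) a b).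
rewrite [map_mx _ _ _ _]mxE [RHS]mxE.
by move/eqP; rewrite subr_eq0 => /eqP.
Qed.

Let solE' h a b : a != b -> formal_solution (A h) (X h) (dg (lam h)) ->
  dz (X h a a) + (A h a a * X h a a + A h a b * X h b a) = X h a a * lam h a /\
  dz (X h a b) + (A h a a * X h a b + A h a b * X h b b) = X h a b * lam h b.
Proof.
move=> ab /solE sol; have := sol a a; have := sol a b.
have [ha|ha] := ord2 a; have [hb|hb] := ord2 b; subst a b => //.
by rewrite ![A h 1 0 * _ + _]addrC.
Qed.

Let diag1 h a : mlge 0 (X h) -> X h a a 0 = (a == a)%:R ->
  (forall k, (0 < k)%R -> X h a a k = 0) -> X h a a = 1.
Proof.
move=> hX X0 Xk; apply: laurentP => k; rewrite lcoef1.
have [k0|k0|->] := ltgtP k 0; last by rewrite X0 eqxx.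
  by rewrite hX // mulr0n.
by rewrite Xk // mulr0n.
Qed.

(** Since the diagonal of [X] is 1, the diagonal equations give [lam] from earlier off-diagonal
    coefficients, and the off-diagonal equations give the next coefficient of [X] after division by
    a nonzero number. Differentiability passes from [A] to both by strong induction. *)
Lemma formal_recursion (s : nat) a b :
  sm (fun h => X h a b s%:Z) /\ sm (fun h => lam h a (- n%:Z + s%:Z)).
Proof.
elim/ltn_ind: s a b => s IH.
have other (a : 'I_2) : exists b, a != b.
  by have [->|->] := ord2 a; [exists 1 | exists 0].
have lam_sm a : sm (fun h => lam h a (- n%:Z + s%:Z)).
  have [b ab] := other a.
  (* The leading coefficient of [A] is diagonal, so only coefficients of [X] of index below [s]
     occur. *)
  apply: (@sm_near (fun h => A h a a (- n%:Z + s%:Z) +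
      \sum_(j < s) A h a b (- n%:Z + j.+1%:Z) * X h b a (s - j.+1)%N%:Z)).
    apply: near0_imp near_sol => h [hA hX hl [X0 Xk] [A0 /(solE' ab)[+ _]]].
    rewrite (diag1 hX (X0 a a) (Xk a)) dz1 add0r mulr1 mul1r => <-.
    rewrite lcoefD; congr (_ + _).
    by rewrite (coef_mul_tail _ (hA a b) (hX b a)) A0 // mul0r add0r.
  apply: smD => //; apply: sm_sum => j; apply: smM => //.
  by have [] := IH (s - j.+1)%N _ b a; first by have := ltn_ord j; lia.
move=> a b; split=> //.
have [->|ab] := eqVneq a b.
  apply: (@sm_near (fun=> (s == 0%N)%:R)); last exact: sm_cst.
  apply: near0_imp near_sol => h [hA hX hl [X0 Xk] _].
  by rewrite (diag1 hX (X0 b b) (Xk b)) lcoef1 eqz_nat.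
have [s0|s_gt0] := posnP s.
  apply: (@sm_near (fun=> 0)); last exact: sm_cst.
  by apply: near0_imp near_sol => h [hA hX hl [X0 Xk] _]; rewrite s0 X0 (negPf ab).
case: s s_gt0 IH lam_sm => // s _ IH lam_sm.
(* The total factor of the unknown coefficient of index [s.+1]. For n = 1 the derivative term has
   this same index and adds [s.+1]; for n > 1 it involves an earlier coefficient and belongs to
   [rhs]. *)
pose cf h := A h a a (- n%:Z) - lam h b (- n%:Z) + (if n == 1%N then s.+1%:R else 0).
pose rhs h := - (if n == 1%N then 0 else (s.+1%:Z - n%:Z + 1)%:~R * X h a b (s.+1%:Z - n%:Z + 1))
  - \sum_(j < s.+1) A h a a (- n%:Z + j.+1%:Z) * X h a b (s.+1 - j.+1)%N%:Z
  - A h a b (- n%:Z + s.+1%:Z)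
  + \sum_(j < s.+1) X h a b j%:Z * lam h b (- n%:Z + (s.+1 - j)%N%:Z).
have cf_sm : sm cf.
  apply: smD; last exact: sm_cst.
  apply: smB => //; have [_] := IH 0%N (ltn0Sn s) b b.
  by apply: sm_near; apply: near0T => h; rewrite addr0.
have cf0 : cf 0 != 0 by apply: nonres.
have near_cf : near0 (fun h => cf h != 0).
  by have [x dx] := cf_sm; apply: sder_neq0 dx cf0.
apply: (@sm_near (fun h => (cf h)^-1 * rhs h)).
  apply: near0_imp2 near_cf near_sol => h c0 [hA hX hl [X0 Xk] [A0 /(solE' ab)[_]]].
  rewrite (diag1 hX (X0 b b) (Xk b)) mulr1.
  move=> /(congr1 (fun f : L => f (- n%:Z + s.+1%:Z))).
  rewrite !lcoefD lcoef_dz.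
  rewrite (coef_mul_tail _ (hA a a) (hX a b)) (coef_mul_last _ (hX a b) (hl b)).
  rewrite (_ : - n%:Z + s.+1%:Z + 1 = s.+1%:Z - n%:Z + 1); last by lia.
  move=> E; apply: (mulfI c0); rewrite mulVKf // /rhs /cf.
  move: E; move: (A h a a (- n%:Z)) (lam h b _) (\sum_(j < _) _) (\sum_(j < _) _) (A h a b _).
  move=> u w S2 S1 z E.
  have -> : S2 = (s.+1%:Z - n%:Z + 1)%:~R * X h a b (s.+1%:Z - n%:Z + 1) +
      (u * X h a b s.+1%:Z + S1 + z) - X h a b s.+1%:Z * w by rewrite E addrK.
  case: eqP => [->|_]; last by ring.
  by rewrite subrK -[s.+1%:Z%:~R]/(s.+1%:R); ring.
apply: smM.
  by apply: smV.
apply: smD; first apply: smB; first apply: smB.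
- case: eqP => [_|n1]; first by exists 0; apply: sder_ext (sder_cst 0) => h; rewrite oppr0.
  (* For large n the index is negative and the coefficient vanishes. *)
  have [hk|hk] := leP 0 (s.+1%:Z - n%:Z + 1); last first.
    apply: (@sm_near (fun=> 0)); last exact: sm_cst.
    apply: near0_imp near_sol => h [_ hX _ _ _].
    by rewrite hX // mulr0 oppr0.
  apply: (@sm_near (fun h => (- (s.+1%:Z - n%:Z + 1)%:~R) * X h a b (s.+1%:Z - n%:Z + 1))).
    by apply: near0T => h; rewrite mulNr.
  apply: smM; first exact: sm_cst.
  have -> : s.+1%:Z - n%:Z + 1 = (absz (s.+1%:Z - n%:Z + 1)%R)%:Z by lia.
  by have [] := IH (absz (s.+1%:Z - n%:Z + 1)%R) _ a b; first by lia.
- apply: sm_sum => j; apply: smM => //.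
  by have [] := IH (s.+1 - j.+1)%N _ a b; first by lia.
- exact: A_sm.
apply: sm_sum => j; apply: smM.
  by have [] := IH j _ a b; first by have := ltn_ord j; lia.
have [j0|jp] := posnP j.
  by rewrite j0 subn0.
have lt : (s.+1 - j < s.+1)%N by lia.
exact: (proj2 (IH _ lt b b)).
Qed.
End FormalRecursion.

Lemma sum_interchange (V : zmodType) (a a' b b' c c' x x' y y' : V) :
  (a + a') + ((b + b') + (c + c')) - ((x + x') + (y + y')) =
  (a + (b + c) - (x + y)) + (a' + (b' + c') - (x' + y')).
Proof.
by rewrite [b + b' + _]addrACA [x + x' + _]addrACA [a + a' + _]addrACA opprD [LHS]addrACA.
Qed.

Lemma map_dzZ (C : numFieldType) (c : C) (A : 'M[laurent C]_2) :
  map_mx (@dz C) (lC c *: A) = lC c *: map_mx (@dz C) A.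
Proof. by apply/matrixP => i j; rewrite !mxE dzM dz_lC mul0r add0r. Qed.

(** * Derivatives of families of matrices and of formal solutions *)

Section MatrixFamilies.
Variable C : numFieldType.
Local Notation L := (laurent C).
Local Notation K := {fraction {poly C}}.

Definition mlder (F : C -> 'M[L]_2) (F' : 'M[L]_2) :=
  forall a b, lder (fun h => F h a b) (F' a b).

Lemma mlder_uniq (F : C -> 'M[L]_2) (F' G' : 'M[L]_2) : mlder F F' -> mlder F G' -> F' = G'.
Proof. by move=> dF dG; apply/matrixP => a b; apply: lder_uniq (dF a b) (dG a b). Qed.

Lemma mlder_near (F G : C -> 'M[L]_2) (F' : 'M[L]_2) :
  near0 (fun h => F h = G h) -> mlder F F' -> mlder G F'.
Proof.
by move=> FG dF a b; apply: lder_near (dF a b); apply: near0_imp FG => h ->.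
Qed.

Lemma mlder_ext (F G : C -> 'M[L]_2) (F' : 'M[L]_2) : F =1 G -> mlder F F' -> mlder G F'.
Proof. by move=> /funext ->. Qed.

Lemma mlder_cst (A : 'M[L]_2) : mlder (fun=> A) 0.
Proof. by move=> a b; rewrite mxE; apply: lder_cst. Qed.

Lemma mlderD (F G : C -> 'M[L]_2) (F' G' : 'M[L]_2) : mlder F F' -> mlder G G' ->
  mlder (fun h => F h + G h) (F' + G').
Proof.
move=> dF dG a b; rewrite mxE; apply: lder_ext (lderD (dF a b) (dG a b)) => h.
by rewrite mxE.
Qed.

Lemma mlderN (F : C -> 'M[L]_2) (F' : 'M[L]_2) : mlder F F' -> mlder (fun h => - F h) (- F').
Proof.
by move=> dF a b; rewrite mxE; apply: lder_ext (lderN (dF a b)) => h; rewrite mxE.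
Qed.

Lemma mlderB (F G : C -> 'M[L]_2) (F' G' : 'M[L]_2) : mlder F F' -> mlder G G' ->
  mlder (fun h => F h - G h) (F' - G').
Proof. by move=> dF dG; apply: mlderD => //; apply: mlderN. Qed.

Lemma mlderM (F G : C -> 'M[L]_2) (F' G' : 'M[L]_2) : mlder F F' -> mlder G G' ->
  mlder (fun h => F h *m G h) (F' *m G 0 + F 0 *m G').
Proof.
move=> dF dG a b; rewrite mxE (mulmx2E F' (G 0)) (mulmx2E (F 0) G') addrACA.
apply: lder_ext (lderD (lderM (dF a 0) (dG 0 b)) (lderM (dF a 1) (dG 1 b))) => h.
by rewrite (mulmx2E (F h) (G h)).
Qed.

Lemma mlder_dz (F : C -> 'M[L]_2) (F' : 'M[L]_2) : mlder F F' ->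
  mlder (fun h => map_mx (@dz C) (F h)) (map_mx (@dz C) F').
Proof.
move=> dF a b; rewrite mxE; apply: lder_ext (lder_dz (dF a b)) => h.
by rewrite mxE.
Qed.

Lemma mlder_dg (f : C -> 'I_2 -> L) (f' : 'I_2 -> L) :
  (forall a, lder (fun h => f h a) (f' a)) -> mlder (fun h => dg (f h)) (dg f').
Proof.
move=> df a b; rewrite !mxE.
apply: (@lder_ext _ (fun h => f h a *+ (a == b))) => [h|]; first by rewrite !mxE.
case: eqP => _; rewrite ?mulr1n ?mulr0n; first exact: df.
by apply: lder_ext (lder_cst 0) => h; rewrite mulr0n.
Qed.

Lemma mlder_mx2 (p q r s : C -> L) (p' q' r' s' : L) :
  lder p p' -> lder q q' -> lder r r' -> lder s s' ->
  mlder (fun h => mx2 (p h) (q h) (r h) (s h)) (mx2 p' q' r' s').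
Proof.
move=> dp dq dr ds a b; rewrite mxE.
have E (h : C) : mx2 (p h) (q h) (r h) (s h) a b =
  (if a == 0 then if b == 0 then p h else q h else if b == 0 then r h else s h).
  by rewrite mxE.
apply: (lder_ext (fun h => esym (E h))).
by case: ifP => _; case: ifP => _.
Qed.

Lemma mlder_entries (F : C -> 'M[L]_2) :
  (forall a b, exists f', lder (fun h => F h a b) f') -> exists F', mlder F F'.
Proof.
move=> dF; have /choice[f fP] : forall ab : 'I_2 * 'I_2, exists f',
    lder (fun h => F h ab.1 ab.2) f' by move=> [a b]; apply: dF.
by exists (\matrix_(a, b) f (a, b)) => a b; rewrite mxE; apply: (fP (a, b)).
Qed.

(* [A1], [F1], [lam1] are derivatives with x fixed, and e is the velocity of the
   centre of the local parameter. *)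
Lemma nabla_of_solution (A F : C -> 'M[L]_2) (lam : C -> 'I_2 -> L) (e : C)
    (A1 F1 : 'M[L]_2) (lam1 Delta : 'I_2 -> L) :
    F 0 \in unitmx ->
    near0 (fun h => formal_solution (A h) (F h) (dg (lam h))) ->
    mlder A (A1 + lC e *: map_mx (@dz C) (A 0)) ->
    mlder F (F1 + lC e *: map_mx (@dz C) (F 0)) ->
    (forall a, lder (fun h => lam h a) (lam1 a + lC e * dz (lam 0 a))) ->
    (forall a, dz (Delta a) = lam1 a) ->
  nabmx (@dz C) (A 0)
    (F1 *m invmx (F 0) - F 0 *m dg Delta *m invmx (F 0)) = - A1.
Proof.
move=> uF sol dA dF dlam dDelta.
have sol0 := near0_at0 sol.
set Lam := dg (lam 0); set Lam1 := dg lam1.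
have Lam1E : dg (fun a => lam1 a + lC e * dz (lam 0 a)) = Lam1 + lC e *: map_mx (@dz C) Lam.
  apply/matrixP => a b; rewrite !mxE; case: eqP => _; rewrite ?mulr1n ?mulr0n //.
  by rewrite dz0 mulr0 addr0.
have dLam := mlder_dg dlam; rewrite Lam1E in dLam.
have E0 := mlder_uniq (mlder_near sol (mlderB (mlderD (mlder_dz dF) (mlderM dA dF)) (mlderM dF dLam)))
  (mlder_cst 0).
have E1 : map_mx (@dz C) F1 + (A1 *m F 0 + A 0 *m F1) = F1 *m Lam + F 0 *m Lam1.
  apply/eqP; rewrite -subr_eq0; apply/eqP.
  have D0 := congr1 (map_mx (@dz C)) sol0.
  rewrite (map_derivB (@dzB C)) (map_derivD (@dzB C)) in D0.
  rewrite !(map_derivM (@dzB C) (@dzM C)) in D0.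
  rewrite (map_derivD (@dzB C)) map_dzZ !mulmxDl !mulmxDr in E0.
  rewrite -!scalemxAl -!scalemxAr sum_interchange -!scalerDr -scalerBr in E0.
  by rewrite -[RHS]E0 D0 map_mx0 scaler0 addr0.
have E : map_mx (@dz C) (F 0) + A 0 *m F 0 = F 0 *m Lam.
  by move/eqP: sol0; rewrite subr_eq0 => /eqP.
have dD : map_mx (@dz C) (dg Delta) = Lam1.
  by apply/matrixP => a b; rewrite !mxE; case: eqP => _; rewrite ?mulr1n ?mulr0n ?dz0.
exact: (nabla_dlog (map_derivB (@dzB C)) (map_derivM (@dzB C) (@dzM C))
  (mulmxV uF) (mulVmx uF) E E1 dD (diag_mx_comm _ _)).
Qed.

End MatrixFamilies.

(** * The isomonodromic deformations *)

Lemma ord2_neq (a b : 'I_2) : a != b -> (a = 0 /\ b = 1) \/ (a = 1 /\ b = 0).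
Proof.
have ord2 (k : 'I_2) : k = 0 \/ k = 1.
  by case: k => [[|[|//]] hk]; [left|right]; apply: val_inj.
by have [->|->] := ord2 a; have [->|->] := ord2 b => // _; [left|right].
Qed.

(** By the Leibniz rule [\tr (P *m Y)] is [\tr (g *m Q)], and [\tr (X *m Q)] is minus
    [\tr (P *m Y)], up to total derivatives, which have no residue. The doubling cancels the factor
    1/2 of the 2-form. *)
Lemma residue_pairing (C : numFieldType) (A g X Y P Q : 'M[laurent C]_2) :
    nabmx (@dz C) A g = P -> nabmx (@dz C) A X = - P -> nabmx (@dz C) A Y = - Q ->
  residue (\tr (P *m Y - X *m Q)) = residue (\tr (g *m Q)) *+ 2.
Proof.
move=> Pg PX QY.
have E1 := mxtrace_nab_mul (@dzB C) (@dzM C) A g Y.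
have E2 := mxtrace_nab_mul (@dzB C) (@dzM C) A X Y.
rewrite Pg QY mulmxN in E1; rewrite PX QY mulmxN mulNmx in E2.
have trN (B : 'M[laurent C]_2) : \tr (- B) = - \tr B by exact: raddfN.
have -> : \tr (P *m Y - X *m Q) = \tr (P *m Y) - \tr (X *m Q) by exact: raddfB.
rewrite !trN in E1 E2.
have {}E1 : \tr (P *m Y) = \tr (g *m Q) + dz (\tr (g *m Y)) by rewrite -E1 addrCA subrr addr0.
have {}E2 : \tr (X *m Q) = - (\tr (P *m Y) + dz (\tr (X *m Y))).
  by rewrite -E2 addrA subrr add0r opprK.
rewrite E2 opprK E1 /residue !lcoefD -!/(residue _) !residue_dz !addr0.
by rewrite mulr2n.
Qed.

(** At a finite centre [dx] becomes [dz], which commutes with coefficientwise differentiation; at oo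
    there is a factor [jac], but the centre does not move. *)
Lemma gder_dx (C : numFieldType) (sing : (C -> C) -> Prop)
    (f : C -> {fraction {poly C}}) (f' : {fraction {poly C}}) :
  gder sing f f' -> gder sing (fun h => dx (f h)) (dx f').
Proof.
move=> df p e pe; have := lder_dz (df p e pe); rewrite dzD.
have Jinv a g : expand a (dx g) = (jac a)^-1 * dz (expand a g).
  by rewrite dz_expand mulKf ?jac_neq0.
case: pe => [[-> ->]|[c -> _]] dE.
  move: dE; rewrite lC0 !mul0r dz0 !addr0 => dE.
  have := lderM (lder_cst (jac None)^-1) dE; rewrite mul0r add0r Jinv.
  by apply: lder_ext => h; rewrite Jinv.
move: dE; rewrite !Jinv /= invr1 !mul1r dzM dz_lC mul0r add0r.
by apply: lder_ext => h; rewrite Jinv invr1 mul1r.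
Qed.

Lemma gauge_lower_row (F : fieldType) (d : F -> F) (p y g c e : F) : y != 0 ->
    d 1 = 0 -> d 0 = 0 ->
  gauge_transform d (mx2 1 0 p y) (mx2 0 g c e) 0 0 = p * g /\
  gauge_transform d (mx2 1 0 p y) (mx2 0 g c e) 0 1 = y * g.
Proof.
move=> y0 d1 d0; rewrite /gauge_transform; have [_ ->] := invmx_lower p y0.
rewrite map_mx2 d1 d0 !mulmx2 !mxE /=; move: (d p) (d y) => u w.
by split; ring.
Qed.

Lemma conn_at_oo01 (C : numFieldType) k (X : 'M[{fraction {poly C}}]_2) :
  conn_at k None X 0 1 = - lX C (- 2) * expand None (X 0 1) * lX C (- k%:Z).
Proof.
rewrite conn_atE Gam_oo /gauge_transform.
have [_ ->] := invmx_lower 0 (lX_neq0 C (- k%:Z)).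
rewrite !map_mx2 dz1 dz0.
have -> : jac None *: map_mx (expand None) X =
    mx2 (jac None * expand None (X 0 0)) (jac None * expand None (X 0 1))
        (jac None * expand None (X 1 0)) (jac None * expand None (X 1 1)).
  by apply: mx2P; rewrite !mxE.
by rewrite !mulmx2 !mxE /= !(mul1r, mul0r, mulr0, addr0, add0r).
Qed.

Lemma end_at_oo (C : numFieldType) k (X : 'M[{fraction {poly C}}]_2) :
  end_at k None X = mx2 (expand None (X 0 0)) (expand None (X 0 1) * lX C (- k%:Z))
    (lX C k%:Z * expand None (X 1 0)) (expand None (X 1 1)).
Proof.
rewrite end_atE Gam_oo; have [_ ->] := invmx_lower 0 (lX_neq0 C (- k%:Z)).
have -> : map_mx (expand None) X =
    mx2 (expand None (X 0 0)) (expand None (X 0 1)) (expand None (X 1 0)) (expand None (X 1 1)).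
  by apply: mx2P; rewrite !mxE.
rewrite lXV opprK !mulmx2 !(mul1r, mul0r, mulr0, mulr1, addr0, add0r, oppr0).
by congr mx2; rewrite mulrAC lXM subrr mul1r.
Qed.

Lemma mulr_divK (F : fieldType) (x y : F) : y != 0 -> y * (x / y) = x.
Proof. by move=> y0; rewrite mulrCA mulfV ?mulr1. Qed.



Lemma add_sub_cancel (V : zmodType) (a b x : V) : x = - (a + (b - (a + (b + x)))).
Proof. by rewrite !addrA opprB [a + b + x]addrC addrK. Qed.

(** * Dual numbers *)

Section DualNumbers.
Variable A : comNzRingType.
Implicit Types p q : {poly dual A}.

Fact dre_is_zmod : zmod_morphism (@dre A). Proof. by []. Qed.
Fact dre_is_monoid : monoid_morphism (@dre A). Proof. by []. Qed.
Fact deps_is_zmod : zmod_morphism (@deps A). Proof. by []. Qed.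
HB.instance Definition _ := GRing.isZmodMorphism.Build (dual A) A (@dre A) dre_is_zmod.
HB.instance Definition _ := GRing.isMonoidMorphism.Build (dual A) A (@dre A) dre_is_monoid.
HB.instance Definition _ := GRing.isZmodMorphism.Build (dual A) A (@deps A) deps_is_zmod.

Lemma dual_eta (x : dual A) : x = Dual (dre x) (deps x). Proof. by case: x. Qed.

Lemma map_deps_mul p q : map_poly (@deps A) (p * q) =
  map_poly (@dre A) p * map_poly (@deps A) q + map_poly (@deps A) p * map_poly (@dre A) q.
Proof.
apply/polyP => i; rewrite coefD !coefM coef_map coefM raddf_sum -big_split /=.
by apply: eq_bigr => j _; rewrite !coef_map.
Qed.

Lemma horner_dual p (a b : A) : p.[Dual a b] = Dual (map_poly (@dre A) p).[a]
  ((map_poly (@deps A) p).[a] + b * ((map_poly (@dre A) p)^`()).[a]).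
Proof.
elim/poly_ind: p => [|p c IH].
  by rewrite !raddf0 !horner0 mulr0 addr0.
rewrite hornerMXaddC IH rmorphD rmorphM /= map_polyX map_polyC /=.
rewrite raddfD /= map_deps_mul map_polyX.
have -> : map_poly (@deps A) 'X = 0.
  by apply/polyP => i; rewrite coef_map coefX coef0; case: eqP.
have -> : map_poly (@deps A) c%:P = (deps c)%:P.
  by apply/polyP => i; rewrite coef_map !coefC; case: eqP.
rewrite derivD derivM derivX derivC mulr0 add0r addr0 mulr1 !hornerE.
rewrite [LHS]dual_eta; congr Dual; rewrite /=.
by move: (map_poly _ _).[a] (map_poly _ _).[a] (_^`()).[a] => x y z; ring.
Qed.
End DualNumbers.

Section DualMatrices.
Variable F : fieldType.
Implicit Types A B : 'M[F]_2.

Lemma dmxM A0 A1 B0 B1 : dmx A0 A1 *m dmx B0 B1 = dmx (A0 *m B0) (A0 *m B1 + A1 *m B0).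
Proof.
apply/matrixP => i j; rewrite !mxE !big_ord_recl !big_ord0 !mxE !addr0.
rewrite [LHS]dual_eta; congr Dual; rewrite /=.
by rewrite addrACA.
Qed.

Lemma dmxD A0 A1 B0 B1 : dmx A0 A1 + dmx B0 B1 = dmx (A0 + B0) (A1 + B1).
Proof. by apply/matrixP => i j; rewrite !mxE. Qed.

Lemma dmx_inj A0 A1 B0 B1 : dmx A0 A1 = dmx B0 B1 -> A0 = B0 /\ A1 = B1.
Proof.
by move=> /matrixP E; split; apply/matrixP => i j; have := E i j; rewrite !mxE => -[].
Qed.

Lemma dmx_eta (A : 'M[dual F]_2) : A = dmx (map_mx (@dre F) A) (map_mx (@deps F) A).
Proof. by apply/matrixP => i j; rewrite !mxE; apply: dual_eta. Qed.

Lemma map_dmap_dmx (d : F -> F) A0 A1 :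
  map_mx (dmap d) (dmx A0 A1) = dmx (map_mx d A0) (map_mx d A1).
Proof. by apply/matrixP => i j; rewrite !mxE. Qed.
End DualMatrices.

(* A truncation of F at order 2r - 1 conjugates a pole of order r into the same
   principal part as F. *)
Lemma conj_truncation (C : numFieldType) (r : nat) (F B : 'M[laurent C]_2) :
  (0 < r)%N -> lunitmx F -> mlge (- r%:Z) B ->
  let P := map_mx (trunc_le (2 * r).-1%:Z) F in
  mlge 0 (F *m B *m invmx F - P *m B *m invmx P).
Proof.
move=> r0 uF hB P; have [hF F0] := uF.
have hP : mlge 0 P by move=> a b; rewrite mxE; apply: lge_trunc_le.
have P0 a b : P a b 0 = F a b 0 by rewrite mxE trunc_leE.
have uP : lunitmx P by split=> //; rewrite lcoef_det // !P0 -lcoef_det.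
have hT : mlge (2 * r)%N%:Z (F - P).
  move=> a b; rewrite !mxE; apply: (@lge_le C _ ((2 * r).-1%:Z + 1)); first by lia.
  exact: lge_trunc_tail.
have hFi := lunitmx_inv_ge uF; have hPi := lunitmx_inv_ge uP.
have -> : F *m B *m invmx F - P *m B *m invmx P =
    (F - P) *m B *m invmx F - P *m B *m (invmx F *m (F - P) *m invmx P).
  have -> : invmx F *m (F - P) *m invmx P = invmx P - invmx F.
    rewrite mulmxBr (mulVmx (lunitmx_unit uF)) mulmxBl mul1mx -mulmxA.
    by rewrite (mulmxV (lunitmx_unit uP)) mulmx1.
  by rewrite mulmxBr !mulmxBl opprB addrA subrK.
have h1 : mlge 0 ((F - P) *m B *m invmx F).
  by apply: mlgeMr hFi; apply: mlge_le (mlgeM hT hB); lia.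
apply: mlgeB h1 _.
have h2 : mlge (2 * r)%N%:Z (invmx F *m (F - P) *m invmx P).
  by apply: mlgeMr hPi; apply: mlgeMl.
by apply: mlge_le (mlgeM (mlgeMl hP hB) h2); lia.
Qed.

Lemma lcoef_principal (C : numFieldType) (r : nat) (f : nat -> C) (k : int) :
  (\sum_(l < r) lC (f l) * lX C (l%:Z - r%:Z)) k =
  if k + r%:Z is Posz l then if (l < r)%N then f l else 0 else 0.
Proof.
rewrite lcoef_sum; case E : (k + r%:Z) => [l|l]; last first.
  rewrite big1 // => j _; rewrite lcoef_lCM lcoef_lmonom ifF ?mulr0 //.
  by apply/eqP => kE; rewrite kE subrK in E.
case: ltnP => lr; last first.
  rewrite big1 // => j _; rewrite lcoef_lCM lcoef_lmonom ifF ?mulr0 //.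
  by apply/eqP => kE; move: E (ltn_ord j) lr; rewrite kE; lia.
rewrite (bigD1 (Ordinal lr)) //= big1 ?addr0 => [|j jl].
  by rewrite lcoef_lCM lcoef_lmonom ifT ?mulr1 //; lia.
rewrite lcoef_lCM lcoef_lmonom ifF ?mulr0 //; apply/eqP => kE; case/eqP: jl.
by apply: val_inj => /=; move: E; rewrite kE; lia.
Qed.

Lemma sub_cancel (V : zmodType) (a b c e : V) : a - (b - c) - (c + e) = a - b - e.
Proof. by rewrite opprB opprD [c - b]addrC !addrA addrK. Qed.

(** Here [x / p] is a first-row entry with numerator [x] and p = P, [e] the eps-part of the deformed
    entry and [a] that of the deformed numerator. The derivative of the entry exceeds [e] by the
    discrepancy of numerators over P. *)
Lemma deriv_row_identity (F : fieldType) (x x' p p' e a : F) : p != 0 ->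
  p * e + p' * (x * p^-1) = a ->
  x' * p^-1 + x * - (p' / p ^+ 2) = (x' - a) * p^-1 + e.
Proof. by move=> p0 <-; field. Qed.

Lemma mulr_deriv_inv (F : fieldType) (x p : F) : p != 0 -> p * - (x / p ^+ 2) = - (x / p).
Proof. by move=> p0; field. Qed.

Lemma mulr_cancel_div (F : fieldType) (x y p : F) : y != 0 -> y * p^-1 * (x / y) = x * p^-1.
Proof. by move=> y0; rewrite mulrC -mulrA [y^-1 * _]mulrA mulVf // mul1r. Qed.

(** No derivative reaches the first row. Where [A 0 1] is nonzero, a matrix of this shape can
    therefore realize any first row, which is the origin of the correction [k] in [IMD_exact]. *)
Lemma nabmx_lower_row (F : fieldType) (d : F -> F) (A : 'M[F]_2) (a b : F) : d 0 = 0 ->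
  nabmx d A (mx2 0 0 a b) 0 0 = A 0 1 * a /\ nabmx d A (mx2 0 0 a b) 0 1 = A 0 1 * b.
Proof.
move=> d0; have [E00 E01 E10 E11] := mx2E (0 : F) 0 a b.
have ent (X Y Z : 'M[F]_2) i j : (X + (Y - Z)) i j = X i j + (Y i j - Z i j) by rewrite !mxE.
rewrite nabmxE !ent !(mulmx2E _ _ 0) [map_mx _ _ 0 0]mxE [map_mx _ _ 0 1]mxE.
rewrite E00 E01 E10 E11 d0.
by rewrite !(mulr0, mul0r, add0r, addr0, subr0).
Qed.

(** Undoes a moving change of frame: the first equation is the conclusion of [derivative_gauge],
    whose exact term is removed by subtracting [invmx G *m GD] from [h]. *)
Lemma nabmx_transport (F : fieldType) (d : F -> F) (A G GD h D D1 : 'M[F]_2) :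
    zmod_morphism d -> (forall x y, d (x * y) = d x * y + x * d y) -> G \in unitmx ->
    G *m D1 = D *m G + G *m nabmx d (gauge_transform d G A) (invmx G *m GD) ->
    D1 = nabmx d (gauge_transform d G A) h ->
  nabmx d A (G *m (h - invmx G *m GD) *m invmx G) = D.
Proof.
move=> dB dM uG E hE.
have := nabmxB dB (gauge_transform d G A) h (invmx G *m GD).
rewrite -hE (nabmx_gauge dB dM A _ uG) => /(congr1 (fun M => G *m M)).
rewrite (mulmxBr G D1) E addrK -mulmxA (mulKVmx uG) => /(congr1 (fun M => M *m invmx G)).
by rewrite -!mulmxA (mulmxV uG) !mulmx1.
Qed.

Lemma nab_corrected (C : numFieldType) (a : option C) (A D : 'M[{fraction {poly C}}]_2)
    (X : 'M[laurent C]_2) (h k : 'M[{fraction {poly C}}]_2) :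
    nabmx (@dz C) (conn_at 1 a A) X = - (jac a *: end_at 1 a D) ->
  nabmx (@dz C) (conn_at 1 a A) (X - end_at 1 a h + end_at 1 a k) =
  - (jac a *: end_at 1 a (D - nabmx (@dx C) A (k - h))).
Proof.
move=> flat; have -> : X - end_at 1 a h + end_at 1 a k = X + end_at 1 a (k - h).
  by rewrite (end_atB 1 a k h) -addrA [- _ + _]addrC.
rewrite (nabmxD (@dzB C) _ X) flat (nab_conn_at 1 a A (k - h)).
by rewrite (end_atB 1 a D) scalerBr opprB addrC.
Qed.

(** * Differentiability of the given families and the variation of their solutions *)

Section Isomonodromy.
Variable C : numFieldType.
Variable nu : nat.
Variable n : option 'I_nu -> nat.
Variable theta0 : 'I_2 -> option 'I_nu -> C.
Local Notation L := (laurent C).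
Local Notation K := {fraction {poly C}}.
Local Notation ntot := (ntot n).
Local Notation nn := (ntot - 2)%N.
Variable Om : param C n -> 'M[K]_2.
Variable thh : param C n -> option 'I_nu -> 'I_2 -> nat -> C.
Variable Phi : option 'I_nu -> param C n -> 'M[C]_2.
Variable Xi : option 'I_nu -> param C n -> 'M[L]_2.
Variable Xiq : 'I_(ntot - 3) -> param C n -> 'M[L]_2.
Hypothesis nu_ge2 : (2 <= nu)%N.
Hypothesis n_gt0 : forall i, (0 < n i)%N.
Hypothesis theta0_nonres : forall i, n i = 1%N ->
  forall k : int, theta0 0 i - theta0 1 i != k%:~R.
Hypothesis Om_normal : forall m, dom theta0 m -> normal_form theta0 m (Om m).
Hypothesis Phi_framing : forall i, compatible_framing theta0 Om Phi i.
Hypothesis Xi_framing : forall i, formal_framing theta0 Om thh Phi Xi i.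
Hypothesis Xiq_framing : forall j, apparent_framing theta0 Om Xiq j.

Section Families.
Variable m : param C n.
Hypothesis hm : dom theta0 m.

Lemma th_top (m' : param C n) i a l : ((n i).-1 <= l)%N -> th theta0 m' i a l = theta0 a i.
Proof. by move=> nl; rewrite /th insubF // ltnNge nl. Qed.

(** For n_i > 1 the leading exponents differ by [dom]; for n_i = 1 they are the constants [theta0],
    whose difference is not an integer. *)
Lemma th_nonres i a b (s : nat) : a != b ->
  th theta0 m i a 0 - th theta0 m i b 0 + (if n i == 1%N then s%:R else 0) != 0.
Proof.
have [_ _ _ hth] := hm; move=> /ord2_neq ab; case: (n i =P 1%N) => [n1|n1]; last first.
  have ni : (1 < n i)%N by have := n_gt0 i; case: (n i) n1 => [|[|k]].
  rewrite addr0 subr_eq0; have := hth i ni.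
  by case: ab => -[-> ->] //; rewrite eq_sym.
rewrite !th_top ?n1 //; case: ab => -[-> ->].
  by have := theta0_nonres n1 (- s%:Z); rewrite mulrNz -addr_eq0.
have := theta0_nonres n1 s%:Z; rewrite -subr_eq0 -oppr_eq0 opprB addrC.
by rewrite opprB.
Qed.

Section Direction.
Variable v : param C n.
Local Notation line := (line m v).
Local Notation sing := (sing m v).

Definition mgder (F : param C n -> 'M[K]_2) (F' : 'M[K]_2) :=
  forall a b, gder sing (fun h => F (line h) a b) (F' a b).

Lemma mgder_uniq (F : param C n -> 'M[K]_2) (F' G' : 'M[K]_2) :
  mgder F F' -> mgder F G' -> F' = G'.
Proof. by move=> dF dG; apply/matrixP => a b; apply: gder_uniq (dF a b) (dG a b). Qed.

Lemma mgderM (F G : param C n -> 'M[K]_2) (F' G' : 'M[K]_2) : mgder F F' -> mgder G G' ->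
  mgder (fun m => F m *m G m) (F' *m G m + F m *m G').
Proof.
move=> dF dG a b; rewrite mxE (mulmx2E F' (G m)) (mulmx2E (F m) G') addrACA.
have := gderD (gderM (dF a 0) (dG 0 b)) (gderM (dF a 1) (dG 1 b)).
rewrite line0; apply: gder_ext => h.
by rewrite (mulmx2E (F (line h)) (G (line h))).
Qed.

Lemma mgder_near (F G : param C n -> 'M[K]_2) (F' : 'M[K]_2) :
  near0 (fun h => F (line h) = G (line h)) -> mgder F F' -> mgder G F'.
Proof.
by move=> FG dF a b; apply: gder_near (dF a b); apply: near0_imp FG => h ->.
Qed.

Lemma mgder_mx2 (p q r s : param C n -> K) (p' q' r' s' : K) :
  gder sing (fun h => p (line h)) p' -> gder sing (fun h => q (line h)) q' ->
  gder sing (fun h => r (line h)) r' -> gder sing (fun h => s (line h)) s' ->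
  mgder (fun m => mx2 (p m) (q m) (r m) (s m)) (mx2 p' q' r' s').
Proof.
move=> dp dq dr ds a b; rewrite mxE.
have E (h : C) : mx2 (p (line h)) (q (line h)) (r (line h)) (s (line h)) a b =
  (if a == 0 then if b == 0 then p (line h) else q (line h)
   else if b == 0 then r (line h) else s (line h)).
  by rewrite mxE.
apply: (gder_ext (fun h => esym (E h))).
by case: ifP => _; case: ifP => _.
Qed.

Lemma near_dom : near0 (fun h => dom theta0 (line h)).
Proof. exact: dom_near. Qed.

(** The normal form constrains [Om] pointwise only, but near [m] it coincides with the formula of
    [normal_form_unique], whose ingredients are differentiable. *)
Lemma Om_smooth : exists D : 'M[K]_2, mgder Om D.
Proof.
have [p' dp] : smooth m v (fun m => (tofrac (PP m))^-1) by apply: smooth_PPV.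
have [c' dc] : smooth m v (c0f theta0) by apply: smooth_c0f.
have [d' dd] : smooth m v (d0f theta0) by apply: smooth_d0f.
exists (mx2 0 p' c' d').
apply: (@mgder_near (fun m => mx2 0 (tofrac (PP m))^-1 (c0f theta0 m) (d0f theta0 m))).
  apply: near0_imp near_dom => h hh; apply/esym.
  exact: (normal_form_unique nu_ge2 n_gt0 hh (Om_normal hh)).
by apply: mgder_mx2 => //; apply: gder0.
Qed.

(** [Lder] goes through ['D_v] and [to_laurent], both with default values. The hypothesis supplies
    the existence and the lower bound that make them genuine, and the term in [dz] accounts for the
    moving centre. *)
Lemma LderE e (F : param C n -> L) (F' : L) :
  lder (fun h => F (line h)) (F' + lC e * dz (F m)) -> Lder v e m F = F'.
Proof.
move=> [_ dF]; rewrite /Lder.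
have -> : (fun k => 'D_v (fun m' => F m' k) m) = lcoef (F' + lC e * dz (F m)).
  apply/funext => k; rewrite (derive_line m v (fun m' => F m' k)).
  by have [_ ->] := dF k.
rewrite (_ : to_laurent _ = F' + lC e * dz (F m)) ?addrK //.
apply: laurentP => k; have [N hN] := lge_ex (F' + lC e * dz (F m)).
by rewrite (to_laurentE _ hN).
Qed.

Lemma Lder_mxE e (F : param C n -> 'M[L]_2) (F' : 'M[L]_2) :
  mlder (fun h => F (line h)) (F' + lC e *: map_mx (@dz C) (F m)) -> Lder_mx v e m F = F'.
Proof.
move=> dF; apply/matrixP => a b; rewrite mxE; apply: LderE.
by have := dF a b; rewrite !mxE.
Qed.

(** The transition matrix is independent of the parameters and oo does not move, so only expansion
    at a finite centre produces a correction in [dz]. *)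
Lemma mlder_conn_at k (F : param C n -> 'M[K]_2) (F' : 'M[K]_2)
    (p : C -> option C) (e : C) : mgder F F' -> adm sing p e ->
  mlder (fun h => conn_at k (p h) (F (line h)))
    (jac (p 0) *: end_at k (p 0) F' + lC e *: map_mx (@dz C) (conn_at k (p 0) (F m))).
Proof.
move=> dF pe.
have dE : mlder (fun h => map_mx (expand (p h)) (F (line h)))
    (map_mx (expand (p 0)) F' + lC e *: map_mx (@dz C) (map_mx (expand (p 0)) (F m))).
  move=> a b; rewrite !mxE; have := dF a b _ _ pe; rewrite line0.
  by apply: lder_ext => h; rewrite mxE.
case: (pe) dE => [[-> ->]|[c -> _]] dE.
  rewrite lC0 scale0r addr0 in dE; rewrite lC0 scale0r addr0.
  have dJ : mlder (fun h => jac None *: map_mx (expand None) (F (line h)))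
      (jac None *: map_mx (expand None) F').
    move=> a b; rewrite mxE; have := lderM (lder_cst (jac None)) (dE a b).
    by rewrite mul0r add0r; apply: lder_ext => h; rewrite [RHS]mxE.
  have := mlderM (mlderM (mlder_cst (invmx (Gam k None))) dJ) (mlder_cst (Gam k None)).
  rewrite mul0mx add0r mulmx0 addr0.
  move/(mlderD (mlder_cst (invmx (Gam k None) *m map_mx (@dz C) (Gam k None)))).
  rewrite add0r (end_atE k None F') -(conjZ (Gam k None) (jac None) (map_mx (expand None) F')).
  by apply: mlder_ext => h; rewrite (conn_atE k None (F (line h))).
rewrite /end_at /conn_at /= scale1r.
by apply: mlder_ext dE => h.
Qed.

Lemma dlt_OmE D i : mgder Om D ->
  dlt_Om Om v i m = jac (pole m i) *: end_at nn (pole m i) D.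
Proof.
move=> dO; apply: Lder_mxE; have := mlder_conn_at nn dO (adm_pole v hm i).
by rewrite line0.
Qed.

Lemma dlt_OmqE D j : mgder Om D ->
  dlt_Omq Om v j m = jac (Some (qq m j)) *: end_at nn (Some (qq m j)) D.
Proof.
move=> dO; apply: Lder_mxE; have := mlder_conn_at nn dO (adm_qq v hm j).
by rewrite line0.
Qed.
Lemma Phi_sm i a b : sm (fun h => Phi i (line h) a b).
Proof.
have [hol _ _] := Phi_framing i.
exact: (sder_line v (hol a b m hm)).
Qed.

Lemma Phi_unit i m' : dom theta0 m' -> Phi i m' \in unitmx.
Proof. by move=> hm'; have [_ _ /(_ m' hm')[]] := Phi_framing i. Qed.

Lemma invPhi_sm i a b : sm (fun h => invmx (Phi i (line h)) a b).
Proof.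
pose dt h := Phi i (line h) 0 0 * Phi i (line h) 1 1 - Phi i (line h) 0 1 * Phi i (line h) 1 0.
have dt_sm : sm dt by apply: smB; apply: smM; apply: Phi_sm.
have dt0 : dt 0 != 0.
  have := Phi_unit i hm; rewrite unitmx2 det2E /dt line0; exact.
have dtV := smV dt_sm dt0.
have e x y : sm (fun h => (dt h)^-1 * Phi i (line h) x y) by apply: smM => //; apply: Phi_sm.
have ne x y : sm (fun h => - ((dt h)^-1 * Phi i (line h) x y)).
  by have := smB (sm_cst 0) (e x y); apply: sm_near; apply: near0T => h; rewrite sub0r.
pose B h : 'M[C]_2 := mx2 ((dt h)^-1 * Phi i (line h) 1 1) (- ((dt h)^-1 * Phi i (line h) 0 1))
  (- ((dt h)^-1 * Phi i (line h) 1 0)) ((dt h)^-1 * Phi i (line h) 0 0).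
apply: (@sm_near _ (fun h => B h a b)).
  by apply: near0_imp near_dom => h hh; rewrite invmx2E ?Phi_unit // det2E.
have ord2 (k : 'I_2) : k = 0 \/ k = 1.
  by case: k => [[|[|//]] hk]; [left|right]; apply: val_inj.
have [->|->] := ord2 a; have [->|->] := ord2 b.
- by apply: sm_near (e 1 1); apply: near0T => h; rewrite mxE.
- by apply: sm_near (ne 0 1); apply: near0T => h; rewrite mxE.
- by apply: sm_near (ne 1 0); apply: near0T => h; rewrite mxE.
by apply: sm_near (e 0 0); apply: near0T => h; rewrite mxE.
Qed.

Lemma mlder_map_lC (P : C -> 'M[C]_2) : (forall a b, sm (fun h => P h a b)) ->
  exists P', mlder (fun h => map_mx (@lC C) (P h)) P'.
Proof.
move=> dP; apply: mlder_entries => a b; have [x dx] := dP a b.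
by exists (lC x); apply: lder_ext (lder_lC dx) => h; rewrite mxE.
Qed.

Lemma Om_at_smooth i : exists D, mlder (fun h => Om_at Om i (line h)) D.
Proof.
by have [D dO] := Om_smooth; eexists; apply: (mlder_conn_at nn dO (adm_pole v hm i)).
Qed.

(** [Phi] diagonalises the leading coefficient, as [formal_recursion] requires; being constant in
    the local parameter it adds no derivative term. *)
Definition conj_Om i m' : 'M[L]_2 :=
  map_mx (@lC C) (invmx (Phi i m')) *m Om_at Om i m' *m map_mx (@lC C) (Phi i m').

Lemma conj_Om_smooth i : exists D, mlder (fun h => conj_Om i (line h)) D.
Proof.
have [Od dO] := Om_at_smooth i.
have [P' dP] := mlder_map_lC (Phi_sm i); have [V' dV] := mlder_map_lC (invPhi_sm i).
by eexists; apply: mlderM (mlderM dV dO) dP.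
Qed.

Lemma Om_at_ge i m' : dom theta0 m' -> mlge (- (n i)%:Z) (Om_at Om i m').
Proof.
by move=> hm'; have [_ _] := formal_data_bounds (normal_form_data (Om_normal hm') i).
Qed.

Lemma mlge_map_lC (P : 'M[C]_2) : mlge 0 (map_mx (@lC C) P).
Proof. by move=> a b; rewrite mxE; apply: lge_lC. Qed.

Lemma conj_Om_ge i m' : dom theta0 m' -> mlge (- (n i)%:Z) (conj_Om i m').
Proof.
move=> hm'; apply: mlgeMr (mlge_map_lC _); apply: mlgeMl (mlge_map_lC _) _.
exact: Om_at_ge.
Qed.

Lemma coef_mx_lC (P Q : 'M[C]_2) (M : 'M[L]_2) k :
  coef_mx (map_mx (@lC C) P *m M *m map_mx (@lC C) Q) k = P *m coef_mx M k *m Q.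
Proof.
apply/matrixP => a b; rewrite mxE (mulmx2E _ (map_mx (@lC C) Q)) (mulmx2E _ Q).
rewrite !(mulmx2E P) !(mulmx2E (map_mx _ P) M) ![map_mx _ _ _ _]mxE !mxE.
rewrite lcoefD ![_ * lC _]mulrC !lcoef_lCM !lcoefD !lcoef_lCM.
by rewrite ![_ * Q _ _]mulrC.
Qed.

Lemma conj_Om_lead i m' a b : dom theta0 m' ->
  conj_Om i m' a b (- (n i)%:Z) = dg (fun a => th theta0 m' i a 0) a b.
Proof.
move=> hm'; have [_ _ /(_ m' hm')[_ <-]] := Phi_framing i.
by rewrite -coef_mx_lC [RHS]mxE.
Qed.

Lemma lam'E i m' a k : lam' theta0 thh i m' a k =
  if k + (n i)%:Z is Posz l then theta theta0 thh m' i a l else 0.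
Proof.
rewrite /lam' (@to_laurentE _ _ (- (n i)%:Z)) // => j jn.
by case E : (j + _) => [l|//]; lia.
Qed.

Lemma lge_lam' i m' a : lge (- (n i)%:Z) (lam' theta0 thh i m' a).
Proof. by move=> k kn; rewrite lam'E; case E : (k + _) => [l|//]; lia. Qed.

Lemma lam'_lead i m' a : lam' theta0 thh i m' a (- (n i)%:Z) = th theta0 m' i a 0.
Proof. by rewrite lam'E addNr -[LHS]/(theta theta0 thh m' i a 0) /theta n_gt0. Qed.

Lemma Xi_solution i m' : dom theta0 m' ->
  formal_solution (conj_Om i m') (Xi i m') (dg (lam' theta0 thh i m')).
Proof.
move=> hm'; have [_ _ _] := Xi_framing i hm'.
rewrite /formal_solution /psi_amp => E.
have u : map_mx (@lC C) (Phi i m') \in unitmx by rewrite map_unitmx Phi_unit.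
have D0 : map_mx (@dz C) (map_mx (@lC C) (Phi i m')) = 0.
  by apply/matrixP => a b; rewrite !mxE dz_lC.
move: E; rewrite (map_derivM (@dzB C) (@dzM C)) D0 mul0mx add0r.
move=> /(congr1 (mulmx (invmx (map_mx (@lC C) (Phi i m'))))).
rewrite mulmx0 mulmxBr mulmxDr !mulmxA mulVmx // !mul1mx => <-.
by rewrite /conj_Om map_invmx.
Qed.

Lemma Xi_lam_sm i : (forall a b k, sm (fun h => Xi i (line h) a b k)) /\
  (forall a k, sm (fun h => lam' theta0 thh i (line h) a k)).
Proof.
have [D dA] := conj_Om_smooth i.
have sol : near0 (fun h => [/\ mlge (- (n i)%:Z) (conj_Om i (line h)), mlge 0 (Xi i (line h)),
    forall a, lge (- (n i)%:Z) (lam' theta0 thh i (line h) a),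
    (forall a b, Xi i (line h) a b 0 = (a == b)%:R) /\
      (forall a k, (0 < k)%R -> Xi i (line h) a a k = 0) &
    (forall a b, a != b -> conj_Om i (line h) a b (- (n i)%:Z) = 0) /\
      formal_solution (conj_Om i (line h)) (Xi i (line h)) (dg (lam' theta0 thh i (line h)))]).
  apply: near0_imp near_dom => h hh; have [X1 X2 X3 _] := Xi_framing i hh.
  split=> //; first exact: conj_Om_ge.
    by move=> a; apply: lge_lam'.
  split; last exact: Xi_solution.
  by move=> a b /negPf ab; rewrite conj_Om_lead // !mxE ab mulr0n.
have nonres a b : a != b -> forall s : nat, (0 < s)%N ->
    conj_Om i (line 0) a a (- (n i)%:Z) - lam' theta0 thh i (line 0) b (- (n i)%:Z)
    + (if n i == 1%N then s%:R else 0) != 0.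
  move=> ab s s0; rewrite line0 conj_Om_lead // lam'_lead !mxE eqxx mulr1n.
  exact: th_nonres.
have rec s a b := formal_recursion (n_gt0 i) sol (fun a b k => ex_intro _ _ ((dA a b).2 k)) nonres s a b.
split=> a.
  move=> b k; have [k0|k0] := leP 0 k.
    have -> : k = (absz k)%:Z by lia.
    by have [] := rec (absz k) a b.
  apply: (@sm_near _ (fun=> 0)); last exact: sm_cst.
  by apply: near0_imp sol => h [_ hX _ _ _]; rewrite hX.
move=> k; have [k0|k0] := leP (- (n i)%:Z) k.
  have -> : k = - (n i)%:Z + (absz (k + (n i)%:Z)%R)%:Z by lia.
  by have [] := rec (absz (k + (n i)%:Z)%R) a a.
apply: (@sm_near _ (fun=> 0)); last exact: sm_cst.
by apply: near0T => h; rewrite lge_lam'.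
Qed.
Lemma Xi_smooth i : exists D, mlder (fun h => Xi i (line h)) D.
Proof.
have [dX _] := Xi_lam_sm i; apply: mlder_entries => a b.
apply: (@lder_ex _ 0) => [|k]; last exact: dX.
by apply: near0_imp near_dom => h hh; have [X1 _ _ _] := Xi_framing i hh; apply: X1.
Qed.

Lemma psi_amp_smooth i : exists D, mlder (fun h => psi_amp Phi Xi i (line h)) D.
Proof.
have [P' dP] := mlder_map_lC (Phi_sm i); have [X' dX] := Xi_smooth i.
by eexists; apply: mlderM dP dX.
Qed.

Lemma lam'_smooth i : exists ld : 'I_2 -> L,
  forall a, lder (fun h => lam' theta0 thh i (line h) a) (ld a).
Proof.
have [_ dl] := Xi_lam_sm i.
have /choice[ld ldP] : forall a, exists f', lder (fun h => lam' theta0 thh i (line h) a) f'.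
  move=> a; apply: (@lder_ex _ (- (n i)%:Z)) => [|k]; last exact: dl.
  by apply: near0T => h; apply: lge_lam'.
by exists ld.
Qed.

Lemma lam_der_coef i a (ld : L) (l : nat) : (l < n i)%N ->
  lder (fun h => lam' theta0 thh i (line h) a) ld ->
  ld (l%:Z - (n i)%:Z) = dth v i a l.
Proof.
move=> ln [_ dl]; apply: sder_uniq (dl _) _; apply: sder_ext (sder_th theta0 m v i a l) => h.
by rewrite lam'E subrK /theta ln.
Qed.

Lemma lge_lam_der i a (ld : L) :
  lder (fun h => lam' theta0 thh i (line h) a) ld -> lge (- (n i)%:Z) ld.
Proof. by apply: lder_lge; apply: near0T => h; apply: lge_lam'. Qed.

Lemma lcoef_lam i m' a k : lam theta0 thh i m' a k =
  if k == 0 then 0 else lam' theta0 thh i m' a (k - 1) / k%:~R.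
Proof.
rewrite /lam (@to_laurentE _ _ (1 - (n i)%:Z)) // => j jn.
by rewrite lge_lam' ?mul0r ?if_same //; lia.
Qed.

Lemma lcoef_dlt_lam i a (ld : L) k : lder (fun h => lam' theta0 thh i (line h) a) ld ->
  dlt_lam theta0 thh v i m a k = (if k == 0 then 0 else ld (k - 1) / k%:~R) -
    dpole v i * lam' theta0 thh i m a k.
Proof.
move=> dl; rewrite /dlt_lam lcoefB lcoef_lCM; congr (_ - _).
have E j : 'D_v (fun m' => lam theta0 thh i m' a j) m = if j == 0 then 0 else ld (j - 1) / j%:~R.
  rewrite (derive_line m v (fun m' => lam theta0 thh i m' a j)).
  suff [_ ->] : sder (fun h => lam theta0 thh i (line h) a j)
    (if j == 0 then 0 else ld (j - 1) / j%:~R) by [].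
  apply: (sder_ext (fun h => esym (lcoef_lam i (line h) a j))).
  case: eqP => _; first exact: sder_cst.
  by have := sderM (dl.2 (j - 1)) (sder_cst j%:~R^-1); rewrite mulr0 addr0.
rewrite (@to_laurentE _ _ (1 - (n i)%:Z)) // => j jn.
by rewrite E (lge_lam_der dl) ?mul0r ?if_same //; lia.
Qed.

(** Only the coefficient of index -1 is delicate, since [lam] omits the logarithm. It causes no
    loss: theta_{n_i - 1} is fixed by [theta0], so its derivative is 0. *)
Lemma dz_dlt_lam i a (ld : L) : lder (fun h => lam' theta0 thh i (line h) a) ld ->
  dz (dlt_lam theta0 thh v i m a) = ld - lC (dpole v i) * dz (lam' theta0 thh i m a).
Proof.
move=> dl; apply: laurentP => k; rewrite lcoef_dz (lcoef_dlt_lam _ dl) lcoefB lcoef_lCM lcoef_dz.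
rewrite mulrBr [_ * (dpole v i * _)]mulrCA; congr (_ - _).
rewrite addrK; case: eqVneq => [k1|k1]; last by rewrite mulrC divfK // intr_eq0.
have n1 := n_gt0 i.
have -> : k = (n i).-1%:Z - (n i)%:Z by lia.
rewrite mulr0 (lam_der_coef _ dl) ?prednK // /dth insubF //.
by rewrite ltnn.
Qed.

Lemma Xi_lunit i m' : dom theta0 m' -> lunitmx (Xi i m').
Proof.
move=> hm'; have [X1 X2 _ _] := Xi_framing i hm'; split => //.
by rewrite lcoef_det // !X2 /= mulr1 mulr0 subr0 oner_eq0.
Qed.

Lemma map_lC_lunit (P : 'M[C]_2) : P \in unitmx -> lunitmx (map_mx (@lC C) P).
Proof.
rewrite unitmx2 => uP; split; first exact: mlge_map_lC.
by rewrite det_map_mx /= lcoef_lmonom eqxx.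
Qed.

Lemma psi_amp_lunit i m' : dom theta0 m' -> lunitmx (psi_amp Phi Xi i m').
Proof.
by move=> hm'; apply: lunitmxM; [apply/map_lC_lunit/Phi_unit | apply: Xi_lunit].
Qed.

(* Apply delta to (d + Om) psi = 0. *)
Lemma nabla_dlog_psi i :
  nabmx (@dz C) (Om_at Om i m) (dlog_psi theta0 thh Phi Xi v i m) = - dlt_Om Om v i m.
Proof.
have [D dO] := Om_smooth; have [F' dF] := psi_amp_smooth i; have [ld dl] := lam'_smooth i.
have u := lunitmx_unit (psi_amp_lunit i hm).
pose e := dpole v i.
pose F1 := F' - lC e *: map_mx (@dz C) (psi_amp Phi Xi i m).
have dF1 : mlder (fun h => psi_amp Phi Xi i (line h))
    (F1 + lC e *: map_mx (@dz C) (psi_amp Phi Xi i m)) by rewrite subrK.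
have dA := mlder_conn_at nn dO (adm_pole v hm i).
rewrite (dlt_OmE i dO) /dlog_psi (Lder_mxE dF1).
have := @nabla_of_solution C (fun h => Om_at Om i (line h)) (fun h => psi_amp Phi Xi i (line h))
  (fun h => lam' theta0 thh i (line h)) e (jac (pole m i) *: end_at nn (pole m i) D) F1
  (fun a => ld a - lC e * dz (lam' theta0 thh i m a)) (dlt_lam theta0 thh v i m).
rewrite !line0 in dA *; apply => //.
- by apply: near0_imp near_dom => h hh; have [] := Xi_framing i hh.
- by move=> a; rewrite subrK.
- by move=> a; apply: dz_dlt_lam.
Qed.

Lemma psiq_smooth j : exists D, mlder (fun h => psiq Xiq j (line h)) D.
Proof.
have [hol hX] := Xiq_framing j.
have [X' dX] : exists X', mlder (fun h => Xiq j (line h)) X'.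
  apply: mlder_entries => a b; apply: (@lder_ex _ 0).
    by apply: near0_imp near_dom => h hh; have [X1 _ _ _] := hX _ hh; apply: X1.
  by move=> k; apply: (sder_line v (hol a b k m hm)).
have dP := mlder_mx2 (lder_cst 1) (lder_cst 0) (lder_lC (sder_co m v (inl (inr j)))) (lder_cst (1 : L)).
by eexists; apply: mlderM (mlderM dP dX) (mlder_cst _).
Qed.

Lemma psiq_unit j m' : dom theta0 m' -> psiq Xiq j m' \in unitmx.
Proof.
move=> hm'; have [_ hX] := Xiq_framing j; have [X1 X2 _ _] := hX _ hm'.
have uX : lunitmx (Xiq j m').
  by split=> //; rewrite lcoef_det // !X2 /= mulr1 mulr0 subr0 oner_eq0.
rewrite !unitmx_mul (lunitmx_unit uX) !unitmx2 !det2E !mxE /=.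
by rewrite !(mulr0, mul0r, mul1r, subr0) oner_eq0 lX_neq0.
Qed.

(** At q_j the solution is an actual Laurent series, so [nabla_of_solution] is applied with zero
    exponents. *)
Lemma nabla_dlog_psiq j :
  nabmx (@dz C) (Om_atq Om j m) (dlog_psiq Xiq v j m) = - dlt_Omq Om v j m.
Proof.
have [D dO] := Om_smooth; have [F' dF] := psiq_smooth j.
have u := psiq_unit j hm; have [_ hX] := Xiq_framing j.
pose e := qq v j.
pose F1 := F' - lC e *: map_mx (@dz C) (psiq Xiq j m).
have dF1 : mlder (fun h => psiq Xiq j (line h))
    (F1 + lC e *: map_mx (@dz C) (psiq Xiq j m)) by rewrite subrK.
have dA := mlder_conn_at nn dO (adm_qq v hm j).
rewrite (dlt_OmqE j dO) /dlog_psiq (Lder_mxE dF1).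
have dg0 : dg (fun=> 0) = 0 :> 'M[L]_2.
  by apply/matrixP => a b; rewrite !mxE mul0rn.
have := @nabla_of_solution C (fun h => Om_atq Om j (line h)) (fun h => psiq Xiq j (line h))
  (fun h _ => 0) e (jac (Some (qq m j)) *: end_at nn (Some (qq m j)) D) F1
  (fun=> 0) (fun=> 0).
rewrite dg0 !line0 mulmx0 mul0mx subr0 in dA *; apply => //.
- apply: near0_imp near_dom => h hh; rewrite /formal_solution mulmx0 subr0.
  by have [] := hX _ hh.
- by move=> a; rewrite dz0 mulr0 addr0; apply: lder_cst.
- by move=> a; rewrite dz0.
Qed.
End Direction.
End Families.

(** * The 2-form on an exact deformation *)

Section UniversalConnection.
Variable m : param C n.
Hypothesis hm : dom theta0 m.

Lemma omega_hat_exact (v w : param C n) (g Dv Dw : 'M[K]_2) :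
  mgder m v Om Dv -> mgder m w Om Dw -> nabmx (@dx C) (Om m) g = Dv ->
  omega_hat theta0 Om thh Phi Xi Xiq m v w =
  \sum_i residue (expand_form (pole m i) (\tr (g *m Dw))) +
  \sum_j residue (expand_form (Some (qq m j)) (\tr (g *m Dw))).
Proof.
move=> dv dw gE; rewrite /omega_hat -mulrDr.
(* One computation serves the t_i, oo and the q_j: the trace of an endomorphism does not depend on
   the frame, so all local terms are residues of a single rational form. *)
have pair (a : option C) (X Y P Q : 'M[L]_2) :
    P = jac a *: end_at nn a Dv -> Q = jac a *: end_at nn a Dw ->
    nabmx (@dz C) (conn_at nn a (Om m)) X = - P -> nabmx (@dz C) (conn_at nn a (Om m)) Y = - Q ->
  residue (\tr (P *m Y - X *m Q)) = residue (expand_form a (\tr (g *m Dw))) *+ 2.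
  move=> PE QE hX hY.
  have hg : nabmx (@dz C) (conn_at nn a (Om m)) (end_at nn a g) = P.
    by rewrite PE -gE; apply: nab_conn_at.
  rewrite (residue_pairing hg hX hY); congr (residue _ *+ 2).
  rewrite QE expand_formE -(mxtrace_end_at nn a (g *m Dw)) (end_atM nn a g Dw).
  by rewrite -scalemxAr; apply: mxtraceZ.
have E1 i : residue (\tr (dlt_Om Om v i m *m dlog_psi theta0 thh Phi Xi w i m
      - dlog_psi theta0 thh Phi Xi v i m *m dlt_Om Om w i m)) =
    residue (expand_form (pole m i) (\tr (g *m Dw))) *+ 2.
  apply: (pair (pole m i)).
  - exact: (dlt_OmE hm i dv).
  - exact: (dlt_OmE hm i dw).
  - by apply: nabla_dlog_psi.
  - by apply: nabla_dlog_psi.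
have E2 j : residue (\tr (dlt_Omq Om v j m *m dlog_psiq Xiq w j m
      - dlog_psiq Xiq v j m *m dlt_Omq Om w j m)) =
    residue (expand_form (Some (qq m j)) (\tr (g *m Dw))) *+ 2.
  apply: (pair (Some (qq m j))).
  - exact: (dlt_OmqE hm j dv).
  - exact: (dlt_OmqE hm j dw).
  - by apply: nabla_dlog_psiq.
  - by apply: nabla_dlog_psiq.
rewrite (eq_bigr _ (fun i _ => E1 i)) (eq_bigr _ (fun j _ => E2 j)) !sumrMnl -mulrnDl.
by rewrite mulrnAr -mulrnAl -[2^-1 *+ 2]mulr_natr mulVf ?mul1r // pnatr_eq0.
Qed.
End UniversalConnection.

Lemma Q1_neq0 (m : param C n) : tofrac (Q1 m) != 0 :> K.
Proof. by rewrite tofrac_Q1; apply/prodf_neq0 => j _; apply: xK_sub_neq0. Qed.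

Lemma Gt_unit (m : param C n) : Gt m \in unitmx.
Proof. by have [] := invmx_lower (tofrac (Q2 m)) (Q1_neq0 m). Qed.

Lemma invGtE (m : param C n) : invmx (Gt m) =
  mx2 1 0 (- tofrac (Q2 m) / tofrac (Q1 m)) (tofrac (Q1 m))^-1.
Proof. by have [] := invmx_lower (tofrac (Q2 m)) (Q1_neq0 m). Qed.

Lemma Om_shape (m : param C n) : dom theta0 m ->
  Om m = mx2 0 (tofrac (PP m))^-1 (Om m 1 0) (Om m 1 1).
Proof. by move=> hm; apply: normal_form_shape (Om_normal hm). Qed.

(** This is how the parameters are seen on E_1: after multiplication by P the first row is
    [(Q2, Q1)], so the q_j are the zeros of the upper right entry and the p_j the values of the
    upper left one. *)
Lemma Om1_row (m : param C n) : dom theta0 m ->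
  Om1 Om m 0 0 = tofrac (Q2 m) * (tofrac (PP m))^-1 /\
  Om1 Om m 0 1 = tofrac (Q1 m) * (tofrac (PP m))^-1.
Proof.
move=> hm; rewrite /Om1 /Gt (Om_shape hm).
apply: gauge_lower_row (Q1_neq0 m) (deriv_one (@dxM C)) _.
by rewrite -tofrac0 dx_tofrac linear0.
Qed.

Lemma leading_Q1 (m : param C n) (c : C) : exists2 u, u != 0 &
  leading (expand (Some c) (tofrac (Q1 m))) (\sum_j (c == qq m j)%:Z) u.
Proof.
rewrite tofrac_Q1 rmorph_prod /=.
exists (\prod_j (if c == qq m j then 1 else c - qq m j)).
  apply/prodf_neq0 => j _; case: ifPn => [_|cq]; rewrite ?oner_eq0 //.
  by rewrite subr_eq0.
by apply: leading_prod => j _; apply: leading_sub.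
Qed.

Lemma leading_Q1_oo (m : param C n) :
  leading (expand None (tofrac (Q1 m))) (- (ntot - 3)%N%:Z) 1.
Proof.
rewrite tofrac_Q1 rmorph_prod /=.
have -> : - (ntot - 3)%N%:Z = \sum_(j < ntot - 3) (-1 : int).
  by rewrite sumr_const card_ord mulNrn natz.
have -> : 1 = \prod_(j < ntot - 3) (1 : C) by rewrite big1.
by apply: leading_prod => j _; apply: leading_sub_oo.
Qed.

Lemma Gt_atE i (m : param C n) : Gt_at i m = local_gauge nn 1 (pole m i) (Gt m).
Proof.
rewrite /Gt_at /local_gauge; case: i => [i|].
  by rewrite /= invmx1 mul1mx mulmx1.
rewrite (map_expandM None (_ *m Gt m) (Gk 1 (xK C))).
by rewrite (map_expandM None (invmx (Gk nn (xK C))) (Gt m)) map_invmx.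
Qed.

(** * The connection on E_1 at a fixed parameter *)

Section AtPoint.
Variable m : param C n.
Hypothesis hm : dom theta0 m.

Lemma tpt_qq i : (\sum_j (tpt m i == qq m j)%:Z) = 0.
Proof.
have [_ _ qt _] := hm.
by rewrite big1 // => j _; rewrite eq_sym (negPf (qt j i)).
Qed.

Lemma qq_qq j : (\sum_k (qq m j == qq m k)%:Z) = 1.
Proof.
have [_ qI _ _] := hm.
by rewrite (bigD1 j) //= eqxx big1 ?addr0 // => k /negPf kj; rewrite (inj_eq qI) eq_sym kj.
Qed.

Lemma Q2_size : (size (Q2 m) <= ntot - 3)%N.
Proof. by have [_ qI _ _] := hm; have [] := Q2_interpolates qI. Qed.

Lemma Q2_value j : (Q2 m).[qq m j] = pp m j.
Proof. by have [_ qI _ _] := hm; have [_] := Q2_interpolates qI. Qed.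

(** At a finite pole the determinant is [Q1], nonzero at t_i. At oo the orders of the lower right
    entry cancel, (n - 2) - (n - 3) - 1 = 0: the degrees of the two bundles match that of [Q1]. *)
Lemma Gt_at_lunit i : lunitmx (Gt_at i m).
Proof.
case: i => [i|].
  have [u u0] := leading_Q1 m (tpt m i); rewrite tpt_qq => -[h1 hu].
  rewrite /Gt_at /= /Gt map_mx2 rmorph1 rmorph0.
  apply: det_lunitmx2 => //; try exact: lge1; try exact: lge0.
    by rewrite expand_poly; apply: lge_pexpand.
  by rewrite hu lcoef0 lcoef1 eqxx mul1r mul0r subr0.
have [h1 hu] := leading_Q1_oo m; have n3 := ntot_ge3 nu_ge2 n_gt0.
rewrite Gt_atE.
rewrite /local_gauge !Gam_oo; have [_ ->] := invmx_lower 0 (lX_neq0 C (- nn%:Z)).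
rewrite lXV opprK oppr0 mul0r /Gt map_mx2 rmorph1 rmorph0 !mulmx2.
rewrite !(mul1r, mulr1, mul0r, mulr0, addr0, add0r).
have hQ1 : leading (lX C nn%:Z * expand None (tofrac (Q1 m)) * lX C (- 1%:Z)) 0 1.
  have lead_lX k : leading (lX C k) k 1.
    by split; [apply: lge_lX | rewrite lcoef_lmonom eqxx].
  have := leadingM (leadingM (lead_lX nn%:Z) (leading_Q1_oo m)) (lead_lX (- 1%:Z)).
  by rewrite !mulr1 (_ : nn%:Z + - (ntot - 3)%N%:Z + - 1%:Z = 0); last by lia.
apply: det_lunitmx2; [exact: lge1|exact: lge0| |by case: hQ1|].
  rewrite expand_poly; have := lgeM (@lge_lX C nn%:Z) (lge_pexpand_oo (leq_trans Q2_size (leqnSn _))).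
  by apply: lge_le; lia.
by case: hQ1 => _ ->; rewrite lcoef0 lcoef1 eqxx mul1r mul0r subr0 oner_eq0.
Qed.

Lemma conn1E i : conn_at 1 (pole m i) (Om1 Om m) =
  gauge_transform (@dz C) (Gt_at i m) (Om_at Om i m).
Proof.
by rewrite Gt_atE /Om1 (conn_at_gauge nn 1 (pole m i) (Om m) (Gt_unit m)).
Qed.
Lemma conn1_ge i : mlge (- (n i)%:Z) (conn_at 1 (pole m i) (Om1 Om m)).
Proof.
have [hG _] := Gt_at_lunit i; have hGi := lunitmx_inv_ge (Gt_at_lunit i).
rewrite conn1E /gauge_transform; apply: mlgeD.
  by apply: mlge_le (mlgeMl hGi (mlge_dz hG)); lia.
by apply: mlgeMr hG; apply: mlgeMl hGi _; apply: (Om_at_ge).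
Qed.

(** The entry is Q_1 / P, with pole order exactly n_i; at oo the orders add up as -2 - (n - 3) + (n
    - n_oo) - 1 = - n_oo. Exactness is what permits division by this entry in [rigidity]. *)
Lemma leading_conn1 i : exists2 u, u != 0 &
  leading (conn_at 1 (pole m i) (Om1 Om m) 0 1) (- (n i)%:Z) u.
Proof.
have [_ E01] := Om1_row hm; case: i => [i|] /=.
  have [u u0] := leading_Q1 m (tpt m i); rewrite tpt_qq => lQ.
  have [w w0] := leading_PP m (tpt m i); rewrite (pole_order hm) => lP.
  exists (u * w^-1); first by rewrite mulf_neq0 ?invr_eq0.
  rewrite /conn_at mxE expand_formE mul1r E01 rmorphM fmorphV /= -[- _]add0r.
  by apply: leadingM lQ (leadingV lP w0).
rewrite conn_at_oo01 E01 rmorphM fmorphV /=.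
have lead_lX k : leading (lX C k) k 1.
  by split; [apply: lge_lX | rewrite lcoef_lmonom eqxx].
exists (- 1); first by rewrite oppr_eq0 oner_eq0.
have n3 := ntot_ge3 nu_ge2 n_gt0.
have := leadingM (leadingM (lead_lX (-2)) (leadingM (leading_Q1_oo m) (leadingV (leading_PP_oo m) (oner_neq0 _)))) (lead_lX (- 1%:Z)).
rewrite invr1 !mulr1 (_ : -2 + (- (ntot - 3)%N%:Z - ((n None)%:Z - ntot%:Z)) + - 1%:Z = - (n None)%:Z); last by lia.
by case=> h1 h2; rewrite !mulNr; split; [apply: lgeN | rewrite lcoefN h2].
Qed.

Definition psi1 i m' : 'M[L]_2 := invmx (Gt_at i m') *m psi_amp Phi Xi i m'.

Lemma psi1_lunit i : lunitmx (psi1 i m).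
Proof.
apply: lunitmxM; first exact: lunitmxV (Gt_at_lunit i).
exact: (psi_amp_lunit).
Qed.

Lemma psi1_solution i : formal_solution (conn_at 1 (pole m i) (Om1 Om m)) (psi1 i m)
  (dg (lam' theta0 thh i m)).
Proof.
have uG := lunitmx_unit (Gt_at_lunit i).
have [_ _ _ sol] := Xi_framing i hm.
have GF : Gt_at i m *m psi1 i m = psi_amp Phi Xi i m by rewrite /psi1 mulKVmx.
have sol' : map_mx (@dz C) (Gt_at i m *m psi1 i m) + Om_at Om i m *m (Gt_at i m *m psi1 i m)
    = Gt_at i m *m psi1 i m *m dg (lam' theta0 thh i m).
  by rewrite GF; move/eqP: sol; rewrite subr_eq0 => /eqP.
have := gauge_solution (map_derivM (@dzB C) (@dzM C)) (mulmxV uG) sol'.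
move/(can_inj (mulKmx uG)) => E.
by rewrite /formal_solution conn1E; apply/eqP; rewrite subr_eq0; apply/eqP.
Qed.

Lemma Om_regular (c : C) : (forall i, c != tpt m i) -> (forall j, c != qq m j) ->
  mlge 0 (map_mx (expand (Some c)) (Om m)).
Proof.
move=> ct cq; have [Cf [Df [Coo [Doo [Ct [_ -> _ _]]]]]] := Om_normal hm.
rewrite map_mx2; apply: mlge_mx2; first by rewrite rmorph0; apply: lge0.
- rewrite fmorphV; have [u u0] := leading_PP m c.
  rewrite big1 => [lP|i _]; last by rewrite (negPf (ct i)) mul0r.
  by have [] := leadingV lP u0; rewrite oppr0.
- rewrite !rmorphD !rmorph_sum /=; do !apply: lgeD.
  + by apply: lge_sum => i _; apply: lge_ratio_at.
  + by apply: lge_sum => j _; apply: lge_ratio_at.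
  + by rewrite expand_poly; apply: lge_pexpand.
  + by rewrite expand_poly; apply: lge_pexpand.
rewrite rmorphD rmorphB !rmorph_sum /=; apply: lgeD; first apply: lgeB.
+ by apply: lge_sum => i _; apply: lge_ratio_at.
+ by apply: lge_sum => j _; apply: lge_ratio_at.
by rewrite expand_poly; apply: lge_pexpand.
Qed.

Lemma Gt_regular (c : C) : mlge 0 (map_mx (expand (Some c)) (Gt m)).
Proof.
rewrite /Gt map_mx2 rmorph1 rmorph0.
by apply: mlge_mx2; rewrite ?expand_poly; try apply: lge_pexpand; [apply: lge1 | apply: lge0].
Qed.

Lemma Gt_lunit_at (c : C) : (forall j, c != qq m j) ->
  lunitmx (map_mx (expand (Some c)) (Gt m)).
Proof.
move=> cq; split; first exact: Gt_regular.
have [u u0] := leading_Q1 m c; rewrite big1 => [[h1 hu]|j _]; last by rewrite (negPf (cq j)).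
by rewrite det_map_mx det2E !mxE /= mul1r mul0r subr0 hu.
Qed.

Lemma gauge_regular (A G : 'M[L]_2) : mlge 0 A -> lunitmx G ->
  mlge 0 (gauge_transform (@dz C) G A).
Proof.
move=> hA uG; have [hG _] := uG; have hGi := lunitmx_inv_ge uG.
apply: mlgeD; first exact: mlgeMl hGi (mlge_dz hG).
by apply: mlgeMr hG; apply: mlgeMl.
Qed.

(** At q_j write [Gt m = P *m U] with [P] the gauge of the apparent singularity condition. The
    factor [U] is holomorphic and invertible at q_j because Q_2(q_j) = p_j and Q_1 has a simple zero
    there. *)
Lemma Om1_regular (c : C) : (forall i, c != tpt m i) ->
  mlge 0 (map_mx (expand (Some c)) (Om1 Om m)).
Proof.
move=> ct; have scale1 (M : 'M[K]_2) : jac (Some c) *: map_mx (expand (Some c)) M =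
  map_mx (expand (Some c)) M by rewrite scale1r.
have [[j cj]|cq] := pselect (exists j, c = qq m j); last first.
  have {}cq j : c != qq m j by apply/eqP => cj; apply: cq; exists j.
  rewrite -scale1 /Om1 (map_expand_gauge (Some c) (Om m) (Gt_unit m)) scale1.
  by apply: gauge_regular; [apply: Om_regular | apply: Gt_lunit_at].
have [Cf [Df [Coo [Doo [Ct [_ _ ap _]]]]]] := Om_normal hm.
pose y := xK C - cK (qq m j); have y0 : y != 0 := xK_sub_neq0 (qq m j).
pose P : 'M[K]_2 := mx2 1 0 (cK (pp m j)) y.
have [uP _] := invmx_lower (cK (pp m j)) y0.
pose U : 'M[K]_2 := mx2 1 0 ((tofrac (Q2 m) - cK (pp m j)) / y) (tofrac (Q1 m) / y).
have GE : Gt m = P *m U.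
  rewrite /P /U mulmx2 !(mul1r, mul0r, mulr0, mulr1, addr0, add0r).
  rewrite (mulr_divK (tofrac (Q2 m) - cK (pp m j)) y0) (mulr_divK (tofrac (Q1 m)) y0).
  by rewrite [cK _ + _]addrC subrK.
have uU : U \in unitmx.
  by have := Gt_unit m; rewrite GE unitmx_mul => /andP[].
rewrite -scale1 /Om1 GE (gauge_transform_comp (@dxB C) (@dxM C) (Om m) uP uU).
rewrite (map_expand_gauge (Some c) _ uU) scale1; apply: gauge_regular.
  by rewrite cj => a b; have := ap j a b; rewrite !mxE expand_formE mul1r.
have ly := leading_sub (qq m j) (qq m j); rewrite eqxx /= in ly.
have [u u0] := leading_Q1 m c; rewrite cj qq_qq => lQ.
have lU := leadingM lQ (leadingV ly (oner_neq0 _)); rewrite subrr invr1 mulr1 in lU.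
have yV : expand (Some (qq m j)) y^-1 = (expand (Some (qq m j)) y)^-1 by rewrite fmorphV.
rewrite /U map_mx2 rmorph1 rmorph0; apply: det_lunitmx2.
- exact: lge1.
- exact: lge0.
- rewrite rmorphM /= yV (_ : 0 = 1 - 1); last by rewrite subrr.
  have [hy hy1] := ly; apply: lge_div; rewrite ?hy1 ?oner_neq0 //.
  rewrite rmorphB /= expand_poly expandC => k k1.
  have [k0|k0|->] := ltgtP k 0; last 1 first.
  + by rewrite lcoefB pexpand_coef0 Q2_value lcoef_lmonom eqxx subrr.
  + by apply: lgeB k0; [apply: lge_pexpand | apply: lge_lC].
  + by move: k0 k1; lia.
- by rewrite rmorphM /= yV; case: lU.
by rewrite rmorphM /= yV; case: lU => _ ->; rewrite lcoef0 lcoef1 eqxx mul1r mul0r subr0.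
Qed.
End AtPoint.

(** * Parameter derivatives on E_1 *)

Section ModifiedDerivative.
Variable m : param C n.
Hypothesis hm : dom theta0 m.
Variable v : param C n.
Local Notation line := (line m v).
Local Notation sing := (sing m v).
Local Notation near_dom := (dom_near v hm).

Lemma mgderD (F G : param C n -> 'M[K]_2) (F' G' : 'M[K]_2) : mgder m v F F' -> mgder m v G G' ->
  mgder m v (fun m => F m + G m) (F' + G').
Proof.
move=> dF dG a b; rewrite mxE; have := gderD (dF a b) (dG a b).
by apply: gder_ext => h; rewrite mxE.
Qed.

Lemma mgder_dx (F : param C n -> 'M[K]_2) (F' : 'M[K]_2) : mgder m v F F' ->
  mgder m v (fun m => map_mx (@dx C) (F m)) (map_mx (@dx C) F').
Proof.
move=> dF a b; rewrite mxE; have := gder_dx (dF a b).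
by apply: gder_ext => h; rewrite mxE.
Qed.

Lemma Gt_smooth (q2 q1 : K) :
  gder sing (fun h => tofrac (Q2 (line h))) q2 ->
  gder sing (fun h => tofrac (Q1 (line h))) q1 ->
  mgder m v (fun m => Gt m) (mx2 0 0 q2 q1).
Proof.
move=> d2 d1; apply: (mgder_mx2 (p := fun=> 1) (q := fun=> 0)
  (r := fun m => tofrac (Q2 m)) (s := fun m => tofrac (Q1 m))) => //.
  exact: gder1.
exact: gder0.
Qed.

Lemma invGt_smooth : exists D, mgder m v (fun m => invmx (Gt m)) D.
Proof.
have [q2 d2] : smooth m v (fun m => tofrac (Q2 m)) by apply: (smooth_Q2 _ hm).
have [iq dq] : smooth m v (fun m => (tofrac (Q1 m))^-1) by apply: smooth_Q1V.
have [r dr] : smooth m v (fun m => - tofrac (Q2 m) / tofrac (Q1 m)).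
  by eexists; apply: gderM (gderN d2) dq.
exists (mx2 0 0 r iq).
have := mgder_mx2 (p := fun=> 1) (q := fun=> 0)
  (r := fun m => - tofrac (Q2 m) / tofrac (Q1 m)) (s := fun m => (tofrac (Q1 m))^-1)
  (@gder1 C sing) (@gder0 C sing) dr dq.
by apply: mgder_near; apply: near0T => h; rewrite invGtE.
Qed.

Lemma Om1_smooth : exists D1, mgder m v (Om1 Om) D1.
Proof.
have [D dO] := Om_smooth hm v.
have [q2 d2] : smooth m v (fun m => tofrac (Q2 m)) by apply: (smooth_Q2 _ hm).
have [q1 d1] : smooth m v (fun m => tofrac (Q1 m)) by apply: smooth_Q1.
have dG := Gt_smooth d2 d1; have [V dV] := invGt_smooth.
by eexists; apply: (mgderD (mgderM dV (mgder_dx dG)) (mgderM (mgderM dV dO) dG)).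
Qed.

Lemma Om1_derivative (D GD D1 : 'M[K]_2) : mgder m v Om D ->
    mgder m v (fun m => Gt m) GD -> mgder m v (Om1 Om) D1 ->
  Gt m *m D1 = D *m Gt m + Gt m *m nabmx (@dx C) (Om1 Om m) (invmx (Gt m) *m GD).
Proof.
move=> dO dG d1; have uG := Gt_unit m.
have L1 := mgderM dG d1.
have L2 := mgderD (mgder_dx dG) (mgderM dO dG).
have E : GD *m Om1 Om m + Gt m *m D1 = map_mx (@dx C) GD + (D *m Gt m + Om m *m GD).
  apply: mgder_uniq L1 (mgder_near _ L2); apply: near0T => h.
  by rewrite /Om1 (mulmx_gauge (@dx C) (Om (line h)) (Gt_unit (line h))).
exact: (derivative_gauge (map_derivM (@dxB C) (@dxM C)) (mulmxV uG) E).
Qed.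

Lemma mlder_local_gauge k l i (F : param C n -> 'M[K]_2) (F' : 'M[K]_2) : mgder m v F F' ->
  exists D, mlder (fun h => local_gauge k l (pole (line h) i) (F (line h))) D.
Proof.
move=> dF; have pe := adm_pole v hm i.
have dE : exists D, mlder (fun h => map_mx (expand (pole (line h) i)) (F (line h))) D.
  eexists (map_mx (expand (pole (line 0) i)) F' + lC (dpole v i) *:
    map_mx (@dz C) (map_mx (expand (pole (line 0) i)) (F m))) => a b.
  rewrite !mxE; have := dF a b _ _ pe; rewrite line0.
  by apply: lder_ext => h; rewrite mxE.
have [D dD] := dE; case: (i) dD => [j|] dD.
  eexists; apply: mlder_ext dD => h.
  by rewrite /local_gauge /= invmx1 mul1mx mulmx1.
by eexists; apply: mlderM (mlderM (mlder_cst (invmx (Gam k None))) dD) (mlder_cst (Gam l None)).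
Qed.

Lemma psi1_smooth i : exists D, mlder (fun h => psi1 i (line h)) D.
Proof.
have [V dV] := invGt_smooth; have [W dW] := mlder_local_gauge 1 nn i dV.
have [F dF] := psi_amp_smooth hm v i.
exists (W *m psi_amp Phi Xi i (line 0) + local_gauge 1 nn (pole (line 0) i) (invmx (Gt (line 0))) *m F).
apply: mlder_ext (mlderM dW dF) => h; rewrite /psi1; congr (_ *m _).
by rewrite Gt_atE (local_gauge_inv nn 1 (pole (line h) i) (Gt_unit (line h))).
Qed.

(** Splits the logarithmic derivative of the solution on E_1 into a holomorphic term and the term of
    delta(Lambda), which alone can have a pole and is compared with [hV] in
    [deformation_holomorphic]. *)
Lemma psi1_flat i (D1 : 'M[K]_2) : mgder m v (Om1 Om) D1 ->
  exists2 F1 : 'M[L]_2, mlge 0 F1 &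
   nabmx (@dz C) (conn_at 1 (pole m i) (Om1 Om m))
     (F1 *m invmx (psi1 i m)
      - psi1 i m *m dg (dlt_lam theta0 thh v i m) *m invmx (psi1 i m))
   = - (jac (pole m i) *: end_at 1 (pole m i) D1).
Proof.
move=> d1; have [F' dF] := psi1_smooth i.
have [ld dl] := lam'_smooth hm v i.
have lun m' : dom theta0 m' -> lunitmx (psi1 i m').
  by move=> hm'; apply: (psi1_lunit hm').
have u := lunitmx_unit (lun m hm).
pose e := dpole v i.
pose F1 := F' - lC e *: map_mx (@dz C) (psi1 i m).
have dF1 : mlder (fun h => psi1 i (line h))
    (F1 + lC e *: map_mx (@dz C) (psi1 i m)) by rewrite subrK.
have dA := mlder_conn_at 1 d1 (adm_pole v hm i).
exists F1.
  have hF' : mlge 0 F'.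
    move=> a b; apply: lder_lge (dF a b); apply: near0_imp near_dom => h hh.
    by have [hF _] := lun _ hh; apply: hF.
  apply: mlgeB hF' _ => a b; rewrite mxE -[0]add0r; apply: lgeM (@lge_lC C e) _.
  by have [hF _] := lun _ hm; rewrite mxE; apply: lge0_dz.
have := @nabla_of_solution C (fun h => conn_at 1 (pole (line h) i) (Om1 Om (line h)))
  (fun h => psi1 i (line h))
  (fun h => lam' theta0 thh i (line h)) e (jac (pole m i) *: end_at 1 (pole m i) D1) F1
  (fun a => ld a - lC e * dz (lam' theta0 thh i m a)) (dlt_lam theta0 thh v i m).
rewrite !line0 in dA *; apply => //.
- by apply: near0_imp near_dom => h hh; apply: (psi1_solution hh).
- by move=> a; rewrite subrK.
- by move=> a; exact: (dz_dlt_lam (dl a)).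
Qed.

(** A common lower bound survives coefficientwise differentiation, and the correction in [dz]
    preserves power series. *)
Lemma regular_derivative (F : param C n -> 'M[K]_2) (F' : 'M[K]_2) p e :
    mgder m v F F' -> adm sing p e ->
    near0 (fun h => mlge 0 (map_mx (expand (p h)) (F (line h)))) ->
  mlge 0 (map_mx (expand (p 0)) F').
Proof.
move=> dF pe reg a b; rewrite mxE.
have reg' : near0 (fun h => lge 0 (expand (p h) (F (line h) a b))).
  by apply: near0_imp reg => h /(_ a b); rewrite mxE.
have h1 := lder_lge reg' (dF a b _ _ pe); have h0 := near0_at0 reg'.
rewrite -[expand _ _](addrK (lC e * dz (expand (p 0) (F (line 0) a b)))).
apply: lgeB h1 _; rewrite -[0]add0r; apply: lgeM (@lge_lC C e) (lge0_dz h0).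
Qed.

(** A constant centre is inadmissible if [c] is a t_i or q_j, since that point may move off; the
    centre then follows it. In this way regularity can be differentiated at every finite point, in
    particular at the apparent singularities. *)
Lemma adm_fin (c : C) : exists p e, [/\ adm sing p e, p 0 = Some c,
  forall h, p h != None,
  (forall i, c != tpt m i) -> near0 (fun h => forall i, p h != Some (tpt (line h) i)) &
  (forall j, c != qq m j) -> near0 (fun h => forall j, p h != Some (qq (line h) j))].
Proof.
have key (p : C -> C) (e : C) : sder p e -> p 0 = c ->
   [/\ (forall i, c != tpt m i) -> near0 (fun h => forall i, Some (p h) != Some (tpt (line h) i)) &
  (forall j, c != qq m j) -> near0 (fun h => forall j, Some (p h) != Some (qq (line h) j))].
  move=> dp p0; split=> cp; apply: near0_forall => i.
    apply: near0_imp (near_neq (ex_intro _ _ dp) (ex_intro _ _ (sder_tpt m v i)) _) => [h|].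
      by apply: contraNneq => -[->].
    by rewrite p0 line0.
  apply: near0_imp (near_neq (ex_intro _ _ dp) (ex_intro _ _ (sder_co m v (inl (inl i)))) _) => [h|].
    by apply: contraNneq => -[->].
  by rewrite p0 line0; apply: cp.
have [[i ci]|ct] := pselect (exists i, c = tpt m i).
  exists (fun h => Some (tpt (line h) i)), (dtpt v i).
  have [] := key (fun h => tpt (line h) i) _ (sder_tpt m v i); first by rewrite line0.
  by split=> //; [apply: (adm_pole v hm (Some i)) | rewrite line0 ci].
have [[j cj]|cq] := pselect (exists j, c = qq m j).
  exists (fun h => Some (qq (line h) j)), (qq v j).
  have [] := key (fun h => qq (line h) j) _ (sder_co m v (inl (inl j))); first by rewrite line0.
  by split=> //; [apply: (adm_qq v hm j) | rewrite line0 cj].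
exists (fun=> Some c), 0.
have [] := key (fun=> c) _ (sder_cst c) (erefl _).
split=> //; apply: adm_cst => [i|j]; apply/eqP => E.
  by apply: ct; exists i.
by apply: cq; exists j.
Qed.

Lemma Om1_derivative_regular (D1 : 'M[K]_2) (c : C) : mgder m v (Om1 Om) D1 ->
  (forall i, c != tpt m i) -> mlge 0 (map_mx (expand (Some c)) D1).
Proof.
move=> d1 ct; have [p [e [pe p0 pN ht _]]] := adm_fin c.
rewrite -p0; apply: regular_derivative d1 pe _.
apply: near0_imp2 near_dom (ht ct) => h hh hp.
case: (p h) (pN h) hp => // c' _ hp; apply: (Om1_regular hh) => i.
by apply: contraNneq (hp i) => ->.
Qed.

Lemma Om_derivative_regular (D : 'M[K]_2) (c : C) : mgder m v Om D ->
  (forall i, c != tpt m i) -> (forall j, c != qq m j) ->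
  mlge 0 (map_mx (expand (Some c)) D).
Proof.
move=> d1 ct cq; have [p [e [pe p0 pN ht hq]]] := adm_fin c.
rewrite -p0; apply: regular_derivative d1 pe _.
apply: near0_imp2 (near0_and near_dom (ht ct)) (hq cq) => h [hh hp] hq'.
case: (p h) (pN h) hp hq' => // c' _ hp hq'; apply: (Om_regular hh) => i.
  by apply: contraNneq (hp i) => ->.
by apply: contraNneq (hq' i) => ->.
Qed.

Lemma Gt_derivative_regular (GD : 'M[K]_2) (c : C) : mgder m v (fun m => Gt m) GD ->
  mlge 0 (map_mx (expand (Some c)) GD).
Proof.
move=> dG; have [p [e [pe p0 pN _ _]]] := adm_fin c.
rewrite -p0; apply: regular_derivative dG pe _; apply: near0T => h.
by case: (p h) (pN h) => // c' _; apply: Gt_regular.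
Qed.
End ModifiedDerivative.

(** * First-order content of the gluing datum *)

Section IsomonodromicVector.
Variable m : param C n.
Hypothesis hm : dom theta0 m.
Variables (s : tcoord n) (v : param C n).
Local Notation line := (line m v).
Local Notation sing := (sing m v).

(** The relation [rel] says that a polynomial over the dual numbers is the first-order jet of a
    family; it is multiplicative, so the linear factors of P suffice. *)
Lemma tofrac_PP_eps (P1 : K) : gder sing (fun h => tofrac (PP (line h))) P1 ->
  tofrac_eps (PP_eps m v) = Dual (tofrac (PP m)) P1.
Proof.
pose rel (f : C -> K) (p : {poly dual C}) := gder sing f (tofrac (map_poly (@deps C) p)) /\
  f 0 = tofrac (map_poly (@dre C) p).
have relM f g p q : rel f p -> rel g q -> rel (fun h => f h * g h) (p * q).
  move=> [df f0] [dg g0]; split; last by rewrite f0 g0 !rmorphM.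
  have := gderM df dg; rewrite f0 g0 map_deps_mul rmorphD !rmorphM /= addrC.
  by [].
have rel1 : rel (fun=> 1) 1.
  split; last by rewrite !rmorph1.
  have -> : map_poly (@deps C) 1 = 0.
    by apply/polyP => i; rewrite coef_map coef1 coef0; case: eqP.
  by rewrite rmorph0; apply: gder1.
have relX f p k : rel f p -> rel (fun h => f h ^+ k) (p ^+ k).
  move=> rf; elim: k => [|k IH]; first exact: rel1.
  have -> : (fun h => f h ^+ k.+1) = fun h => f h * f h ^+ k.
    by apply/funext => h; rewrite exprS.
  by rewrite exprS; apply: relM.
have relP : rel (fun h => tofrac (PP (line h))) (PP_eps m v).
  have : rel (fun h => \prod_i (xK C - cK (tpt (line h) i)) ^+ n (Some i)) (PP_eps m v).
    rewrite /PP_eps; elim: (index_enum _) => [|i r IH].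
      have -> : (fun h => \prod_(i <- [::]) (xK C - cK (tpt (line h) i)) ^+ n (Some i)) = fun=> 1.
        by apply/funext => h; rewrite big_nil.
      by rewrite big_nil.
    rewrite big_cons.
    have -> : (fun h => \prod_(j <- i :: r) (xK C - cK (tpt (line h) j)) ^+ n (Some j)) =
       fun h => (xK C - cK (tpt (line h) i)) ^+ n (Some i) *
          \prod_(j <- r) (xK C - cK (tpt (line h) j)) ^+ n (Some j).
      by apply/funext => h; rewrite big_cons.
    apply: (relM _ _ _ _ _ IH); apply: (relX (fun h => xK C - cK (tpt (line h) i))).
    split.
      have -> : map_poly (@deps C) ('X - (Dual (tpt m i) (dtpt v i))%:P) = - (dtpt v i)%:P.
        apply/polyP => k; rewrite coef_map coefN coefC coefB coefX coefC /=.
        by case: k => [|[|k]] /=; rewrite ?oppr0 ?subr0 ?add0r.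
      rewrite rmorphN /= -[tofrac _]/(cK (dtpt v i)) -sub0r.
      by apply: gderB; [apply: gder_xK | apply: gder_cK; apply: sder_tpt].
    by rewrite line0 rmorphB /= map_polyX map_polyC /= rmorphB.
  have -> // : (fun h => \prod_i (xK C - cK (tpt (line h) i)) ^+ n (Some i)) =
     (fun h => tofrac (PP (line h))).
  by apply/funext => h; rewrite tofrac_PP.
move=> dP; have [dP' P0] := relP; rewrite /tofrac_eps (gder_uniq dP dP').
by rewrite -P0 line0.
Qed.
(** These are the eps-parts of the datum: [eta] of the connection, [al] and [be] of the numerators
    in the first row. The last two equations are the Taylor expansions of N_00(q_j^eps) = p_j^eps
    and N_01(q_j^eps) = 0. *)
Lemma IMD_equations (P1 : K) : IMD_vector theta0 Om Phi Xi s m v ->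
    gder sing (fun h => tofrac (PP (line h))) P1 ->
  exists (hU : 'M[L]_2) (hV eta : 'M[K]_2) (al be : {poly C}),
    [/\ mlge 0 hU /\ (forall b, b <> pole m (idx s) -> mlge 0 (end_at 1 b hV)),
        end_at 1 (pole m (idx s)) hV + frakB theta0 Phi Xi s m = hU,
        eta = - nabmx (@dx C) (Om1 Om m) hV,
        (tofrac (PP m) * eta 0 0 + P1 * Om1 Om m 0 0 = tofrac al /\
         tofrac (PP m) * eta 0 1 + P1 * Om1 Om m 0 1 = tofrac be) &
        [/\ forall c : tcoord n, co v (inr c) = (c == s)%:R,
            forall j, al.[qq m j] + qq v j * (Q2 m)^`().[qq m j] = pp v j &
            forall j, be.[qq m j] + qq v j * (Q1 m)^`().[qq m j] = 0]].
Proof.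
move=> [hU [hV [Ome [N [[hU0 _ hV0] glue [e1 _] eN [hv hN01 hN00]]]]]] dP.
exists hU, hV, (map_mx (@deps K) Ome), (map_poly (@deps C) (N 0 0)), (map_poly (@deps C) (N 0 1)).
have [OmE etaE] : map_mx (@dre K) Ome = Om1 Om m /\
    map_mx (@deps K) Ome = - nabmx (@dx C) (Om1 Om m) hV.
  move: e1; rewrite {1}(dmx_eta Ome) map_dmap_dmx !dmxM dmxD => /dmx_inj[].
  rewrite (map_deriv1 (@dxB C) (@dxM C)) !mulmx1 !mul1mx add0r => OmE E; split=> //.
  move: E; rewrite OmE add0r nabmxE => <-.
  exact: add_sub_cancel.
have glueE : end_at 1 (pole m (idx s)) hV + frakB theta0 Phi Xi s m = hU.
  by move: glue; rewrite dmxM => /dmx_inj[_]; rewrite mul1mx mulmx1 addrC.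
have PE := tofrac_PP_eps dP.
have NE a b : tofrac (PP m) * Om1 Om m a b = tofrac (map_poly (@dre C) (N a b)) /\
   tofrac (PP m) * (map_mx (@deps K) Ome) a b + P1 * Om1 Om m a b =
     tofrac (map_poly (@deps C) (N a b)).
  have /matrixP/(_ a b) := eN; rewrite PE mxE [RHS]mxE -OmE !mxE.
  by case: (Ome a b) => x y [<- <-].
have [R00 R01] := Om1_row hm.
have P0 : tofrac (PP m) != 0 :> K.
  by rewrite tofrac_PP; apply/prodf_neq0 => i _; rewrite expf_neq0 // xK_sub_neq0.
have Q2E : map_poly (@dre C) (N 0 0) = Q2 m.
  apply/eqP; rewrite -tofrac_eq -(proj1 (NE 0 0)) R00; apply/eqP; exact: mulr_divK.
have Q1E : map_poly (@dre C) (N 0 1) = Q1 m.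
  apply/eqP; rewrite -tofrac_eq -(proj1 (NE 0 1)) R01; apply/eqP; exact: mulr_divK.
split=> //.
- by split; [apply: (proj2 (NE 0 0)) | apply: (proj2 (NE 0 1))].
split=> // j.
  by have := hN00 j; rewrite horner_dual Q2E => -[].
by have := hN01 j; rewrite horner_dual Q1E => -[].
Qed.
End IsomonodromicVector.

(** * Principal part of the deformed exponents *)

Section LocalDeformation.
Variable m : param C n.
Hypothesis hm : dom theta0 m.
Variables (s : tcoord n) (v : param C n).
Hypothesis hv : forall c : tcoord n, co v (inr c) = (c == s)%:R.
Local Notation line := (line m v).
Local Notation sing := (sing m v).

Definition BB_diag (a : 'I_2) : L :=
  match s with
  | inl i => - \sum_(l < n (Some (val i)))
      lC (th theta0 m (Some (val i)) a l) * lX C (l%:Z - (n (Some (val i)))%:Z)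
  | inr al => let r : int := (n (tag al.2))%:Z - (tagged al.2)%:Z - 1 in
      if a == al.1 then lmonom (- r%:~R^-1) (- r) else 0
  end.

Lemma BB_diagE : BB theta0 s m = dg BB_diag.
Proof. by rewrite /BB /BB_diag; case: s. Qed.

Lemma lge_BB_diag a : lge (- (n (idx s))%:Z) (BB_diag a).
Proof.
rewrite /BB_diag; case: s => [i|[b [i l]]] /=.
  apply: lgeN; apply: lge_sum => l _; rewrite -lmonomE.
  by apply: lge_le (@lge_lmonom _ _ _); lia.
case: ifP => // _; apply: lge_le (@lge_lmonom _ _ _); lia.
Qed.

Lemma dth_ct i a l (i0 : {i : 'I_nu | (1 < i)%N}) : s = ct n i0 -> dth v i a l = 0.
Proof. by move=> sE; rewrite /dth; case: insubP => // l' _ _; rewrite hv sE. Qed.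

Lemma dpole_cth i al : s = inr al -> dpole v i = 0.
Proof.
move=> sE; case: i => [i|] //=; rewrite /dtpt.
by case: insubP => // i' _ _; rewrite hv sE.
Qed.

Lemma dpole_ct i (i0 : {i : 'I_nu | (1 < i)%N}) : s = ct n i0 ->
  dpole v i = (i == Some (val i0))%:R.
Proof.
move=> sE; case: i => [i|] //=; rewrite /dtpt.
case: insubP => [i' _ <-|].
  rewrite hv sE; suff -> : (ct n i' == ct n i0) = (Some (val i') == Some (val i0)) by [].
  by apply/eqP/eqP => [[->]//|[/val_inj ->]].
by case: eqP => // -[->]; rewrite (valP i0).
Qed.

Lemma lam_der_negative i a (ld : L) k :
    lder (fun h => lam' theta0 thh i (line h) a) ld -> (k < 0)%R ->
  ld (k - 1) = if k - 1 + (n i)%:Z is Posz l then dth v i a l else 0.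
Proof.
move=> dl k0; case E : (k - 1 + _) => [l|l].
  rewrite (_ : k - 1 = l%:Z - (n i)%:Z); last by lia.
  by apply: (lam_der_coef _ dl); lia.
by rewrite (lge_lam_der dl) //; lia.
Qed.

(** Explains the choice of [BB]: varying theta_l gives a primitive of z^(l - n_i), and varying t_i
    gives minus the z-derivative of Lambda, since the derivative of x - t_i with x fixed is -1. *)
Lemma dlt_lam_principal i a :
  lge 0 (dlt_lam theta0 thh v i m a - (if i == idx s then BB_diag a else 0)).
Proof.
have [ld dl] := lam'_smooth hm v i.
move=> k k0; rewrite lcoefB (lcoef_dlt_lam k (dl a)) (lam'E _ _).
have kE := lam_der_negative (dl a) k0. rewrite kE {kE}.
rewrite ifF; last by lia.
case sE : s => [i0|[b [i0 l0]]].
  rewrite (dpole_ct i sE).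
  have -> : (if k - 1 + (n i)%:Z is Posz l then dth v i a l else 0) = 0.
    by case: (k - 1 + _) => // l; apply: dth_ct sE.
  rewrite mul0r sub0r; case: eqP => [iE|_] /=; last by rewrite mul0r lcoef0 oppr0 addr0.
  rewrite /BB_diag sE lcoefN lcoef_principal -iE mul1r; apply/eqP; rewrite subr_eq0; apply/eqP.
  case E : (k + _) => [l|//]; rewrite /theta (_ : (l < n i)%N = true) //.
  by apply/idP; lia.
rewrite (dpole_cth i sE) mul0r subr0 /BB_diag sE /=.
case: (i =P i0) => [iE|iN]; last first.
  rewrite subr0; case: (k - 1 + _) => [l|_]; last by rewrite mul0r.
  rewrite /dth; case: insubP => [l' _ _|_]; last by rewrite mul0r.
  rewrite hv sE; case: eqP => [[_ E]|]; last by rewrite mul0r.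
  by case: iN; rewrite -E.
subst i0; case E : (k - 1 + _) => [l|l]; last first.
  rewrite mul0r sub0r; case: (a == b); last by rewrite lcoef0 oppr0.
  rewrite lcoef_lmonom ifF ?oppr0 //.
  by have := ltn_ord l0; lia.
have ln : (l < (n i).-1)%N by lia.
rewrite /dth insubT /= hv sE.
have -> : (cth a (Ordinal ln) == inr (b, existT _ i l0)) = (a == b) && (l == l0 :> nat).
  apply/eqP/andP => [[-> /eqP]|[/eqP -> /eqP ll]].
    by rewrite eq_Tagged /= => /eqP/(congr1 val) /= ->.
  by rewrite /cth; congr (inr (_, Tagged _ _)); apply: val_inj.
case: eqP => [_|_] /=; last by rewrite mul0r subrr.
rewrite lcoef_lmonom.
have -> : (k == - ((n i)%:Z - (nat_of_ord l0)%:Z - 1)) = (l == nat_of_ord l0).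
  by apply/eqP/eqP => [kE|lE]; move: E; [rewrite kE | rewrite lE]; lia.
case: eqP => [ll|_]; last by rewrite mul0r subrr.
rewrite (_ : (n i)%:Z - (nat_of_ord l0)%:Z - 1 = - k); last by move: E; rewrite ll; lia.
by rewrite mulrNz invrN opprK mul1r subrr.
Qed.

Lemma pole_inj : injective (pole m).
Proof. by have [tI _ _ _] := hm; move=> [i|] [j|] //= [/tI ->]. Qed.

Lemma dgB (f g : 'I_2 -> L) : dg f - dg g = dg (fun a => f a - g a).
Proof. by apply/matrixP => a b; rewrite !mxE; case: eqP; rewrite ?mulr1n ?mulr0n ?subr0. Qed.

(* At the pole of s, truncating psi1 does not change the principal part of
   psi1 BB psi1^-1, which is that of psi1 delta(Lambda) psi1^-1. *)
Lemma deformation_holomorphic i (F1 hU : 'M[L]_2) (hV : 'M[K]_2) :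
    mlge 0 F1 -> mlge 0 hU ->
    (forall b, b <> pole m (idx s) -> mlge 0 (end_at 1 b hV)) ->
    end_at 1 (pole m (idx s)) hV + frakB theta0 Phi Xi s m = hU ->
  mlge 0 (F1 *m invmx (psi1 i m)
    - psi1 i m *m dg (dlt_lam theta0 thh v i m) *m invmx (psi1 i m)
    - end_at 1 (pole m i) hV).
Proof.
move=> hF hUh hVh glue; set T := psi1 i m.
have uT : lunitmx T := psi1_lunit hm i.
have [hT _] := uT; have hTi := lunitmx_inv_ge uT.
pose bb a : L := if i == idx s then BB_diag a else 0.
have hd : mlge 0 (dg (dlt_lam theta0 thh v i m) - dg bb).
  by rewrite dgB; apply: mlge_dg => a; apply: dlt_lam_principal.
have h1 : mlge 0 (F1 *m invmx T) by apply: mlgeMr.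
have h2 : mlge 0 (T *m (dg (dlt_lam theta0 thh v i m) - dg bb) *m invmx T).
  by apply: mlgeMr hTi; apply: mlgeMl hT hd.
suff h3 : mlge 0 (T *m dg bb *m invmx T + end_at 1 (pole m i) hV).
  have := mlgeB (mlgeB h1 h2) h3.
  by rewrite mulmxBr mulmxBl sub_cancel.
rewrite /bb; case: (i =P idx s) => [iE|iN]; last first.
  have -> : dg (fun=> 0 : L) = 0 by apply/matrixP => a b; rewrite !mxE mul0rn.
  rewrite mulmx0 mul0mx add0r; apply: hVh => /pole_inj; exact: iN.
rewrite -/BB_diag (_ : dg _ = BB theta0 s m); last by rewrite BB_diagE.
have hB : mlge (- (n i)%:Z) (BB theta0 s m).
  by rewrite BB_diagE iE; apply: mlge_dg => a; apply: lge_BB_diag.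
have := mlgeD (conj_truncation (n_gt0 i) uT hB) hUh.
rewrite -glue /frakB -iE [_ + _ in X in _ -> X]addrC.
by rewrite [end_at _ _ _ + _]addrC addrA subrK addrC.
Qed.
End LocalDeformation.

(** * Rigidity on E_1 *)

Section Rigidity.
Variable m : param C n.
Hypothesis hm : dom theta0 m.
Variables (s : tcoord n) (v : param C n).
Local Notation line := (line m v).
Local Notation sing := (sing m v).

(** Chain rule at the moving point: differentiating the value at q_j adds the velocity of q_j times
    the x-derivative. *)
Lemma derivative_at_qq (f : param C n -> {poly C}) (f' : K) (d : C) j :
    gder sing (fun h => tofrac (f (line h))) f' ->
    sder (fun h => (f (line h)).[qq (line h) j]) d ->
  expand (Some (qq m j)) f' 0 = d - qq v j * (f m)^`().[qq m j].
Proof.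
move=> df fd; have [_ /(_ 0)] := df _ _ (adm_qq v hm j).
rewrite line0 lcoefD lcoef_lCM expand_poly dz_pexpand mul1r pexpand_coef0 => E.
have E' := sder_ext (fun h => _ : expand (Some (qq (line h) j)) (tofrac (f (line h))) 0 = _) E.
rewrite -[X in X - _](sder_uniq (E' (fun h => (f (line h)).[qq (line h) j]) _) fd) ?addrK //.
by move=> h; rewrite expand_poly pexpand_coef0.
Qed.

Lemma div_Q1_regular (f : K) : (forall c, lge 0 (expand (Some c) f)) ->
    (forall j, expand (Some (qq m j)) f 0 = 0) ->
  forall c, lge 0 (expand (Some c) (f / tofrac (Q1 m))).
Proof.
move=> freg fq c; rewrite rmorphM fmorphV /=.
have [u u0] := leading_Q1 m c.
have [[j ->]|cq] := pselect (exists j, c = qq m j); last first.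
  rewrite big1 => [[h1 h2]|j _]; last by case: eqP => // cj; case: cq; exists j.
  by apply: (lge_div (freg c) h1); rewrite h2.
rewrite (qq_qq hm) => -[h1 h2].
have f1 : lge 1 (expand (Some (qq m j)) f).
  move=> k k1; have [k0|k0|->] := ltgtP k 0; last exact: fq.
    exact: freg.
  by move: k0 k1; lia.
by rewrite -[0](subrr 1); apply: (lge_div f1 h1); rewrite h2.
Qed.

Lemma PP_neq0 : tofrac (PP m) != 0 :> K.
Proof. by rewrite tofrac_PP; apply/prodf_neq0 => i _; rewrite expf_neq0 // xK_sub_neq0. Qed.

Lemma gder_PPV (P1 : K) : gder sing (fun h => tofrac (PP (line h))) P1 ->
  gder sing (fun h => (tofrac (PP (line h)))^-1) (- (P1 / tofrac (PP m) ^+ 2)).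
Proof.
move=> dP; have [pv dV] := smooth_PPV m v.
suff <- : pv = - (P1 / tofrac (PP m) ^+ 2) by [].
have E : P1 / tofrac (PP m) + tofrac (PP m) * pv = 0.
  have := gderM dP dV; rewrite line0 => dE; apply: gder_uniq dE _.
  apply: gder_ext (@gder1 C sing) => h; rewrite mulfV // tofrac_PP.
  by apply/prodf_neq0 => i _; rewrite expf_neq0 // xK_sub_neq0.
by apply: (mulfI PP_neq0); apply: (addrI (P1 / tofrac (PP m))); rewrite E mulr_deriv_inv ?PP_neq0 // subrr.
Qed.

Lemma Om1_derivative_row (D1 : 'M[K]_2) (q2 q1 P1 : K) : mgder m v (Om1 Om) D1 ->
    gder sing (fun h => tofrac (Q2 (line h))) q2 ->
    gder sing (fun h => tofrac (Q1 (line h))) q1 ->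
    gder sing (fun h => tofrac (PP (line h))) P1 ->
  D1 0 0 = q2 * (tofrac (PP m))^-1 + tofrac (Q2 m) * - (P1 / tofrac (PP m) ^+ 2) /\
  D1 0 1 = q1 * (tofrac (PP m))^-1 + tofrac (Q1 m) * - (P1 / tofrac (PP m) ^+ 2).
Proof.
move=> d1 dq2 dq1 dP; have dV := gder_PPV dP.
have := gderM dq2 dV; have := gderM dq1 dV; rewrite line0 => e1 e2.
split; [apply: gder_uniq (d1 0 0) (gder_near _ e2) | apply: gder_uniq (d1 0 1) (gder_near _ e1)];
  apply: near0_imp (dom_near v hm) => h hh; have [E0 E1] := Om1_row hh; by rewrite (E0, E1).
Qed.

Lemma end_at_fin k (c : C) (X : 'M[K]_2) : end_at k (Some c) X = map_mx (expand (Some c)) X.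
Proof. by []. Qed.

(** Algebraic closedness enters only through this statement and the residue theorem; both are
    supplied for [R[i]] in the final theorem. *)
Hypothesis liouville : forall f : K, (forall c, lge 0 (expand (Some c) f)) ->
  lge 1 (expand None f) -> f = 0.

(* An infinitesimal deformation y of the connection on E_1 that fixes the
   formal data and the first row of the connection matrix is trivial: its trace
   and then its lower left entry are holomorphic on P^1 and vanish at oo. *)
Lemma rigidity (y k : 'M[K]_2) :
    (forall c, mlge 0 (map_mx (expand (Some c)) k)) -> k 0 0 = 0 -> k 0 1 = 0 ->
    y 0 0 = 0 -> y 0 1 = 0 ->
    (forall i, exists2 zeta : 'M[L]_2, mlge 0 zeta &
      nabmx (@dz C) (conn_at 1 (pole m i) (Om1 Om m)) (zeta + end_at 1 (pole m i) k) =
      - (jac (pole m i) *: end_at 1 (pole m i) y)) ->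
    (forall c, (forall i, c != tpt m i) -> mlge 0 (map_mx (expand (Some c)) y)) ->
  y = 0.
Proof.
move=> kreg k00 k01 y00 y01 hz yreg.
pose A i := conn_at 1 (pole m i) (Om1 Om m).
have hA i : mlge (- (n i)%:Z) (A i) by apply: (conn1_ge hm).
have hA01 i : exists2 u, u != 0 & leading (A i 0 1) (- (n i)%:Z) u.
  exact: (leading_conn1 hm).
(* The first row of [y] vanishes, so that of the covariant derivative of [k] is minus that of [z],
   of order at least - n_oo. It equals [A 0 1] times the second row of [k], and [A 0 1] has order
   exactly - n_oo. *)
have koo : mlge 0 (end_at 1 None k).
  have [z z0] := hz None; have [u u0 [hu hu0]] := hA01 None; rewrite /= -/(A None).
  rewrite (nabmxD (@dzB C) (A None) z (end_at 1 None k)).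
  have hn : mlge (- (n None)%:Z) (nabmx (@dz C) (A None) z).
    by apply: mlge_nab z0; [lia | apply: hA].
  set kap := end_at 1 None k.
  have kE : kap = mx2 0 0 (kap 1 0) (kap 1 1).
    by rewrite {1}/kap end_at_oo k00 k01 !rmorph0 mul0r /kap end_at_oo !mxE.
  have yE a : (jac (@None C) *: end_at 1 None y) 0 a = 0.
    rewrite mxE end_at_oo y00 y01 !rmorph0 mul0r !mxE /=.
    by case: ifP; rewrite mulr0.
  have row a : lge (- (n None)%:Z) (A None 0 1 * kap 1 a) -> lge 0 (kap 1 a).
    by rewrite mulrC -[X in lge X _]add0r; apply: lge_divK => //; rewrite hu0.
  have [r0 r1] := nabmx_lower_row (A None) (kap 1 0) (kap 1 1) (@dz0 C).
  move=> E; have key a : nabmx (@dz C) (A None) kap 0 a = - nabmx (@dz C) (A None) z 0 a.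
    have := congr1 (fun M : 'M[L]_2 => M 0 a) E.
    rewrite [X in X = _]mxE [X in _ = X]mxE yE oppr0 => /eqP.
    by rewrite addrC addr_eq0 => /eqP.
  rewrite kE; apply: mlge_mx2; [exact: lge0 | exact: lge0 | | ]; apply: row.
    by rewrite -r0 -kE key; apply: lgeN; apply: hn.
  by rewrite -r1 -kE key; apply: lgeN; apply: hn.
have hxi i : exists2 xi : 'M[L]_2, mlge 0 xi & nabmx (@dz C) (A i) xi =
      - (jac (pole m i) *: end_at 1 (pole m i) y).
  have [z z0 zE] := hz i; exists (z + end_at 1 (pole m i) k) => //.
  by apply: mlgeD z0 _; case: (i) => [j|] //; rewrite end_at_fin.
have reg f : (forall i, lge 0 (expand (Some (tpt m i)) f)) ->
    (forall c, (forall i, c != tpt m i) -> lge 0 (expand (Some c) f)) ->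
    lge 1 (expand None f) -> f = 0.
  move=> ht hc; apply: liouville => c.
  have [[i ->]|ct] := pselect (exists i, c = tpt m i); first exact: ht.
  by apply: hc => i; apply/eqP => ci; apply: ct; exists i.
have y11 : y 1 1 = 0.
  have tr i : lge 0 (jac (pole m i) * expand (pole m i) (y 1 1)).
    have [xi xi0 xiE] := hxi i.
    have := mxtrace_nab (@dzB C) (A i) xi; rewrite xiE.
    have -> : \tr (- (jac (pole m i) *: end_at 1 (pole m i) y)) =
        - (jac (pole m i) * expand (pole m i) (y 1 1)).
      rewrite -scaleNr mxtraceZ mxtrace_end_at mxtrace2E y00 add0r.
      by rewrite mulNr.
    move=> E; rewrite -[X in lge 0 X]opprK E; apply: lgeN; apply: lge0_dz.
    exact: mlge_tr.
  apply: reg => [i|c ct|].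
  - by have := tr (Some i); rewrite /= mul1r.
  - by have := yreg c ct 1 1; rewrite mxE.
  (* The form is regular and dx contributes z^-2, so the function vanishes to order 2 at oo. *)
  have := lgeM (@lge_lX C 2) (tr None); rewrite /= mulrA mulrN lXM.
  rewrite (_ : 2 + (- 2) = 0) ?lX0 ?mulN1r ?addr0 // => h2.
  by rewrite -[expand _ _]opprK; apply: lgeN; apply: lge_le h2.
have y10 : y 1 0 = 0.
  have lower i : lge 0 (jac (pole m i) * end_at 1 (pole m i) y 1 0).
    have [xi xi0 xiE] := hxi i; have [u u0 [hu hu0]] := hA01 i.
    (* Only the lower left entry of [y] is left, so its trace against [A i] is that entry times
       [A i 0 1]; the trace has order at least - n_i and dividing by [A i 0 1] gives regularity. *)
    have := mxtrace_nab_self (@dz C) (A i) xi; rewrite xiE => E.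
    have hE : lge (- (n i)%:Z) (\tr (map_mx (@dz C) xi *m A i)).
      by apply: mlge_tr; apply: mlgeMl (hA i); apply: mlge_dz.
    apply: (@lge_divK C 0 (- (n i)%:Z) _ (A i 0 1)) => //; first by rewrite hu0.
    rewrite add0r -[_ * _]opprK; apply: lgeN.
    suff -> : - (jac (pole m i) * end_at 1 (pole m i) y 1 0 * A i 0 1) =
      \tr (- (jac (pole m i) *: end_at 1 (pole m i) y) *m A i) by rewrite E.
    have Y : end_at 1 (pole m i) y = mx2 0 0 (end_at 1 (pole m i) y 1 0) 0.
      case: (i) => [j|]; first by apply: mx2P; rewrite !mxE ?y00 ?y01 ?y11 ?rmorph0.
      by rewrite /= end_at_oo y00 y01 y11 !rmorph0 mul0r; apply: mx2P; rewrite !mxE.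
    move: Y; set w := end_at _ _ _ 1 0 => ->.
    have -> : - (jac (pole m i) *: mx2 0 0 w 0) = mx2 0 0 (- (jac (pole m i) * w)) 0.
      by apply: mx2P; rewrite !mxE /= ?mulr0 ?oppr0.
    rewrite mxtrace2E (mulmx2E _ _ 0 0) (mulmx2E _ _ 1 1).
    have [-> -> -> ->] := mx2E (0 : L) 0 (- (jac (pole m i) * w)) 0.
    by rewrite !mul0r !add0r addr0 mulNr.
  apply: reg => [i|c ct|].
  - by have := lower (Some i); rewrite /= mul1r end_at_fin mxE.
  - by have := yreg c ct 1 0; rewrite mxE.
  (* The frame of E_1 contributes z and dx contributes z^-2, which leaves a zero of order 1. A
     bundle of larger degree would not give it. *)
  have := lgeM (@lge_lX C 1) (lower None); rewrite /= end_at_oo mxE /=.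
  rewrite mulrA mulrN lXM mulrA mulNr lXM mulNr.
  rewrite (_ : 1 + (- 2) + 1%:Z = 0) ?lX0 ?mul1r ?addr0 // => h2.
  by rewrite -[expand _ _]opprK; apply: lgeN.
by rewrite [y]mx2_eta y00 y01 y10 y11; apply: mx2P; rewrite !mxE.
Qed.
End Rigidity.

(** * Isomonodromic deformations are covariantly exact *)

Section IsomonodromicExactness.
Variable m : param C n.
Hypothesis hm : dom theta0 m.
Variables (s : tcoord n) (v : param C n).
Local Notation line := (line m v).
Local Notation sing := (sing m v).
Hypothesis liouville : forall f : K, (forall c, lge 0 (expand (Some c) f)) ->
  lge 1 (expand None f) -> f = 0.

Lemma IMD_exact (D : 'M[K]_2) : IMD_vector theta0 Om Phi Xi s m v -> mgder m v Om D ->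
  exists2 g : 'M[K]_2, nabmx (@dx C) (Om m) g = D &
    forall c, (forall i, c != tpt m i) -> (forall j, c != qq m j) ->
      mlge 0 (map_mx (expand (Some c)) g).
Proof.
move=> imd dO.
have [D1 d1] := Om1_smooth hm v.
have [q2 dq2] : smooth m v (fun m => tofrac (Q2 m)) by apply: (smooth_Q2 _ hm).
have [q1 dq1] : smooth m v (fun m => tofrac (Q1 m)) by apply: smooth_Q1.
have [P1 dP] : smooth m v (fun m => tofrac (PP m)) by apply: smooth_PP.
have dG := Gt_smooth dq2 dq1; set GD := mx2 0 0 q2 q1 in dG.
have [hU [hV [eta [al [be [[hU0 hV0] glue etaE [ea eb] [hv hal hbe]]]]]]] :=
  IMD_equations hm imd dP.
have GDreg := Gt_derivative_regular hm _ dG.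
have polyreg (p : {poly C}) c : lge 0 (expand (Some c) (tofrac p)).
  by rewrite expand_poly; apply: lge_pexpand.
have q2reg c : lge 0 (expand (Some c) (q2 - tofrac al)).
  by rewrite rmorphB /=; apply: lgeB => //; have := GDreg c 1 0; rewrite !mxE.
have q1reg c : lge 0 (expand (Some c) (q1 - tofrac be)).
  by rewrite rmorphB /=; apply: lgeB => //; have := GDreg c 1 1; rewrite !mxE.
(* Differentiating Q_2(q_j) = p_j gives [q2] the same value at q_j as the datum gives [al]; likewise
   below for Q_1(q_j) = 0 and [be]. *)
have q2at j : expand (Some (qq m j)) (q2 - tofrac al) 0 = 0.
  rewrite rmorphB /= lcoefB expand_poly pexpand_coef0.
  have sd : sder (fun h => (Q2 (line h)).[qq (line h) j]) (pp v j).
    apply: sder_near (sder_co m v (inl (inr j))).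
    by apply: near0_imp (dom_near v hm) => h hh; rewrite (Q2_value hh).
  by rewrite (derivative_at_qq hm dq2 sd) -hal addrK subrr.
have q1at j : expand (Some (qq m j)) (q1 - tofrac be) 0 = 0.
  rewrite rmorphB /= lcoefB expand_poly pexpand_coef0.
  have sd : sder (fun h => (Q1 (line h)).[qq (line h) j]) 0.
    apply: sder_ext (sder_cst 0) => h.
    by rewrite /Q1 horner_prod (bigD1 j) //= !hornerE subrr mul0r.
  by rewrite (derivative_at_qq hm dq1 sd) -(hbe j) addrK subrr.
(* The second row is chosen so that the covariant derivative has first row [(q2 - al, q1 - be)] over
   P, the discrepancy between the actual derivative and the deformation. It is regular because the
   numerators vanish at the simple zeros of Q_1. *)
pose k : 'M[K]_2 := mx2 0 0 ((q2 - tofrac al) / tofrac (Q1 m)) ((q1 - tofrac be) / tofrac (Q1 m)).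
have kreg c : mlge 0 (map_mx (expand (Some c)) k).
  rewrite /k map_mx2; apply: mlge_mx2; rewrite ?rmorph0; try exact: lge0.
    exact: (div_Q1_regular hm q2reg q2at c).
  exact: (div_Q1_regular hm q1reg q1at c).
have hVreg c : (forall i, c != tpt m i) -> mlge 0 (map_mx (expand (Some c)) hV).
  move=> ct; apply: (hV0 (Some c)); case: (idx s) => [i|] //= [ci].
  by have := ct i; rewrite ci eqxx.
have nabreg c (X : 'M[K]_2) : (forall i, c != tpt m i) ->
    mlge 0 (map_mx (expand (Some c)) X) ->
    mlge 0 (map_mx (expand (Some c)) (nabmx (@dx C) (Om1 Om m) X)).
  move=> ct hX; have := nab_conn_at 1 (Some c) (Om1 Om m) X.
  rewrite scale1r !end_at_fin => <-; apply: mlge_nab => //.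
  exact: (Om1_regular hm ct).
pose h := k - hV.
have nabh : nabmx (@dx C) (Om1 Om m) h = nabmx (@dx C) (Om1 Om m) k + eta.
  by rewrite /h (nabmxB (@dxB C)) etaE.
have D1E : D1 = nabmx (@dx C) (Om1 Om m) h.
  apply/eqP; rewrite -subr_eq0; apply/eqP.
  have dx0 : dx (0 : K) = 0 by rewrite -[X in dx X](subrr 0) dxB subrr.
  have [r0 r1] := nabmx_lower_row (Om1 Om m) ((q2 - tofrac al) / tofrac (Q1 m))
    ((q1 - tofrac be) / tofrac (Q1 m)) dx0.
  have [w0 w1] := Om1_row hm.
  have [e0 e1] := Om1_derivative_row hm d1 dq2 dq1 dP.
  have P0 := PP_neq0 m; have Q0 := Q1_neq0 m.
  rewrite w0 in ea; rewrite w1 in eb r0 r1.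
  have row X Y Z a : (X - (Y + Z) : 'M[K]_2) 0 a = X 0 a - (Y 0 a + Z 0 a).
    by rewrite !mxE.
  apply: (rigidity hm liouville (k := k)).
  - exact: kreg.
  - by rewrite mxE.
  - by rewrite mxE.
  - rewrite nabh row -/k r0 e0 (deriv_row_identity q2 P0 ea) (mulr_cancel_div _ _ Q0).
    by rewrite subrr.
  - rewrite nabh row -/k r1 e1 (deriv_row_identity q1 P0 eb) (mulr_cancel_div _ _ Q0).
    by rewrite subrr.
  (* Up to the term of [k], the logarithmic derivative of the solution minus [hV] is a primitive of
     minus the difference, and it is holomorphic. *)
  - move=> i; have [F1 hF1 flat] := psi1_flat hm (v := v) i d1.
    have z0 := deformation_holomorphic hm hv i hF1 hU0 hV0 glue.
    move: flat z0; move: (F1 *m _ - _) => X flat z0.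
    exists (X - end_at 1 (pole m i) hV); first exact: z0.
    exact: (nab_corrected hV k flat).
  move=> c ct; rewrite map_expandB; apply: mlgeB.
    exact: (Om1_derivative_regular hm d1 ct).
  apply: nabreg => //; rewrite /h map_expandB; apply: mlgeB => //.
  exact: hVreg.
have uG := Gt_unit m.
(* Back on E_(n-2): the motion of [Gt] is the infinitesimal gauge transformation
   [invmx (Gt m) *m GD], subtracted before conjugating. *)
exists (Gt m *m (h - invmx (Gt m) *m GD) *m invmx (Gt m)).
  exact: (nabmx_transport (@dxB C) (@dxM C) uG (Om1_derivative dO dG d1) D1E).
move=> c ct cq; have uGc := Gt_lunit_at cq; have [hGc _] := uGc.
have hGi := lunitmx_inv_ge uGc.
rewrite !map_expandM map_expandB map_expandM map_invmx.
have hGG := mlgeMl hGi (GDreg c).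
apply: mlgeMr hGi; apply: mlgeMl hGc _; apply: mlgeB hGG.
by rewrite /h map_expandB; apply: mlgeB => //; apply: hVreg.
Qed.
End IsomonodromicExactness.

(** * Vanishing of the 2-form *)

Section Vanishing.
Variable m : param C n.
Hypothesis hm : dom theta0 m.
Hypothesis liouville : forall f : K, (forall c, lge 0 (expand (Some c) f)) ->
  lge 1 (expand None f) -> f = 0.
Hypothesis residue_theorem : forall (r : seq C) (f : K), uniq r ->
  (forall c, c \notin r -> residue (expand_form (Some c) f) = 0) ->
  \sum_(c <- r) residue (expand_form (Some c) f) + residue (expand_form None f) = 0.

Lemma omega_hat_IMD (s : tcoord n) (v w : param C n) :
  IMD_vector theta0 Om Phi Xi s m v -> omega_hat theta0 Om thh Phi Xi Xiq m v w = 0.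
Proof.
move=> imd; have [D dv] := Om_smooth hm v.
have [Dw dw] := Om_smooth hm w.
have [g gE greg] := IMD_exact
  hm liouville imd dv.
rewrite (omega_hat_exact hm dv dw gE) sum_option addrAC addrC addrA.
set f := \tr (g *m Dw).
(* Away from the t_i and q_j both [g] and [Dw] are regular, so this list carries all finite
   residues. *)
pose r := codom (tpt m) ++ codom (qq m).
have [tI qI qt _] := hm.
have ur : uniq r.
  rewrite cat_uniq (map_inj_uniq tI) (map_inj_uniq qI) !enum_uniq /= andbT.
  apply/hasPn => _ /codomP[j ->]; apply/negP => /codomP[i /eqP].
  by rewrite (negPf (qt j i)).
rewrite -[RHS](residue_theorem ur (f := f)).
  rewrite /r big_cat /= !big_image.
  by rewrite addrAC.
move=> c; rewrite mem_cat negb_or => /andP[ct cq].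
have ct' i : c != tpt m i by apply: contraNneq ct => ->; rewrite codom_f.
have cq' j : c != qq m j by apply: contraNneq cq => ->; rewrite codom_f.
have hD := Om_derivative_regular hm dw ct' cq'.
have := mlge_tr (mlgeM (greg c ct' cq') hD).
rewrite addr0 -map_expandM -(end_at_fin 1 c (g *m Dw)) mxtrace_end_at => h0.
by rewrite expand_formE mul1r /residue h0.
Qed.
End Vanishing.
End Isomonodromy.

Theorem theorem3p10 (R : realType) (nu : nat) (n : option 'I_nu -> nat)
    (theta0 : 'I_2 -> option 'I_nu -> R[i])
    (Om : param R[i] n -> 'M[{fraction {poly R[i]}}]_2)
    (thh : param R[i] n -> option 'I_nu -> 'I_2 -> nat -> R[i])
    (Phi : option 'I_nu -> param R[i] n -> 'M[R[i]]_2)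
    (Xi : option 'I_nu -> param R[i] n -> 'M[laurent R[i]]_2)
    (Xiq : 'I_(ntot n - 3) -> param R[i] n -> 'M[laurent R[i]]_2)
    (nu_ge2 : (2 <= nu)%N)
    (n_gt0 : forall i, (0 < n i)%N)
    (theta0_sum : \sum_i (theta0 0 i + theta0 1 i) = - 1)
    (theta0_nonres : forall i, n i = 1%N ->
      forall k : int, theta0 0 i - theta0 1 i != k%:~R)
    (Om_normal : forall m, dom theta0 m -> normal_form theta0 m (Om m))
    (Phi_framing : forall i, compatible_framing theta0 Om Phi i)
    (Xi_framing : forall i, formal_framing theta0 Om thh Phi Xi i)
    (Xiq_framing : forall j, apparent_framing theta0 Om Xiq j) :
  (forall (a : 'I_2) (i : option 'I_nu) (l : 'I_(n i).-1)
      (dIMD : param R[i] n -> param R[i] n),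
    IMD_field theta0 Om Phi Xi (cth a l) dIMD ->
    forall dhat : param R[i] n -> param R[i] n, vector_field theta0 dhat ->
    forall m, dom theta0 m ->
      omega_hat theta0 Om thh Phi Xi Xiq m (dIMD m) (dhat m) = 0) /\
  (forall (i : {i : 'I_nu | (1 < i)%N})
      (dIMD : param R[i] n -> param R[i] n),
    IMD_field theta0 Om Phi Xi (ct n i) dIMD ->
    forall dhat : param R[i] n -> param R[i] n, vector_field theta0 dhat ->
    forall m, dom theta0 m ->
      omega_hat theta0 Om thh Phi Xi Xiq m (dIMD m) (dhat m) = 0).
Proof.
have liouville (f : {fraction {poly R[i]}}) :
    (forall c, lge 0 (expand (Some c) f)) -> lge 1 (expand None f) -> f = 0.
  exact: regular_eq0.
have residue_theorem (r : seq R[i]) (f : {fraction {poly R[i]}}) : uniq r ->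
    (forall c, c \notin r -> residue (expand_form (Some c) f) = 0) ->
    \sum_(c <- r) residue (expand_form (Some c) f) + residue (expand_form None f) = 0.
  exact: sum_residues.
split=> [a i l|i] dIMD hI dhat _ m hm;
  exact: (omega_hat_IMD nu_ge2 n_gt0 theta0_nonres Om_normal Phi_framing Xi_framing
    Xiq_framing hm liouville residue_theorem (dhat m) (hI m hm)).
Qed.
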